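(* Let $d\ge2$ be an integer and $q$ a prime power. The height zeta function $$Z_\alpha(s)=\int_Y\alpha(x)^s\,d\nu(x)\qquad(s\in\mathbb C)$$ converges absolutely if and only if $\operatorname{Re}(s)<d$. It extends meromorphically to all $s\in\mathbb C$ as a rational function of $u=q^{s/d}$. At $s=d$ it has a simple pole, and $$Z_\alpha(s)=\frac{\kappa_{d,q}}{d-s}+O(1)\qquad(s\to d^-),$$ where $\kappa_{d,q}>0$ is given explicitly by $$\kappa_{d,q}=\frac{d}{\log q}\sum_{j=1}^{d-1}\frac1{j(d-j)}\sum_{z}C\bigl(\{j\}\cup\operatorname{supp}z\bigr)\,q^{-R_j(z)},$$ the inner sum being over all $z=(z_i)_{i\ne j}\in\mathbb Z_{\ge0}^{\{1,\ldots,d-1\}\setminus\{j\}}$.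
   Context: Let $q$ be a prime power, $d\ge2$ an integer, $F=\mathbb F_q(\!(t^{-1})\!)$ with valuation ring $\mathcal O=\mathbb F_q[\![t^{-1}]\!]$ and absolute value normalized by $|t|=q$. Put $G=\operatorname{PGL}_d(F)$, $K=\operatorname{PGL}_d(\mathcal O)$, $\Gamma=\operatorname{PGL}_d(\mathbb F_q[t])$. Haar measure on $G$ is normalized by $\operatorname{vol}(K)=1$. Put $Y=\Gamma\backslash G/K$ (a countable set), and let $\nu$ be the measure on $Y$ induced from the Haar measure of $G$, i.e. the push-forward to $Y$ of the quotient measure on $\Gamma\backslash G$; equivalently each point $\Gamma gK$ has mass $1/|\Gamma\cap gKg^{-1}|$. Height function $\alpha$. Let $\Lambda_0=\mathbb F_q[t]^d\subset F^d$. Use the max norm on $F^d$ and on each $\bigwedge^jF^d$ the sup norm in the standard exterior basis. For a rank-$d$ $\mathbb F_q[t]$-lattice $\Lambda=g\Lambda_0$, $g\in\operatorname{GL}_d(F)$, put $\operatorname{covol}(\Lambda)=|\det g|$. For the homothety class $[\Lambda]$ define $$\alpha([\Lambda])=\max_{1\le j\le d}\left\{\operatorname{covol}(\Lambda)^{j/d}\,\|v_1\wedge\cdots\wedge v_j\|^{-1}: v_1,\ldots,v_j\in\Lambda\text{ are $F$-linearly independent}\right\}.$$ This is invariant under homotheties. On $Y$ define $\alpha(\Gamma gK)=\alpha([g^{-1}\Lambda_0])$, which is well-defined because $K$ acts by isometries and $\Gamma$ preserves $[\Lambda_0]$. Notation. $u=q^{s/d}=\exp((s/d)\log q)$ with $\log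 q$ the positive real logarithm. $Q_0=1$ and $Q_n=\prod_{j=1}^n(q^j-1)$ for $n\ge1$. For $I=\{s_1<\cdots<s_{k-1}\}\subset\{1,\ldots,d-1\}$ let $\operatorname{Blocks}(I)$ be the list $(s_1,s_2-s_1,\ldots,d-s_{k-1})$ (with $\operatorname{Blocks}(\varnothing)=(d)$), and $$C(I)=q^{-\binom d2}(q-1)\prod_{\ell\in\operatorname{Blocks}(I)}Q_\ell^{-1}.$$ For $1\le j\le d-1$ and $z=(z_i)_{i\ne j}\in\mathbb Z_{\ge0}^{\{1,\ldots,d-1\}\setminus\{j\}}$, $\operatorname{supp}z=\{i:z_i>0\}$ and $$R_j(z)=\sum_{i<j}i(j-i)z_i+\sum_{i>j}(i-j)(d-i)z_i.$$ *)

(* Defs.v *)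
From HB Require Import structures.
From mathcomp Require Import all_boot all_order all_algebra generic_quotient.
From mathcomp Require Import finmap all_classical all_reals all_analysis.
From mathcomp Require Import complex.
Set Implicit Arguments.
Unset Strict Implicit.
Unset Printing Implicit Defensive.
Import Order.TTheory GRing.Theory Num.Theory.
Import numFieldNormedType.Exports.
Local Open Scope classical_set_scope.
Local Open Scope ring_scope.
Local Open Scope complex_scope.

(* The series sum_n (pscoef f n) x^n, with x = t^-1. *)

Record power_series (k : Type) := PowerSeries { pscoef : nat -> k }.

HB.instance Definition _ (k : Type) := gen_eqMixin (power_series k).
HB.instance Definition _ (k : Type) := gen_choiceMixin (power_series k).

Section PowerSeriesRing.
Variable k : fieldType.
Implicit Types f g h : power_series k.

Lemma psP f g : (forall n, pscoef f n = pscoef g n) -> f = g.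
Proof. by case: f g => [f] [g] /= /funext ->. Qed.

Definition psC (c : k) := PowerSeries (fun n => if n == 0%N then c else 0).
Definition psX : power_series k := PowerSeries (fun n => (n == 1%N)%:R).
Definition ps_add f g := PowerSeries (fun n => pscoef f n + pscoef g n).
Definition ps_opp f := PowerSeries (fun n => - pscoef f n).
Definition ps_mul f g :=
  PowerSeries (fun n => \sum_(i < n.+1) pscoef f i * pscoef g (n - i)).

Lemma ps_addA : associative ps_add.
Proof. by move=> f g h; apply: psP => n /=; rewrite addrA. Qed.
Lemma ps_addC : commutative ps_add.
Proof. by move=> f g; apply: psP => n /=; rewrite addrC. Qed.
Lemma ps_add0 : left_id (psC 0) ps_add.
Proof. by move=> f; apply: psP => n /=; rewrite if_same add0r. Qed.
Lemma ps_addN : left_inverse (psC 0) ps_opp ps_add.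
Proof. by move=> f; apply: psP => n /=; rewrite if_same addNr. Qed.

HB.instance Definition _ :=
  GRing.isZmodule.Build (power_series k) ps_addA ps_addC ps_add0 ps_addN.

Let trunc n f : {poly k} := \poly_(i < n.+1) pscoef f i.

Let coef_trunc n f i : (i <= n)%N -> (trunc n f)`_i = pscoef f i.
Proof. by move=> le_in; rewrite coef_poly ltnS le_in. Qed.

Let coef_truncM n f g i : (i <= n)%N ->
  (trunc n f * trunc n g)`_i = pscoef (ps_mul f g) i.
Proof.
move=> le_in; rewrite coefM /=; apply: eq_bigr => j _.
have le_ji : (j <= i)%N by rewrite -ltnS.
by rewrite !coef_trunc ?(leq_trans _ le_in) ?leq_subr.
Qed.

Lemma ps_mulC : commutative ps_mul.
Proof.
by move=> f g; apply: psP => n; rewrite -!(coef_truncM _ _ (leqnn n)) mulrC.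
Qed.

Lemma ps_mulA : associative ps_mul.
Proof.
move=> f g h; apply: psP => n.
transitivity ((trunc n f * (trunc n g * trunc n h))`_n).
  rewrite coefM /=; apply: eq_bigr => j _.
  by rewrite coef_trunc -1?ltnS // coef_truncM ?leq_subr.
rewrite mulrA coefM /=; apply: eq_bigr => j _.
by rewrite coef_truncM -1?ltnS // coef_trunc ?leq_subr.
Qed.

Lemma ps_mul1 : left_id (psC 1) ps_mul.
Proof.
move=> f; apply: psP => n /=.
rewrite big_ord_recl /= mul1r subn0 big1 ?addr0 // => i _.
by rewrite mul0r.
Qed.

Lemma ps_mulDl : left_distributive ps_mul ps_add.
Proof.
move=> f g h; apply: psP => n /=; rewrite -big_split /=.
by apply: eq_bigr => i _; rewrite mulrDl.
Qed.

Lemma ps_1neq0 : psC 1 != psC 0.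
Proof. by apply/eqP => /(congr1 (fun f => pscoef f 0)) /= /eqP; rewrite oner_eq0. Qed.

HB.instance Definition _ := GRing.Zmodule_isComNzRing.Build (power_series k)
  ps_mulA ps_mulC ps_mul1 ps_mulDl ps_1neq0.

Definition ps_unit : {pred power_series k} :=
  fun f => `[< exists g, g * f = 1 >].
Definition ps_inv f : power_series k :=
  if pselect (exists g, g * f = 1) is left e then projT1 (cid e) else f.

Lemma ps_mulVx : {in ps_unit, left_inverse 1 ps_inv *%R}.
Proof.
move=> f /asboolP uf; rewrite /ps_inv; case: pselect => // e.
exact: (projT2 (cid e)).
Qed.
Lemma ps_unitPl f g : g * f = 1 -> ps_unit f.
Proof. by move=> gf; apply/asboolP; exists g. Qed.
Lemma ps_inv_out : {in [predC ps_unit], ps_inv =1 id}.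
Proof.
move=> f /negP nuf; rewrite /ps_inv; case: pselect => // e.
by case: nuf; apply/asboolP.
Qed.

HB.instance Definition _ := GRing.ComNzRing_hasMulInverse.Build (power_series k)
  ps_mulVx ps_unitPl ps_inv_out.

Lemma ps_neq0_ex f : f != 0 -> exists n, pscoef f n != 0.
Proof.
move=> nz_f; apply: contrapT => f0; case/eqP: nz_f; apply: psP => n /=.
by rewrite if_same; apply/eqP/negPn/negP => fn; apply: f0; exists n.
Qed.

(* The x-adic order; the junk value 0 is used at f = 0. *)
Definition ps_ord f : nat :=
  if pselect (exists n, pscoef f n != 0) is left e then ex_minn e else 0%N.

Lemma ps_ordP f : f != 0 ->
  pscoef f (ps_ord f) != 0 /\ forall i, (i < ps_ord f)%N -> pscoef f i = 0.
Proof.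
move=> /ps_neq0_ex ex_f; rewrite /ps_ord; case: pselect => // e.
case: ex_minnP => m fm minm; split => // i lt_im.
by apply/eqP/negPn/negP => /minm; rewrite leqNgt lt_im.
Qed.

Lemma ps_integral f g : f * g = 0 -> (f == 0) || (g == 0).
Proof.
move=> fg0; apply/norP => -[/ps_ordP[fm fi] /ps_ordP[gm gi]].
have /(congr1 (fun h => pscoef h (ps_ord f + ps_ord g)%N)) := fg0.
rewrite /= (bigD1 (Ordinal (leq_addr (ps_ord g) (ps_ord f) :
  (ps_ord f < (ps_ord f + ps_ord g).+1)%N))) //= big1 => [|i ne_i].
  by rewrite addr0 addKn if_same => /eqP; rewrite mulf_eq0 (negPf fm) (negPf gm).
have [lt_if|le_fi] := ltnP i (ps_ord f); first by rewrite fi ?mul0r.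
have lt_fi : (ps_ord f < i)%N by rewrite ltn_neqAle le_fi andbT eq_sym.
rewrite [X in _ * X]gi ?mulr0 // ltn_subLR ?ltn_add2r //.
by rewrite -ltnS.
Qed.

HB.instance Definition _ :=
  GRing.ComUnitRing_isIntegral.Build (power_series k) ps_integral.

Lemma psC_is_zmod_morphism : zmod_morphism psC.
Proof. by move=> a b; apply: psP => -[|n] /=; rewrite ?oppr0 ?addr0. Qed.
HB.instance Definition _ :=
  GRing.isZmodMorphism.Build k (power_series k) psC psC_is_zmod_morphism.

Lemma psC_is_monoid_morphism : monoid_morphism psC.
Proof.
split=> // a b; apply: psP => n /=.
rewrite big_ord_recl /= subn0 big1 ?addr0 => [|i _]; last by rewrite mul0r.
by case: n => [|n]; rewrite ?mulr0.
Qed.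
HB.instance Definition _ :=
  GRing.isMonoidMorphism.Build k (power_series k) psC psC_is_monoid_morphism.

End PowerSeriesRing.

Notation laurent k := {fraction (power_series k)}.

Section LaurentField.
Variable k : finFieldType.

(* The embedding of the valuation ring O = k[[t^-1]]. *)
Definition OtoF : power_series k -> laurent k := @FracField.tofrac _.

Definition tF : laurent k := (OtoF (psX k))^-1.

(* The embedding of k[t], by evaluation at t = x^-1. *)
Definition polytoF : {poly k} -> laurent k :=
  horner_eval tF \o map_poly (@FracField.tofrac _ \o @psC k).

(* |n / d| = q ^ (ord d - ord n); in particular |t| = q. *)
Definition labs (R : realType) (a : laurent k) : R :=
  if a == 0 then 0 else
  #|k|%:R ^ ((ps_ord (frac (repr a)).2)%:Z - (ps_ord (frac (repr a)).1)%:Z).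

HB.instance Definition _ := GRing.RMorphism.on OtoF.
HB.instance Definition _ := GRing.RMorphism.on polytoF.

End LaurentField.

Section PGL.
Variables (F : fieldType) (d : nat).

Definition GL := {A : 'M[F]_d | A \in unitmx}.
HB.instance Definition _ := Choice.on GL.
Implicit Types A B C : GL.

Definition GL1 : GL := exist _ 1%:M (unitmx1 F d).
Lemma GLmul_subproof A B : val A *m val B \in unitmx.
Proof. by rewrite unitmx_mul (valP A) (valP B). Qed.
Definition GLmul A B : GL := exist _ (val A *m val B) (GLmul_subproof A B).
Lemma GLinv_subproof A : invmx (val A) \in unitmx.
Proof. by rewrite unitmx_inv (valP A). Qed.
Definition GLinv A : GL := exist _ (invmx (val A)) (GLinv_subproof A).

Definition homothetic A B : bool :=
  `[< exists2 c : F, c != 0 & val A = c *: val B >].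

Lemma homothetic_refl : reflexive homothetic.
Proof. by move=> A; apply/asboolP; exists 1; rewrite ?oner_neq0 ?scale1r. Qed.
Lemma homothetic_sym : symmetric homothetic.
Proof.
move=> A B; apply/asboolP/asboolP => -[c nzc ->]; exists c^-1;
  by rewrite ?invr_eq0 // scalerA mulVf ?scale1r.
Qed.
Lemma homothetic_trans : transitive homothetic.
Proof.
move=> B A C /asboolP[a nza eA] /asboolP[b nzb eB]; apply/asboolP.
by exists (a * b); rewrite ?mulf_neq0 // eA eB scalerA.
Qed.
Canonical homothetic_equiv :=
  EquivRel homothetic homothetic_refl homothetic_sym homothetic_trans.

Definition PGL := {eq_quot homothetic}%qT.
HB.instance Definition _ : EqQuotient _ homothetic PGL := EqQuotient.on PGL.
HB.instance Definition _ := Choice.on PGL.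

Definition toPGL (A : GL) : PGL := (\pi_PGL A)%qT.

Lemma toPGL_eq A B : reflect (exists2 c : F, c != 0 & val A = c *: val B)
  (toPGL A == toPGL B).
Proof. by rewrite /toPGL eqmodE; apply: asboolP. Qed.

Lemma toPGLK (g : PGL) : toPGL (repr g) = g.
Proof. exact: reprK. Qed.

Definition PGL1 : PGL := toPGL GL1.
Definition PGLmul (g h : PGL) : PGL := toPGL (GLmul (repr g) (repr h)).
Definition PGLinv (g : PGL) : PGL := toPGL (GLinv (repr g)).

Lemma toPGLM A B : PGLmul (toPGL A) (toPGL B) = toPGL (GLmul A B).
Proof.
apply/eqP/toPGL_eq => /=.
have /eqP/toPGL_eq[a nza ->] := toPGLK (toPGL A).
have /eqP/toPGL_eq[b nzb ->] := toPGLK (toPGL B).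
by exists (a * b); rewrite ?mulf_neq0 // -scalemxAl -scalemxAr scalerA.
Qed.

Lemma toPGLV A : PGLinv (toPGL A) = toPGL (GLinv A).
Proof.
apply/eqP/toPGL_eq => /=.
have /eqP/toPGL_eq[a nza eA] := toPGLK (toPGL A).
exists a^-1; rewrite ?invr_eq0 //; rewrite eA invmxZ //.
by rewrite -eA; exact: (valP (repr _)).
Qed.

Lemma PGLmulA : associative PGLmul.
Proof.
move=> f g h; rewrite -(toPGLK f) -(toPGLK g) -(toPGLK h) !toPGLM.
by congr toPGL; apply: val_inj; rewrite /= mulmxA.
Qed.
Lemma PGLmul1 : left_id PGL1 PGLmul.
Proof.
move=> g; rewrite -(toPGLK g) toPGLM.
by congr toPGL; apply: val_inj; rewrite /= mul1mx.
Qed.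
Lemma PGLmulr1 : right_id PGL1 PGLmul.
Proof.
move=> g; rewrite -(toPGLK g) toPGLM.
by congr toPGL; apply: val_inj; rewrite /= mulmx1.
Qed.
Lemma PGLmulV : left_inverse PGL1 PGLinv PGLmul.
Proof.
move=> g; rewrite -(toPGLK g) toPGLV toPGLM.
congr toPGL; apply: val_inj; rewrite /= mulVmx //; exact: (valP (repr g)).
Qed.
Lemma PGLmulrV : right_inverse PGL1 PGLinv PGLmul.
Proof.
move=> g; rewrite -(toPGLK g) toPGLV toPGLM.
congr toPGL; apply: val_inj; rewrite /= mulmxV //; exact: (valP (repr g)).
Qed.

HB.instance Definition _ :=
  isGroup.Build PGL PGLmulA PGLmul1 PGLmulr1 PGLmulV PGLmulrV.

(* The image in PGL_d(F) of GL_d(S), for a ring S mapping to F. *)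
Definition imPGL (S : comUnitRingType) (iota : S -> F) : set PGL :=
  [set g | exists P : 'M[S]_d, exists A : GL,
    [/\ P \in unitmx, val A = map_mx iota P & g = toPGL A]].

Section ImageGroup.
Variables (S : comUnitRingType) (iota : {rmorphism S -> F}).

Lemma imPGL1 : imPGL iota 1%g.
Proof. by exists 1%:M, GL1; split; rewrite ?unitmx1 //= map_mx1. Qed.

Lemma imPGLM g h : imPGL iota g -> imPGL iota h -> imPGL iota (g * h)%g.
Proof.
move=> [P [A [uP eA ->]]] [Q [B [uQ eB ->]]]; exists (P *m Q), (GLmul A B).
by split; rewrite ?unitmx_mul ?uP //= ?eA ?eB ?map_mxM //; exact: toPGLM.
Qed.

Lemma imPGLV g : imPGL iota g -> imPGL iota g^-1%g.
Proof.
move=> [P [A [uP eA ->]]]; exists (invmx P), (GLinv A).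
split; rewrite ?unitmx_inv //=; last exact: toPGLV.
have uA : map_mx iota P \in unitmx by rewrite -eA (valP A).
rewrite eA -[RHS]mulmx1 -(mulmxV uA) mulmxA -map_mxM mulVmx //.
by rewrite map_mx1 mul1mx.
Qed.

End ImageGroup.
End PGL.

Arguments toPGL {F d} A.
Arguments imPGL {F} d {S} iota.

Section DoubleQuotient.
Variables (k : finFieldType) (d : nat).

Definition G := PGL (laurent k) d.
HB.instance Definition _ := Group.on G.
Definition Gamma : set G := imPGL d (@polytoF k).
Definition K : set G := imPGL d (@OtoF k).

Definition dcoset (g h : G) : bool :=
  `[< exists gam kap : G, [/\ Gamma gam, K kap & h = (gam * g * kap)%g] >].

Lemma dcoset_refl : reflexive dcoset.
Proof.
move=> g; apply/asboolP; exists 1%g, 1%g.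
by split; [exact: imPGL1 | exact: imPGL1 | rewrite mul1g mulg1].
Qed.
Lemma dcoset_sym : symmetric dcoset.
Proof.
have sub g h : dcoset g h -> dcoset h g.
  move=> /asboolP[gam [kap [Gg Kk ->]]]; apply/asboolP.
  exists gam^-1%g, kap^-1%g; split; [exact: imPGLV | exact: imPGLV |].
  by rewrite -!mulgA mulgV mulg1 mulKg.
by move=> g h; apply/idP/idP; apply: sub.
Qed.
Lemma dcoset_trans : transitive dcoset.
Proof.
move=> h g l /asboolP[a [b [Ga Kb ->]]] /asboolP[a' [b' [Ga' Kb' ->]]].
apply/asboolP; exists (a' * a)%g, (b * b')%g.
by split; [exact: imPGLM | exact: imPGLM | rewrite !mulgA].
Qed.
Canonical dcoset_equiv := EquivRel dcoset dcoset_refl dcoset_sym dcoset_trans.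

Definition Y := {eq_quot dcoset}%qT.
HB.instance Definition _ : EqQuotient _ dcoset Y := EqQuotient.on Y.
HB.instance Definition _ := Choice.on Y.
HB.instance Definition _ := isPointed.Build Y (\pi_Y (1%g : G))%qT.
HB.instance Definition _ := @isMeasurable.Build default_measure_display Y
  discrete_measurable discrete_measurable0 discrete_measurableC
  discrete_measurableU.

Definition stab (g : G) : set G :=
  Gamma `&` [set (g * kap * g^-1)%g | kap in K].

Variable R : realType.

(* The mass of {Gamma g K} is 1 / #|Gamma :&: g K g^-1|: this is the push-forward
   to Y of the quotient on Gamma \ G of the Haar measure with vol(K) = 1. *)
Definition mass (y : Y) : R := (#|` fset_set (stab (repr y))|%:R)^-1.

Definition nu (A : set Y) : \bar R := (\esum_(y in A) (mass y)%:E)%E.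

Lemma mass_ge0 y : (0 <= (mass y)%:E)%E.
Proof. by rewrite lee_fin invr_ge0. Qed.

Lemma nu0 : nu set0 = 0%E.
Proof. exact: esum_set0. Qed.
Lemma nu_ge0 A : (0 <= nu A)%E.
Proof. by apply: esum_ge0 => y _; apply: mass_ge0. Qed.
Lemma nu_sigma_additive : semi_sigma_additive nu.
Proof.
move=> A _ tA _; rewrite /nu nneseries_sum_bigcup //; last exact: mass_ge0.
by apply: is_cvg_nneseries => n _ _; apply: nu_ge0.
Qed.

HB.instance Definition _ := isMeasure.Build _ _ _ nu nu0 nu_ge0 nu_sigma_additive.

End DoubleQuotient.

Section Height.
Variables (R : realType) (k : finFieldType) (d : nat).
Local Notation F := (laurent k).

(* The lattice g Lambda_0, inside the space F^d of column vectors. *)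
Definition lattice (g : 'M[F]_d) : set 'cV[F]_d :=
  [set g *m map_mx (@polytoF k) w | w in [set: 'cV[{poly k}]_d]].

(* The sup norm of v_1 /\ ... /\ v_j, where the v_b are the columns of V: its
   coordinate on e_(i_1) /\ ... /\ e_(i_j), i_1 < ... < i_j, is the minor of V
   on the rows i_1, ..., i_j. *)
Definition wedge_norm (j : nat) (V : 'M[F]_(d, j)) : R :=
  \big[Num.max/0]_(f : {ffun 'I_j -> 'I_d} |
      [forall a : 'I_j, forall b : 'I_j, (a < b)%N ==> (f a < f b)%N])
    labs R (\det (rowsub f V)).

Definition height_values (g : 'M[F]_d) : set R :=
  [set x | exists j : nat, exists V : 'M[F]_(d, j),
    [/\ (1 <= j <= d)%N,
        forall b, lattice g (col b V),
        \rank V = j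
      & x = labs R (\det g) `^ (j%:R / d%:R) * (wedge_norm V)^-1]].

(* The supremum is attained: the norms of nonzero v_1 /\ ... /\ v_j lie in a
   discrete subset of the positive reals, bounded away from 0. *)
Definition lattice_height (g : 'M[F]_d) : R := sup (height_values g).

(* alpha(Gamma g K) = alpha([g^-1 Lambda_0]): the two reprs choose g in PGL_d(F)
   and then in GL_d(F), and the value does not depend on these choices. *)
Definition alpha (y : Y k d) : R :=
  lattice_height (invmx (val (repr (repr y : G k d)))).

End Height.

Section Complex.
Variable R : realType.

Definition cexp (z : R[i]) : R[i] :=
  (expR (complex.Re z))%:C * (cos (complex.Im z) +i* sin (complex.Im z)).

(* a ^ s for a > 0 *)
Definition cpow (a : R) (s : R[i]) : R[i] := cexp (s * (ln a)%:C).

(* R[i]^o carries the normed space structure of R[i] over itself, so that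
   derivable f s 1 is complex differentiability. *)
Definition holomorphic_at (f : R[i] -> R[i]) (p : R[i]) : Prop :=
  \forall s \near nbhs (p : R[i]^o),
    derivable (f : R[i]^o -> R[i]^o) (s : R[i]^o) (1 : R[i]^o).

(* The value of f at p itself is irrelevant. *)
Definition meromorphic_at (f : R[i] -> R[i]) (p : R[i]) : Prop :=
  exists (n : nat) (h : R[i] -> R[i]), holomorphic_at h p /\
    \forall s \near (p : R[i]^o)^', f s = h s / (s - p) ^+ n.

Definition meromorphic (f : R[i] -> R[i]) : Prop :=
  forall p, meromorphic_at f p.

Definition simple_pole_at (f : R[i] -> R[i]) (p : R[i]) : Prop :=
  exists h : R[i] -> R[i], [/\ holomorphic_at h p, h p != 0 &
    \forall s \near (p : R[i]^o)^', f s = h s / (s - p)].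

End Complex.

Section Zeta.
Variables (R : realType) (k : finFieldType) (d : nat).

Definition abs_convergent (s : R[i]) : Prop :=
  (\int[@nu k d R]_(y in [set: Y k d])
     (complex.Re `|cpow (alpha R y) s|)%:E < +oo)%E.

Definition Zeta (s : R[i]) : R[i] :=
  (\int[@nu k d R]_(y in [set: Y k d]) complex.Re (cpow (alpha R y) s)) +i*
  (\int[@nu k d R]_(y in [set: Y k d]) complex.Im (cpow (alpha R y) s)).

End Zeta.

Section Kappa.
Variables (R : realType) (d q : nat).

Definition Qfact (n : nat) : R := \prod_(1 <= j < n.+1) (q%:R ^+ j - 1).

(* A subset of {1, ..., d-1} is encoded as I : {set 'I_d} not containing 0;
   enum I lists it in increasing order. *)
Definition Blocks (I : {set 'I_d}) : seq nat :=
  pairmap (fun a b => b - a)%N 0%N (rcons [seq val i | i <- enum I] d).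

Definition Cconst (I : {set 'I_d}) : R :=
  (q%:R ^+ 'C(d, 2))^-1 * (q%:R - 1) * \prod_(l <- Blocks I) (Qfact l)^-1.

Definition idx (j : 'I_d) := {i : 'I_d | (0 < i)%N && (i != j)}.

Definition supp (j : 'I_d) (z : {ffun idx j -> nat}) : {set 'I_d} :=
  [set val i | i : idx j & (0 < z i)%N].

Definition Rexp (j : 'I_d) (z : {ffun idx j -> nat}) : nat :=
  (\sum_(i : idx j | (val i < j)%N) val i * (j - val i) * z i +
   \sum_(i : idx j | (j < val i)%N) (val i - j) * (d - val i) * z i)%N.

(* Valued in \bar R because the inner sums are infinite. *)
Definition kappa : \bar R :=
  ((d%:R / ln q%:R)%:E *
   \sum_(j < d | (0 < j)%N) ((j * (d - j))%N%:R^-1)%:E *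
     \esum_(z in [set: {ffun idx j -> nat}])
       (Cconst (j |: supp z) * (q%:R ^+ Rexp z)^-1)%:E)%E.

End Kappa.

(* Main.v *)
(** By Birkhoff's theorem Y is parametrized by n = (n_1, ..., n_{d-1}), n_i >= 0,
through diag(t^{a_1}, ..., t^{a_d}) with a_i - a_{i+1} = n_i. Its stabilizer is cut
out by degree bounds, with a parabolic subgroup of GL_d(F_q) as reductive part, so
the mass of n is C(supp n) q^{-sum_i i(d-i)n_i}; its height is q^{E(n)/d}, E(n)
being the maximum over j of d(a_1 + ... + a_j) - j(a_1 + ... + a_d).

For n <> 0 let j be the largest index with d a_j > sum_i a_i; it attains the maximum
defining E. For fixed z = (n_i)_{i <> j} this j is selected exactly by the n_j above a threshold, and
there E increases by j(d-j) when n_j increases by 1, while the exponent of the mass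
is E(n) + R_j(z). Hence, with v = q^{s/d}/q,
  Z(s) = C(0) + sum_j H_j(v) / (1 - v^{j(d-j)}),   H_j(1) = sum_z C q^{-R_j(z)}.
The coefficients of H_j satisfy a linear recurrence: E is piecewise linear with
periodic corrections in z. So H_j is a fraction, which in lowest terms is regular
at v = 1 because the series converges there. Therefore (1 - v) Z takes at v = 1 the
value L = sum_j H_j(1) / (j(d-j)) > 0: the fraction Z in v has in lowest terms a
simple pole at v = 1, and kappa = (d / log q) L. *)
Require Import Defs.
From HB Require Import structures.
From mathcomp Require Import all_boot all_order all_algebra generic_quotient.
From mathcomp Require Import finmap all_classical all_reals all_analysis.
From mathcomp Require Import complex.
From mathcomp Require Import perm.
From mathcomp Require Import ring lra zify.
Set Implicit Arguments.
Unset Strict Implicit.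
Unset Printing Implicit Defensive.
Import Order.TTheory GRing.Theory Num.Theory.
Import numFieldNormedType.Exports.
Local Open Scope classical_set_scope.
Local Open Scope ring_scope.
Local Open Scope complex_scope.


(** * Units and valuation of Laurent series *)

(** The threshold for n_j involves integer division, so no closed form of H_j is sought. Rationality
    is obtained from closure properties instead: sequences whose shifts span a finite-dimensional
    space are stable under sums, termwise products, convolution and stretching, and the coefficients
    of H_j are built from geometric and periodic sequences by these operations. A characteristic
    polynomial then yields some fraction with an uncontrolled denominator. Its regularity at v = 1
    follows from the identity Q(v) L = P(v), valid wherever the series converges to L: a zero of Q
    there is also a zero of P, which lowest terms exclude. The same argument for the full series
    shows that the denominator does not vanish for Re s < d, while L > 0 prevents the pole from
    cancelling. Levels are weighted by q^m times their mass, so that the variable is v and the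
    coefficients are bounded; divergence for Re s >= d comes from their being bounded below along an
    arithmetic progression. Turning a zero in u into a pole in s needs Taylor estimates of the
    complex exponential. *)

Section PowerSeriesUnits.
Variable k : fieldType.
Implicit Types f g : power_series k.

(* The inverse is computed coefficient by coefficient; the list holds the first n ones. *)
Fixpoint ps_inv_seq f (n : nat) : seq k :=
  if n is m.+1 then
    let s := ps_inv_seq f m in
    rcons s (((m == 0%N)%:R - \sum_(i < m) nth 0 s i * pscoef f (m - i)) / pscoef f 0)
  else [::].

Lemma size_ps_inv_seq f n : size (ps_inv_seq f n) = n.
Proof. by elim: n => //= n IH; rewrite size_rcons IH. Qed.

Lemma nth_ps_inv_seq f n m i : (i < n <= m)%N ->
  nth 0 (ps_inv_seq f m) i = nth 0 (ps_inv_seq f n) i.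
Proof.
move=> /andP[lt_in]; elim: m => [|m IH].
  by rewrite leqn0 => /eqP n0; rewrite n0 in lt_in.
rewrite leq_eqVlt => /orP[/eqP -> //|lt_nm].
by rewrite /= nth_rcons size_ps_inv_seq (leq_trans lt_in lt_nm) IH.
Qed.

Lemma ps_unitP f : reflect (pscoef f 0 != 0) (f \is a GRing.unit).
Proof.
apply: (iffP idP) => [/mulVr/(congr1 (fun h => pscoef h 0))|nz].
  by rewrite /= big_ord1 subnn => /eqP; apply: contraTneq => ->; rewrite mulr0 eq_sym oner_eq0.
apply/asboolP; exists (PowerSeries (fun n => nth 0 (ps_inv_seq f n.+1) n)).
apply: psP => n /=; rewrite big_ord_recr /= subnn.
rewrite nth_rcons size_ps_inv_seq ltnn eqxx mulfVK //.
rewrite (eq_bigr (fun i : 'I_n => nth 0 (ps_inv_seq f n) i * pscoef f (n - i))); last first.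
  by move=> i _; rewrite -(@nth_ps_inv_seq f i.+1 n) ?leqnn ?ltn_ord.
by rewrite addrC subrK; case: (n == 0%N).
Qed.

Lemma pscoefM f g n :
  pscoef (f * g) n = \sum_(i < n.+1) pscoef f i * pscoef g (n - i).
Proof. by []. Qed.

Lemma pscoefXM f n : pscoef (psX k * f) n = if n is m.+1 then pscoef f m else 0.
Proof.
rewrite pscoefM; case: n => [|n]; first by rewrite big_ord1 /= mul0r.
rewrite big_ord_recl /= mul0r add0r big_ord_recl /= mul1r big1 ?addr0 ?subn1 //.
by move=> i _; rewrite mul0r.
Qed.

Lemma psX_neq0 : psX k != 0.
Proof. by apply/eqP => /(congr1 (fun h => pscoef h 1)) /eqP /=; rewrite oner_eq0. Qed.

Lemma ps_divX f : pscoef f 0 = 0 -> exists g, f = psX k * g.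
Proof.
move=> f0; exists (PowerSeries (fun n => pscoef f n.+1)).
by apply: psP => -[|n]; rewrite pscoefXM.
Qed.

Lemma ps_fact f : f != 0 -> exists2 u, u \is a GRing.unit & f = psX k ^+ ps_ord f * u.
Proof.
move=> /ps_ordP[]; move: (ps_ord f) => m; elim: m f => [|m IH] f.
  by move=> f0 _; exists f; [exact/ps_unitP | rewrite expr0 mul1r].
move=> fm fi; have /ps_divX[g eg] := fi 0%N isT.
rewrite eg; have [||u uu ->] := IH g.
- by rewrite eg pscoefXM in fm.
- by move=> i lt_im; have := fi i.+1 lt_im; rewrite eg pscoefXM.
by exists u => //; rewrite exprS -mulrA.
Qed.

Lemma ps_ord_unique f m : pscoef f m != 0 ->
  (forall i, (i < m)%N -> pscoef f i = 0) -> ps_ord f = m.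
Proof.
move=> fm fi; have nzf : f != 0.
  by apply: contraNneq fm => ->; rewrite /= if_same.
have [fo fo'] := ps_ordP nzf; apply/eqP; rewrite eqn_leq; apply/andP; split.
  by rewrite leqNgt; apply: contra fm => /fo' ->.
by rewrite leqNgt; apply: contra fo => /fi ->.
Qed.

Lemma ps_ordXnu m u : u \is a GRing.unit -> ps_ord (psX k ^+ m * u) = m.
Proof.
move=> /ps_unitP u0; apply: ps_ord_unique.
  by elim: m => [|m IH]; rewrite ?expr0 ?mul1r // exprS -mulrA pscoefXM.
elim: m => [//|m IH] [|i] lt_im; rewrite exprS -mulrA pscoefXM //; exact: IH.
Qed.

Lemma ps_ordM f g : f != 0 -> g != 0 -> ps_ord (f * g) = (ps_ord f + ps_ord g)%N.
Proof.
move=> /ps_fact[u uu ->] /ps_fact[v uv ->].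
by rewrite mulrACA -exprD !ps_ordXnu // unitrM uu.
Qed.

End PowerSeriesUnits.

Section Valuation.
Variable k : finFieldType.
Variable R : realType.
Local Notation F := (laurent k).
Local Notation q := (#|k|%:R : R).
Local Notation labs := (@labs k R).
Implicit Types (x y : F) (f g : power_series k) (p : {poly k}).

Lemma q_gt1 : 1 < q.
Proof. by rewrite ltr1n ?card_finNzRing_gt1 ?finRing_gt1. Qed.
Lemma q_gt0 : 0 < q. Proof. exact: lt_trans q_gt1. Qed.
Lemma q_neq0 : q != 0. Proof. by rewrite gt_eqF ?q_gt0. Qed.

Lemma q_expzI : injective (fun m : int => q ^ m).
Proof. by apply: ieexprIz; rewrite ?q_gt0 // gt_eqF ?q_gt1. Qed.

Lemma OtoF_inj : injective (@OtoF k).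
Proof. by move=> f g /eqP; rewrite /OtoF tofrac_eq => /eqP. Qed.

Lemma OtoF_eq0 f : (OtoF f == 0) = (f == 0).
Proof. exact: tofrac_eq0. Qed.


(** The absolute value is defined on a chosen representative; this identity links that choice to
    arbitrary fractions. *)
Lemma repr_laurent x : x = OtoF (frac (repr x)).1 / OtoF (frac (repr x)).2.
Proof.
set n := (frac _).1; set e := (frac _).2; have nze : e != 0 := denom_ratioP _.
apply: (canRL (mulfK _)); first by rewrite OtoF_eq0.
rewrite -{1}[x]reprK /OtoF; unlock FracField.tofrac.
rewrite -[LHS]FracField.pi_mul; apply/eqmodP.
rewrite /= FracField.equivfE /FracField.mulf /= !numden_Ratio ?mulf_neq0 ?oner_neq0 //.
by rewrite !mulr1 mulrC.
Qed.

(** Independence of the representative: cross-multiplying two fractions and taking orders gives the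
    same difference. *)
Lemma labs_frac f g : f != 0 -> g != 0 ->
  labs (OtoF f / OtoF g) = q ^ ((ps_ord g)%:Z - (ps_ord f)%:Z).
Proof.
move=> nzf nzg; set x := _ / _.
have nzx : x != 0 by rewrite mulf_neq0 ?invr_eq0 ?OtoF_eq0.
rewrite /labs (negPf nzx).
have := repr_laurent x; set n := (frac _).1; set e := (frac _).2.
have nze : e != 0 := denom_ratioP _.
move=> ex; have nzn : n != 0.
  by apply: contraNneq nzx => n0; rewrite ex n0 /OtoF rmorph0 mul0r.
have : OtoF (f * e) = OtoF (n * g).
  rewrite !rmorphM; apply/eqP; rewrite -eqr_div ?OtoF_eq0 //.
  by rewrite -ex.
move/OtoF_inj/(congr1 (@ps_ord k)); rewrite !ps_ordM // => eo.
by congr (_ ^ _); lia.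
Qed.

Lemma labs0 : labs 0 = 0. Proof. by rewrite /labs eqxx. Qed.

Lemma labs_OtoF f : f != 0 -> labs (OtoF f) = q ^ (- (ps_ord f)%:Z).
Proof.
move=> nzf; have := labs_frac nzf (oner_neq0 _).
rewrite /OtoF rmorph1 divr1 => ->.
by congr (_ ^ _); rewrite -(mulr1 1) -(expr0 (psX k)) ps_ordXnu ?unitr1 // sub0r.
Qed.

Lemma fracP x : x != 0 -> exists f g, [/\ f != 0, g != 0 & x = OtoF f / OtoF g].
Proof.
move=> nzx; have := repr_laurent x; set n := (frac _).1; set e := (frac _).2.
have nze : e != 0 := denom_ratioP _.
move=> ex; exists n, e; split=> //.
by apply: contraNneq nzx => n0; rewrite ex n0 /OtoF rmorph0 mul0r.
Qed.

Lemma labsM x y : labs (x * y) = labs x * labs y.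
Proof.
have [->|nzx] := eqVneq x 0; first by rewrite mul0r labs0 mul0r.
have [->|nzy] := eqVneq y 0; first by rewrite mulr0 labs0 mulr0.
have [f [g [nzf nzg ->]]] := fracP nzx; have [f' [g' [nzf' nzg' ->]]] := fracP nzy.
rewrite mulf_div -!rmorphM !labs_frac ?mulf_neq0 // -expfzDr ?q_neq0 //.
by rewrite !ps_ordM //; congr (_ ^ _); lia.
Qed.

Lemma labs_neq0 x : (labs x != 0) = (x != 0).
Proof.
have [->|nzx] := eqVneq x 0; first by rewrite labs0 eqxx.
by rewrite /labs (negPf nzx) expfz_neq0 ?q_neq0.
Qed.

Lemma labs_gt0 x : (0 < labs x) = (x != 0).
Proof.
have [->|nzx] := eqVneq x 0; first by rewrite labs0 ltxx.
by rewrite /labs (negPf nzx) exprz_gt0 ?q_gt0.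
Qed.

Lemma labs_ge0 x : 0 <= labs x.
Proof. by rewrite /labs; case: ifP => // _; rewrite exprz_ge0 // ltW ?q_gt0. Qed.

Lemma labs1 : labs 1 = 1.
Proof. by apply: (mulfI (x := labs 1)); rewrite ?labs_neq0 ?oner_neq0 // -labsM !mulr1. Qed.

Lemma labsV x : labs x^-1 = (labs x)^-1.
Proof.
have [->|nzx] := eqVneq x 0; first by rewrite invr0 labs0 invr0.
apply: (mulfI (x := labs x)); first by rewrite labs_neq0.
by rewrite -labsM !mulfV ?labs1 // labs_neq0.
Qed.

Lemma labsX x n : labs (x ^+ n) = labs x ^+ n.
Proof. by elim: n => [|n IH]; rewrite ?expr0 ?labs1 // !exprS labsM IH. Qed.

Lemma labs_prod (I : Type) (r : seq I) (P : pred I) (E : I -> F) :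
  labs (\prod_(i <- r | P i) E i) = \prod_(i <- r | P i) labs (E i).
Proof. exact: (big_morph labs labsM labs1). Qed.

Lemma labs_eq x : x != 0 -> exists m : int, labs x = q ^ m.
Proof. by move=> nzx; rewrite /labs (negPf nzx); eexists. Qed.

Lemma labs_OtoF_le1 f : labs (OtoF f) <= 1.
Proof.
have [->|nzf] := eqVneq f 0; first by rewrite /OtoF rmorph0 labs0 ler01.
rewrite labs_OtoF // -(expr0z q) ler_eXz2l ?q_gt1 //; lia.
Qed.

Lemma labs_OtoF_unit f : f \is a GRing.unit -> labs (OtoF f) = 1.
Proof.
move=> uf; rewrite labs_OtoF; last by apply: contraTneq uf => ->; rewrite unitr0.
by rewrite -(mul1r f) -(expr0 (psX k)) ps_ordXnu // oppr0 expr0z.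
Qed.

Lemma labs_le1P x : reflect (exists f, x = OtoF f) (labs x <= 1).
Proof.
apply: (iffP idP) => [|[f ->]]; last exact: labs_OtoF_le1.
have [->|nzx] := eqVneq x 0; first by exists 0; rewrite /OtoF rmorph0.
have [f [g [nzf nzg ->]]] := fracP nzx.
rewrite labs_frac // -(expr0z q) ler_eXz2l ?q_gt1 // => le_gf.
have [u uu ef] := ps_fact nzf; have [v uv eg] := ps_fact nzg.
have le' : (ps_ord g <= ps_ord f)%N by lia.
exists (psX k ^+ (ps_ord f - ps_ord g) * (u * v^-1)).
apply: (canLR (mulfK _)); first by rewrite OtoF_eq0.
rewrite -rmorphM; congr OtoF.
rewrite {2}eg mulrACA [_ * v]mulrC mulrA mulrAC -exprD subnK //.
by rewrite -mulrA divrK.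
Qed.

Lemma labsDle1 x y : labs x <= 1 -> labs y <= 1 -> labs (x + y) <= 1.
Proof.
move=> /labs_le1P[f ->] /labs_le1P[g ->].
by rewrite -rmorphD labs_OtoF_le1.
Qed.

(** Dividing by the larger term reduces the ultrametric inequality to the closure of the valuation
    ring under addition. *)
Lemma labsD_le x y c : labs x <= c -> labs y <= c -> labs (x + y) <= c.
Proof.
wlog le_yx : x y / labs y <= labs x.
  move=> W; case/orP: (le_total (labs y) (labs x)) => [/W//|/W H ? ?].
  by rewrite addrC; apply: H.
move=> xc _; apply: le_trans xc.
have [x0|nzx] := eqVneq x 0.
  by move: le_yx; rewrite x0 labs0 add0r.
have -> : x + y = x * (1 + y / x) by rewrite mulrDr mulr1 mulrCA mulfV ?mulr1.
rewrite labsM ler_piMr ?labs_ge0 // labsDle1 ?labs1 //.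
by rewrite labsM labsV ler_pdivrMr ?mul1r // labs_gt0.
Qed.

Lemma labs_sum_le (I : Type) (r : seq I) (P : pred I) (E : I -> F) c : 0 <= c ->
  (forall i, P i -> labs (E i) <= c) -> labs (\sum_(i <- r | P i) E i) <= c.
Proof.
move=> c0 H; elim/big_ind: _ => [|x y|i /H //]; first by rewrite labs0.
exact: labsD_le.
Qed.

Lemma labsN x : labs (- x) = labs x.
Proof.
rewrite -mulN1r labsM; suff -> : labs (-1) = 1 by rewrite mul1r.
apply/eqP; rewrite -(@eqrXn2 _ 2) ?labs_ge0 //.
by rewrite -labsX sqrrN expr1n labs1 expr1n.
Qed.

Lemma labs_dominant x y : labs y < labs x -> labs (x + y) = labs x.
Proof.
move=> lt_yx; apply/eqP; rewrite eq_le labsD_le ?(ltW lt_yx) //=.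
rewrite leNgt; apply/negP => lt_xy.
have : labs x <= Num.max (labs (x + y)) (labs y).
  by rewrite -{1}(addrK y x) labsD_le ?labsN ?le_max ?lexx ?orbT.
by rewrite leNgt gt_max lt_xy lt_yx.
Qed.

Lemma tF_neq0 : tF k != 0.
Proof. by rewrite invr_eq0 OtoF_eq0 psX_neq0. Qed.

Lemma labs_tF : labs (tF k) = q.
Proof.
rewrite /tF labsV labs_OtoF ?psX_neq0 //.
by rewrite -[psX k]mulr1 -{1}[psX k]expr1 ps_ordXnu ?unitr1 // exprN1 invrK.
Qed.

Lemma labs_tFz (m : int) : labs (tF k ^ m) = q ^ m.
Proof.
case: m => n; first by rewrite /= labsX labs_tF.
by rewrite /exprz /= labsV labsX labs_tF.
Qed.

Lemma polytoFC (c : k) : polytoF c%:P = OtoF (psC c).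
Proof. by rewrite /polytoF /= map_polyC /= /horner_eval hornerC. Qed.

Lemma polytoFX : polytoF 'X = tF k.
Proof. by rewrite /polytoF /= map_polyX /horner_eval hornerX. Qed.

Lemma polytoFD p p' : polytoF (p + p') = polytoF p + polytoF p'.
Proof. exact: rmorphD. Qed.

Lemma polytoFM p p' : polytoF (p * p') = polytoF p * polytoF p'.
Proof. exact: rmorphM. Qed.

Lemma labs_psC (c : k) : labs (OtoF (psC c)) = (c != 0)%:R.
Proof.
have [->|nzc] := eqVneq c 0; first by rewrite /OtoF !rmorph0 labs0.
by rewrite labs_OtoF_unit //; apply/ps_unitP.
Qed.

Lemma labs_polytoF p : p != 0 -> labs (polytoF p) = q ^+ (size p).-1.
Proof.
elim/poly_ind: p => [|p c IH]; first by rewrite eqxx.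
rewrite polytoFD polytoFM polytoFX polytoFC size_MXaddC.
have [-> /=|nzp] := eqVneq p 0.
  rewrite rmorph0 mul0r add0r !mul0r add0r polyC_eq0 => nzc.
  by rewrite (negPf nzc) labs_psC nzc size_poly0.
have sp : (0 < size p)%N by rewrite size_poly_gt0.
have e : labs (polytoF p * tF k) = q ^+ size p.
  by rewrite labsM labs_tF IH // -exprSr prednK.
move=> _; rewrite /= labs_dominant e // labs_psC.
apply: le_lt_trans (_ : 1 < _); first by case: (c != 0); rewrite ?lexx ?ler01.
by rewrite exprn_egt1 ?q_gt1 // -lt0n.
Qed.

(** With [size] and a strict inequality the zero polynomial needs no exception. *)
Lemma labs_polytoF_size p n : (labs (polytoF p) < q ^+ n) = (size p <= n)%N.
Proof.
have [->|nzp] := eqVneq p 0.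
  by rewrite rmorph0 labs0 size_poly0 exprn_gt0 ?q_gt0.
rewrite labs_polytoF // ltr_eXn2l ?q_gt1 //.
by rewrite -[in RHS](@prednK (size p)) ?size_poly_gt0.
Qed.

Lemma polytoF_eq0 p : (polytoF p == 0) = (p == 0).
Proof.
have [->|nzp] := eqVneq p 0; first by rewrite rmorph0 eqxx.
by apply/negbTE; rewrite -labs_neq0 labs_polytoF // expf_neq0 ?q_neq0.
Qed.

Lemma polytoF_inj : injective (@polytoF k).
Proof.
by move=> p p' /eqP; rewrite -subr_eq0 -rmorphB polytoF_eq0 subr_eq0 => /eqP.
Qed.

Lemma poly_unitP p : reflect (exists2 c, c != 0 & p = c%:P) (p \is a GRing.unit).
Proof.
rewrite poly_unitE; apply: (iffP andP) => [[/size_poly1P[c nzc ->] _]|[c nzc ->]].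
  by exists c.
by rewrite size_polyC nzc coefC /= unitfE.
Qed.

Lemma labs_polytoF_unit p : p \is a GRing.unit -> labs (polytoF p) = 1.
Proof. by move=> /poly_unitP[c nzc ->]; rewrite polytoFC labs_psC nzc. Qed.

End Valuation.

(** * Birkhoff factorization *)

Section Reduction.
Variables (k : finFieldType) (R : realType) (d : nat).
Local Notation F := (laurent k).
Local Notation q := (#|k|%:R : R).
Local Notation labs := (@labs k R).
Local Notation polyM := (map_mx (@polytoF k)).
Local Notation OM := (map_mx (@OtoF k)).
Implicit Types (a : 'I_d -> int).

Definition Dmx a : 'M[F]_d := diag_mx (\row_i tF k ^ a i).

Lemma mul_Dmx a m (M : 'M[F]_(d, m)) i j : (Dmx a *m M) i j = tF k ^ a i * M i j.
Proof. by rewrite /Dmx mul_diag_mx !mxE. Qed.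

Lemma mul_mx_Dmx a m (M : 'M[F]_(m, d)) i j : (M *m Dmx a) i j = M i j * tF k ^ a j.
Proof. by rewrite /Dmx mul_mx_diag !mxE. Qed.

Lemma det_Dmx a : \det (Dmx a) = \prod_i tF k ^ a i.
Proof. by rewrite det_diag; apply: eq_bigr => i _; rewrite mxE. Qed.

Lemma Dmx_unit a : Dmx a \in unitmx.
Proof.
rewrite unitmxE det_Dmx unitfE; apply/prodf_neq0 => i _.
by rewrite expfz_neq0 ?tF_neq0.
Qed.

Lemma q_prodz (I : finType) (e : I -> int) : \prod_i q ^ e i = q ^ (\sum_i e i).
Proof. by rewrite (big_morph _ (fun x y => expfzDr x y (q_neq0 k R)) (expr0z q)). Qed.

Lemma labs_det_Dmx a : labs (\det (Dmx a)) = q ^ (\sum_i a i).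
Proof.
by rewrite det_Dmx labs_prod -q_prodz; apply: eq_bigr => i _; rewrite labs_tFz.
Qed.

Lemma OM_le1 m n (M : 'M[F]_(m, n)) :
  (forall i j, labs (M i j) <= 1) -> exists B, M = OM B.
Proof.
move=> H; have H' i j : {f | M i j = OtoF f}.
  by apply: cid; apply/labs_le1P; exact: H.
exists (\matrix_(i, j) sval (H' i j)); apply/matrixP => i j; rewrite !mxE.
exact: (svalP (H' i j)).
Qed.

Lemma labs_det_poly (g : 'M[{poly k}]_d) : g \in unitmx -> labs (\det (polyM g)) = 1.
Proof. by rewrite unitmxE det_map_mx; exact: labs_polytoF_unit. Qed.

Lemma labs_det_O (B : 'M[power_series k]_d) : B \in unitmx -> labs (\det (OM B)) = 1.
Proof. by rewrite unitmxE det_map_mx; exact: labs_OtoF_unit. Qed.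

Lemma polyM_unit (g : 'M[{poly k}]_d) : g \in unitmx -> polyM g \in unitmx.
Proof. by rewrite !unitmxE det_map_mx; apply: rmorph_unit. Qed.

Lemma OM_unit (B : 'M[power_series k]_d) : B \in unitmx -> OM B \in unitmx.
Proof. by rewrite !unitmxE det_map_mx; apply: rmorph_unit. Qed.

Lemma polyM_inv (g : 'M[{poly k}]_d) : g \in unitmx -> polyM (invmx g) = invmx (polyM g).
Proof.
move=> ug; apply: (can_inj (mulmxK (polyM_unit ug))).
by rewrite mulVmx ?polyM_unit // -map_mxM mulVmx // map_mx1.
Qed.

Lemma OM_inv (B : 'M[power_series k]_d) : B \in unitmx -> OM (invmx B) = invmx (OM B).
Proof.
move=> uB; apply: (can_inj (mulmxK (OM_unit uB))).
by rewrite mulVmx ?OM_unit // -map_mxM mulVmx // map_mx1.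
Qed.

Definition psc0 (f : power_series k) := pscoef f 0.

Lemma psc0_zmod : zmod_morphism psc0. Proof. by []. Qed.
HB.instance Definition _ := GRing.isZmodMorphism.Build _ _ psc0 psc0_zmod.
Lemma psc0_monoid : monoid_morphism psc0.
Proof. by split=> // f g; rewrite /psc0 pscoefM big_ord1 subnn. Qed.
HB.instance Definition _ := GRing.isMonoidMorphism.Build _ _ psc0 psc0_monoid.

(** The vanishing entry makes [N] square to zero, so [1 - N] is its inverse partner. *)
Lemma transvection_unit (i : 'I_d) (r : 'rV[{poly k}]_d) : r 0 i = 0 ->
  1%:M + delta_mx i 0 *m r \in unitmx.
Proof.
move=> ri; set N := _ *m r.
have NN : N *m N = 0.
  rewrite /N mulmxA -[delta_mx i 0 *m r *m _]mulmxA.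
  suff -> : r *m delta_mx i 0 = 0 :> 'M[{poly k}]_1 by rewrite mulmx0 mul0mx.
  by rewrite -colE; apply/matrixP => x y; rewrite !mxE !ord1 ri.
have : (1%:M + N) *m (1%:M - N) = 1%:M.
  by rewrite mulmxBr mulmx1 mulmxDl mul1mx NN addr0 addrK.
by move/mulmx1_unit => [].
Qed.

(* If the reduction of B at x = 0 is singular, one row operation over k[t] replaces
   a row of B by x times an integral row. *)
Lemma reduction_step a (B : 'M[power_series k]_d) :
  \det B != 0 -> B \notin unitmx ->
  exists (E : 'M[{poly k}]_d) a' (B' : 'M[power_series k]_d),
    [/\ E \in unitmx, polyM E *m (Dmx a *m OM B) = Dmx a' *m OM B',
        \det B' != 0 & (ps_ord (\det B) = (ps_ord (\det B')).+1)%N].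
Proof.
move=> nzB nuB.
have det0 : \det (map_mx psc0 B) == 0.
  by rewrite det_map_mx; apply: contraR nuB => nz; rewrite unitmxE; apply/ps_unitP.
have /det0P[c nzc cB] := det0.
have /rV0Pn[i0 nzi0] := nzc.
(* [c] is a left kernel vector of the reduction. Taking [a i] maximal on its support makes every
   [a i - a l] nonnegative there, so the row operation has polynomial coefficients. *)
case: (Order.TotalTheory.arg_maxP a (P := fun l => c 0 l != 0) nzi0) => i nzi maxi.
pose r : 'rV[{poly k}]_d := \row_l (if l == i then 0 else
  (c 0 l / c 0 i)%:P * 'X^(absz (a i - a l))).
have ri : r 0 i = 0 by rewrite mxE eqxx.
pose E := 1%:M + delta_mx i 0 *m r.
have uE : E \in unitmx by exact: transvection_unit.
have rowi j : exists b, \sum_l psC (c 0 l / c 0 i) * B l j = psX k * b.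
  apply: ps_divX; rewrite -/(psc0 _) rmorph_sum.
  transitivity ((c *m map_mx psc0 B) 0 j / c 0 i); last by rewrite cB mxE mul0r.
  rewrite mxE mulr_suml; apply: eq_bigr => l _.
  by rewrite rmorphM mxE {1}/psc0 /= mulrAC.
pose b j := sval (cid (rowi j)).
have bE j : \sum_l psC (c 0 l / c 0 i) * B l j = psX k * b j := svalP (cid (rowi j)).
pose B' : 'M[power_series k]_d := \matrix_(m, j) if m == i then b j else B m j.
(* The new row [i] is divisible by x = t^-1, and pulling x out lowers its exponent by one. *)
pose a' m := a m - (m == i)%:R.
have eE : polyM E *m (Dmx a *m OM B) = Dmx a' *m OM B'.
  apply/matrixP => m j; rewrite mul_Dmx.
  have EE l : E m l = (m == l)%:R + (m == i)%:R * r 0 l.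
    rewrite mxE mxE; congr (_ + _); rewrite mxE big_ord1 mxE eqxx andbT //.
  have [emi|nmi] := eqVneq m i; last first.
    rewrite mxE (bigD1 m) //= big1 => [|l nlm].
      rewrite addr0 mxE EE eqxx (negPf nmi) mul0r addr0 rmorph1 mul1r mul_Dmx.
      by rewrite /a' (negPf nmi) subr0 !mxE (negPf nmi).
    by rewrite mxE EE eq_sym (negPf nlm) (negPf nmi) mul0r addr0 rmorph0 mul0r.
  subst m; rewrite mxE /a' eqxx expfzDr ?tF_neq0 // exprN1 /tF invrK -/(tF k).
  rewrite [OM B' i j]mxE mxE eqxx -mulrA -rmorphM -bE rmorph_sum mulr_sumr.
  apply: eq_bigr => l _; rewrite mxE EE eqxx mul1r mul_Dmx mxE rmorphM !mulrA.
  congr (_ * _); last by rewrite mxE.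
  have [eli|nli] := eqVneq l i.
    by rewrite eli addr0 rmorph1 mul1r divff // -/(1 : power_series k) rmorph1 mulr1.
  rewrite add0r.
  have [cl0|nzl] := eqVneq (c 0 l) 0.
    by rewrite cl0 mul0r !rmorph0 mul0r rmorph0 mul0r mulr0.
  rewrite polytoFM polytoFC rmorphXn /= polytoFX [RHS]mulrC -mulrA; congr (_ * _).
  have le_li : a l <= a i := maxi l nzl.
  have /gez0_abs e : 0 <= a i - a l by rewrite subr_ge0.
  by rewrite exprnP e -expfzDr ?tF_neq0 // subrK.
(* Determinants suffice to measure the progress: [E] contributes absolute value 1 and the diagonal
   part loses one factor q. *)
have labsE : q * labs (OtoF (\det B)) = labs (OtoF (\det B')).
  have /(congr1 (fun M => labs (\det M))) := eE.
  rewrite !det_mulmx !labsM labs_det_poly // mul1r !labs_det_Dmx !det_map_mx.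
  have -> : \sum_m a' m = \sum_m a m - 1.
    rewrite /a' big_split /= sumrN; congr (_ - _).
    by rewrite (bigD1 i) //= eqxx big1 ?addr0 // => m /negPf ->.
  rewrite expfzDr ?q_neq0 // exprN1 -!mulrA => /(mulfI _) -> //.
    by rewrite mulVKf ?q_neq0.
  by rewrite expfz_neq0 ?q_neq0.
have nzB' : \det B' != 0.
  rewrite -OtoF_eq0 -(labs_neq0 R) -labsE mulf_neq0 ?q_neq0 //.
  by rewrite labs_neq0 OtoF_eq0.
exists E, a', B'; split=> //.
move: labsE; rewrite !labs_OtoF // -{1}(expr1z q) -expfzDr ?q_neq0 //.
move/q_expzI; lia.
Qed.

(** Induction on the order of [\det B], which [reduction_step] lowers by one until [B] is
    invertible. The initial [B] is [A] divided by a power of t that bounds all its entries. *)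
Lemma birkhoff_unsorted (A : 'M[F]_d) : A \in unitmx ->
  exists (g : 'M[{poly k}]_d) a (B : 'M[power_series k]_d),
    [/\ g \in unitmx, B \in unitmx & polyM g *m A = Dmx a *m OM B].
Proof.
move=> uA.
suff H N : forall (g : 'M[{poly k}]_d) a (B : 'M[power_series k]_d),
    g \in unitmx -> \det B != 0 -> polyM g *m A = Dmx a *m OM B ->
    ps_ord (\det B) = N ->
  exists (g : 'M[{poly k}]_d) a (B : 'M[power_series k]_d),
    [/\ g \in unitmx, B \in unitmx & polyM g *m A = Dmx a *m OM B].
  have [m Hm] : exists m : nat, forall i j, labs (A i j) <= q ^ m%:Z.
    have Hij (ij : 'I_d * 'I_d) : exists m : nat, labs (A ij.1 ij.2) <= q ^ m%:Z.
      have [->|/(@labs_eq _ R)[m ->]] := eqVneq (A ij.1 ij.2) 0.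
        by exists 0%N; rewrite labs0 ler01.
      by exists (absz m); rewrite ler_eXz2l ?q_gt1 //; lia.
    pose e ij := sval (cid (Hij ij)).
    exists (\max_ij e ij)%N => i j; apply: le_trans (svalP (cid (Hij (i, j)))) _.
    by rewrite ler_eXz2l ?q_gt1 // lez_nat (leq_bigmax (i, j)).
  pose a := (fun _ => m%:Z) : 'I_d -> int.
  have [|B eB] := @OM_le1 _ _ (Dmx (fun i => - a i) *m A).
    move=> i j; rewrite mul_Dmx labsM labs_tFz /a -invr_expz.
    by rewrite mulrC ler_pdivrMr ?mul1r ?exprz_gt0 ?q_gt0.
  have eA : A = Dmx a *m OM B.
    rewrite -eB mulmxA; apply/matrixP => i j; rewrite -mulmxA !mul_Dmx mulrA.
    by rewrite -expfzDr ?tF_neq0 // subrr expr0z mul1r.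
  apply: (H _ 1%:M a B (unitmx1 _ _)) (erefl _); last by rewrite map_mx1 mul1mx.
  have : \det A != 0 by rewrite -unitfE -unitmxE.
  by rewrite eA det_mulmx mulf_eq0 negb_or det_map_mx OtoF_eq0 => /andP[].
elim: N => [|N IH] g a B ug nzB e oB.
  exists g, a, B; split=> //; rewrite unitmxE; apply/ps_unitP.
  by rewrite -oB; case: (ps_ordP nzB).
have nuB : B \notin unitmx.
  rewrite unitmxE; apply/negP => /(ps_ordXnu 0); rewrite expr0 mul1r oB //.
have [E [a' [B' [uE eE nzB' oB']]]] := reduction_step a nzB nuB.
apply: (IH (E *m g) a' B') => //; first by rewrite unitmx_mul uE.
  by rewrite map_mxM -mulmxA e.
by move: oB'; rewrite oB => -[].
Qed.

Lemma sort_perm a : exists s : 'S_d, forall i j : 'I_d, (i <= j)%N -> a (s j) <= a (s i).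
Proof.
pose t := [tuple a i | i < d].
have st : size (sort >=%O t) == d by rewrite size_sort size_tuple.
have /tuple_permP[s es] : perm_eq (Tuple st) t by rewrite perm_sort.
exists s => i j le_ij.
have nthE (l : 'I_d) : nth 0 (sort >=%O t) l = a (s l).
  have -> : sort >=%O t = [tuple tnth t (s l) | l < d] := es.
  by rewrite -tnth_nth !tnth_mktuple.
rewrite -!nthE; have := sort_sorted (T := int) (leT := >=%O) ge_total t.
move/(sorted_leq_nth ge_trans ge_refl 0); apply => //.
  by rewrite inE (eqP st).
by rewrite inE (eqP st).
Qed.

Lemma birkhoff (A : 'M[F]_d) : A \in unitmx ->
  exists (g : 'M[{poly k}]_d) a (B : 'M[power_series k]_d),
    [/\ g \in unitmx, B \in unitmx, polyM g *m A = Dmx a *m OM B &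
        forall i j : 'I_d, (i <= j)%N -> a j <= a i].
Proof.
move=> /birkhoff_unsorted[g [a [B [ug uB e]]]].
have [s hs] := sort_perm a.
exists (perm_mx s *m g), (fun i => a (s i)), (perm_mx s *m B).
split=> //; rewrite ?unitmx_mul ?unitmx_perm //.
rewrite !map_mxM -mulmxA e !map_perm_mx -!row_permE.
by apply/matrixP => i j; rewrite mxE !mul_Dmx !mxE.
Qed.

(** Pigeonhole: the d - r indices from r on cannot all be sent into the d - r - 1 values above r. *)
Lemma inj_ord_meet (f : 'I_d -> 'I_d) (r : 'I_d) : injective f ->
  exists i : 'I_d, (r <= i)%N && (f i <= r)%N.
Proof.
move=> injf; apply/existsP; apply: contraT; rewrite negb_exists => /forallP H.
have sub : {subset codom (fun i : {i : 'I_d | (r <= i)%N} => f (val i)) <=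
    [pred i : 'I_d | (r < i)%N]}.
  move=> x /codomP[[i ri] ->]; rewrite !inE /=.
  by have := H i; rewrite ri /= -ltnNge.
have := subset_leq_card (introT fintype.subsetP sub).
rewrite card_codom => [|i j /injf /val_inj //]; rewrite card_sig.
rewrite leqNgt proper_card //; apply/properP; split.
  by apply/fintype.subsetP => i; rewrite !inE; exact: ltnW.
by exists r; rewrite !inE ?ltnn.
Qed.

(** The zero block has d - r rows and r + 1 columns, one too many in total for a permutation to
    avoid it. *)
Lemma det_zero_block (T : comNzRingType) (M : 'M[T]_d) (r : 'I_d) :
  (forall i j : 'I_d, (r <= i)%N -> (j <= r)%N -> M i j = 0) -> \det M = 0.
Proof.
move=> M0; rewrite /determinant big1 // => s _.
have [i /andP[ri sr]] := inj_ord_meet r (@perm_inj _ s).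
by rewrite (bigD1 i) //= M0 // mul0r mulr0.
Qed.

(** The relation bounds the degree of [g i l] by m + a'_i - a_l. If a_r > a'_r + m for some r,
    monotonicity makes these bounds negative on a block that forces [\det g = 0]. So a <= a' + m
    everywhere, and comparing determinants shows that the sums agree. *)
Lemma Dmx_unique a a' (g : 'M[{poly k}]_d) (B : 'M[power_series k]_d) (c : F) :
  c != 0 -> g \in unitmx -> B \in unitmx ->
  (forall i j : 'I_d, (i <= j)%N -> a j <= a i) ->
  (forall i j : 'I_d, (i <= j)%N -> a' j <= a' i) ->
  polyM g *m Dmx a *m OM B = c *: Dmx a' ->
  exists m, forall i, a i = a' i + m.
Proof.
move=> nzc ug uB da da' e.
have [m em] := labs_eq R nzc; exists m.
have bound i l : labs (polyM g i l) <= q ^ (m + a' i - a l).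
  have eg : polyM g *m Dmx a = c *: (Dmx a' *m OM (invmx B)).
    by rewrite OM_inv // scalemxAl -e mulmxK ?OM_unit.
  have := congr1 (fun M : 'M[F]_d => M i l) eg; rewrite mul_mx_Dmx [RHS]mxE mul_Dmx [OM _ _ _]mxE.
  move=> /(congr1 labs); rewrite !labsM em !labs_tFz => e'.
  rewrite expfzDr ?q_neq0 // -invr_expz ler_pdivlMr ?exprz_gt0 ?q_gt0 //.
  rewrite e' expfzDr ?q_neq0 // mulrA ler_piMr ?labs_OtoF_le1 //.
  by rewrite mulr_ge0 // exprz_ge0 // ltW ?q_gt0.
have ge r : a r <= a' r + m.
  rewrite leNgt; apply/negP => lt_r.
  have : \det g = 0.
    apply: (@det_zero_block _ _ r) => i l ri lr; apply/eqP; rewrite -polytoF_eq0 //.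
    have := bound i l; rewrite mxE; apply: contraTT => nz.
    rewrite -ltNge; apply: lt_le_trans (_ : 1 <= _).
      rewrite -(expr0z q) ltr_eXz2l ?q_gt1 //.
      have := da' _ _ ri; have := da _ _ lr; lia.
    by rewrite labs_polytoF ?exprn_ege1 ?ltW ?q_gt1 // -(polytoF_eq0 R).
  by apply/eqP; apply: contraTneq ug => g0; rewrite unitmxE g0 unitr0.
have sumE : \sum_i a i = \sum_i (a' i + m).
  have := congr1 (fun M => labs (\det M)) e.
  rewrite !det_mulmx !labsM labs_det_poly // labs_det_O // mul1r mulr1 labs_det_Dmx.
  rewrite detZ labsM labsX em labs_det_Dmx exprnP exprz_exp -expfzDr ?q_neq0 //.
  move/q_expzI ->.
  by rewrite big_split /= sumr_const card_ord addrC -mulr_natr natz.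
move=> i; apply/eqP; rewrite -subr_eq0.
have : \sum_i (a' i + m - a i) == 0 by rewrite sumrB sumE subrr.
rewrite psumr_eq0 => [/allP/(_ i (mem_index_enum i))|l _]; last by rewrite subr_ge0.
by rewrite !subr_eq0 eq_sym.
Qed.

End Reduction.

(** * Counting parabolic subgroups *)

Section Parabolic.
Variable k : finFieldType.
Local Notation q := #|k|.

Definition Qnat n := (\prod_(1 <= j < n.+1) (q ^ j - 1))%N.

Lemma card_unitmx n : #|[pred M : 'M[k]_n | M \in unitmx]| = (q ^ 'C(n, 2) * Qnat n)%N.
Proof.
case: n => [|n].
  rewrite /Qnat big_nil muln1 (eq_card (B := pred1 (0 : 'M[k]_0))) ?card1 // => M.
  by rewrite !inE flatmx0 eqxx unitmxE det_mx00 unitr1.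
rewrite -card_GL // cardsT -(fintype.card_image (@val_inj _ _ {'GL_(n.+1)[k]})).
apply: eq_card => M; rewrite !inE; apply/idP/codomP => [uM|[u ->]].
  by exists (insubd (1%g : {'GL_(n.+1)[k]}) M); rewrite val_insubd uM.
exact: (valP (u : {'GL_(n.+1)[k]})).
Qed.

(** The stabilizer of a standard flag, [s] listing the dimensions of its proper members. *)
Definition parabolic (s : seq nat) d : {pred 'M[k]_d} :=
  [pred M | (M \in unitmx) && [forall i : 'I_d, forall l : 'I_d,
     has (fun x => l < x <= i)%N s ==> (M i l == 0)]].

Arguments parabolic : clear implicits.

Lemma binD2 x e : 'C(x + e, 2) = ('C(x, 2) + 'C(e, 2) + x * e)%N.
Proof.
elim: x => [|x IH]; first by rewrite bin0n mul0n addn0.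
by rewrite addSn !(binS _ 1) IH !bin1 mulSn; ring.
Qed.

(** Splitting off the first block shifts the remaining cuts by its size and leaves the block lengths
    alone. *)
Lemma pairmap_sub (s : seq nat) x y : path leq x s -> (y <= x)%N ->
  pairmap (fun a b => b - a)%N x s =
  pairmap (fun a b => b - a)%N (x - y)%N [seq b - y | b <- s]%N.
Proof.
elim: s x => //= b s IH x /andP[le_xb ps] le_yx.
by rewrite subnBA // subnK ?(leq_trans le_yx) // -IH // (leq_trans le_yx).
Qed.

Lemma path_ltn_sub (s : seq nat) x y : path ltn x s -> (y <= x)%N ->
  path ltn (x - y)%N [seq b - y | b <- s]%N.
Proof.
elim: s x => //= b s IH x /andP[lt_xb /IH H] le_yx.
by rewrite ltn_sub2r ?H ?(leq_trans le_yx) ?(leq_ltn_trans le_yx) // ltnW.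
Qed.

(** Induction on the number of cuts: the first block gives an invertible matrix of size x, a free x
    by e rectangle and a smaller parabolic matrix. The powers of q recombine by [binD2]. *)
Lemma card_parabolic (s : seq nat) d : path ltn 0%N (rcons s d) ->
  #|parabolic s d| = (q ^ 'C(d, 2) *
    \prod_(l <- pairmap (fun a b => b - a)%N 0%N (rcons s d)) Qnat l)%N.
Proof.
have [m] := ubnP (size s); elim: m s d => // m IHm [|x s] d.
  move=> _ _ /=; rewrite big_seq1 subn0 -card_unitmx; apply: eq_card => M.
  rewrite !inE; case: (_ \in _) => //=.
  by apply/forallP => i; apply/forallP.
rewrite ltnS rcons_cons /= => le_sm /andP[x0 ps].
have {}IHm := IHm [seq b - x | b <- s]%N; rewrite size_map in IHm.
have lt_xd : (x < d)%N.
  move: ps; rewrite rcons_path.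
  move=> /andP[ps]; apply: leq_ltn_trans.
  elim: s x {IHm le_sm x0} ps => //= y s IH x /andP[lt_xy /IH]; exact/leq_trans/ltnW.
pose e := (d - x)%N; have ed : d = (x + e)%N by rewrite subnKC // ltnW.
move: ps {lt_xd}; rewrite ed; move: e {ed} => e {d} ps.
rewrite big_cons subn0 (@pairmap_sub _ x x) //; last first.
  by apply: sub_path ps => a b; exact: ltnW.
rewrite subnn map_rcons addKn.
have ps' : path ltn 0%N (rcons [seq b - x | b <- s]%N e).
  by have := path_ltn_sub ps (leqnn x); rewrite subnn map_rcons addKn.
pose f (X : 'M[k]_x * 'M[k]_(x, e) * 'M[k]_e) := block_mx X.1.1 X.1.2 0 X.2.
have f_inj : injective f.
  by move=> [[A B] D] [[A' B'] D'] /eq_block_mx[/= -> -> _ ->].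
rewrite -[LHS](_ : #|[seq f X | X in [pred X : 'M[k]_x * 'M[k]_(x, e) * 'M[k]_e |
   (X.1.1 \in unitmx) && (X.2 \in parabolic [seq b - x | b <- s]%N e)]]| = _); last first.
  apply: eq_card => M; apply/fintype.imageP/idP.
    move=> [[[A B] D] /andP[/= uA /andP[uD /forallP HD]] ->].
    rewrite inE /f /= unitmxE det_ublock unitrM -!unitmxE uA uD /=.
    apply/forallP => i; apply/forallP => l; apply/implyP.
    move=> /orP[/andP[lb bi]|/seq.hasP[b bs /andP[lb bi]]].
      rewrite -(splitK i) -(splitK l); case: splitP bi => /= [i' -> |i' _ _].
        by rewrite leqNgt ltn_ord.
      case: (splitP l) => /= [l' _|l' el]; last by move: lb; rewrite el ltnNge leq_addr.
      by rewrite block_mxEdl mxE.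
    have le_xb : (x < b)%N.
      have /allP := order_path_min ltn_trans ps; apply.
      by rewrite mem_rcons inE bs orbT.
    rewrite -(splitK i) -(splitK l); case: splitP bi => /= [i' -> |i' -> bi].
      by move/(leq_trans le_xb); rewrite ltnNge ltnW ?ltn_ord.
    case: splitP lb => /= [l' _ _|l' -> lb].
      by rewrite block_mxEdl mxE.
    rewrite block_mxEdr; have /forallP/(_ l')/implyP := HD i'; apply.
    apply/seq.hasP; exists (b - x)%N; first by apply: map_f.
    by rewrite ltn_subRL lb leq_subLR.
  move=> /andP[uM /forallP HM].
  have M0 : dlsubmx M = 0.
    apply/matrixP => i l; rewrite !mxE; apply/eqP.
    have /forallP/(_ (lshift e l))/implyP := HM (rshift x i); apply.
    by apply/seq.hasP; exists x; rewrite ?mem_head //= ltn_ord leq_addr.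
  exists (ulsubmx M, ursubmx M, drsubmx M); last by rewrite /f /= -M0 submxK.
  have : M = block_mx (ulsubmx M) (ursubmx M) 0 (drsubmx M) by rewrite -M0 submxK.
  move=> eM; have := uM; rewrite {1}eM unitmxE det_ublock unitrM -!unitmxE.
  move=> /andP[uA uD]; rewrite !inE /= uA uD /=.
  apply/forallP => i; apply/forallP => l; apply/implyP => /seq.hasP[_ /mapP[b bs ->]] /andP[lb bi].
  have /forallP/(_ (rshift x l))/implyP := HM (rshift x i); rewrite !mxE; apply.
  apply/seq.hasP; exists b; first by rewrite inE bs orbT.
  by move: lb bi; rewrite /= ltn_subRL leq_subLR => -> ->.
rewrite fintype.card_image // -[LHS](_ : #|[predX [predX [pred A : 'M[k]_x | A \in unitmx] &
    {: 'M[k]_(x, e)}] & parabolic [seq b - x | b <- s]%N e]| = _); last first.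
  by apply: eq_card => -[[A B] D]; rewrite !inE andbT.
rewrite !cardX card_unitmx IHm // card_mx.
by rewrite binD2 !expnD; ring.
Qed.

End Parabolic.

(** * Points of Y and their masses *)

Section Representatives.
Variables (k : finFieldType) (R : realType) (d' : nat).
Local Notation d := d'.+1.
Local Notation F := (laurent k).
Local Notation q := (#|k|%:R : R).
Local Notation labs := (@labs k R).
Local Notation polyM := (map_mx (@polytoF k)).
Local Notation OM := (map_mx (@OtoF k)).
Implicit Types (n : {ffun 'I_d -> nat}).

(** Rows are numbered from 0, so the gap between rows i and i+1 is [n] at i+1; the last exponent is
    normalized to 0. *)
Definition aexp n (i : 'I_d) : nat := (\sum_(l < d | (i < l)%N) n l)%N.

(* Coordinate 0 is a dummy, so that the remaining ones are indexed by 1, ..., d-1. *)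
Definition nvec : set {ffun 'I_d -> nat} := [set n | n ord0 = 0%N].

Lemma aexp_step n (i j : 'I_d) : j = i.+1 :> nat -> aexp n i = (n j + aexp n j)%N.
Proof.
move=> ej; rewrite /aexp (bigD1 j) /= ?ej //; congr (_ + _)%N.
by apply: eq_bigl => l; rewrite [RHS]ltn_neqAle -(inj_eq val_inj) /= ej eq_sym andbC.
Qed.

Lemma aexp_last n : aexp n ord_max = 0%N.
Proof. by rewrite /aexp big1 // => l; rewrite ltnNge -ltnS ltn_ord. Qed.

Lemma aexp_anti n (i j : 'I_d) : (i <= j)%N -> (aexp n j <= aexp n i)%N.
Proof.
move=> le_ij; rewrite /aexp [leqRHS](bigID (fun l : 'I_d => (j < l)%N)) /=.
apply: leq_trans (leq_addr _ _); apply: eq_leq; apply: eq_bigl => l.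
by case: ltnP => [lt_jl|]; rewrite ?andbF // andbT (leq_ltn_trans le_ij lt_jl).
Qed.

Lemma aexp_inj n n' : nvec n -> nvec n' -> aexp n =1 aexp n' -> n = n'.
Proof.
move=> n0 n'0 e; apply/ffunP => -[[|j] lt_jd].
  by rewrite (_ : Ordinal _ = ord0) ?n0 ?n'0 //; apply: val_inj.
pose i := Ordinal (ltnW lt_jd); have := @aexp_step n i (Ordinal lt_jd) erefl.
rewrite e (@aexp_step n' i (Ordinal lt_jd) erefl) e => /eqP.
by rewrite eqn_add2r => /eqP.
Qed.

Definition nexp n (i : 'I_d) : int := (aexp n i)%:Z.
Definition DGL n : GL F d := exist _ (Dmx k (nexp n)) (Dmx_unit k (nexp n)).
Definition GLpoly (g : 'M[{poly k}]_d) (ug : g \in unitmx) : GL F d :=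
  exist _ (polyM g) (polyM_unit ug).
Definition GLO (B : 'M[power_series k]_d) (uB : B \in unitmx) : GL F d :=
  exist _ (OM B) (OM_unit uB).

Lemma toPGLMg (A B : GL F d) : (toPGL A * toPGL B)%g = toPGL (GLmul A B) :> G k d.
Proof. exact: toPGLM. Qed.

Lemma toPGLMg3 (A B C : GL F d) :
  (toPGL A * toPGL B * toPGL C)%g = toPGL (GLmul (GLmul A B) C) :> G k d.
Proof. by rewrite (toPGLMg A B) toPGLMg. Qed.

Lemma toPGLVg (A : GL F d) : (toPGL A)^-1%g = toPGL (GLinv A) :> G k d.
Proof. exact: toPGLV. Qed.

Lemma GammaP (x : G k d) :
  Gamma x <-> exists g (ug : g \in unitmx), x = toPGL (GLpoly ug).
Proof.
split=> [[g [A [ug eA ->]]]|[g [ug ->]]]; last by exists g, (GLpoly ug).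
by exists g, ug; congr toPGL; apply: val_inj.
Qed.

Lemma KP (x : G k d) : K x <-> exists B (uB : B \in unitmx), x = toPGL (GLO uB).
Proof.
split=> [[B [A [uB eA ->]]]|[B [uB ->]]]; last by exists B, (GLO uB).
by exists B, uB; congr toPGL; apply: val_inj.
Qed.

Definition cls n : Y k d := (\pi_(Y k d) (toPGL (DGL n) : G k d))%qT.

Lemma nvec_of_anti (a : 'I_d -> int) :
  (forall i j : 'I_d, (i <= j)%N -> a j <= a i) ->
  exists2 n, nvec n & forall i, a i = nexp n i + a ord_max.
Proof.
move=> anti; pose n := [ffun l : 'I_d => if l == ord0 then 0%N
  else absz (a (inord l.-1) - a l)].
exists n; first by rewrite /nvec /= ffunE.
suff H m (i : 'I_d) : (d' - i < m)%N -> a i = nexp n i + a ord_max by move=> i; exact: (H _ i (ltnSn _)).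
elim: m i => // m IH i lt_im.
have := ltn_ord i; rewrite ltnS leq_eqVlt => /orP[/eqP ei|lt_id].
  have -> : i = ord_max by apply: val_inj.
  by rewrite /nexp aexp_last add0r.
have lt_jd : (i.+1 < d)%N by [].
pose j := Ordinal lt_jd; rewrite /nexp (@aexp_step n i j) // PoszD -addrA -/(nexp n j).
rewrite -IH; last by rewrite /=; lia.
rewrite ffunE (_ : j == ord0 = false) //= inord_val gez0_abs ?subrK //.
by rewrite subr_ge0 anti //=.
Qed.

Lemma cls_surj (y : Y k d) : exists2 n, nvec n & cls n = y.
Proof.
pose r : G k d := repr y; pose A : GL F d := repr r.
have [g [a [B [ug uB e anti]]]] := birkhoff R (valP A).
have [n n0 ea] := nvec_of_anti anti; exists n => //.
rewrite -[y]reprK -/r -[r]toPGLK -/A; apply/esym/eqmodP.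
apply/asboolP; exists (toPGL (GLpoly ug)), (toPGL (GLO uB))^-1%g; split.
- by apply/GammaP; exists g, ug.
- by apply: imPGLV; apply/KP; exists B, uB.
rewrite toPGLVg toPGLMg3; apply/eqP/toPGL_eq => /=.
(* The homothety that brings the last exponent to 0. *)
exists (tF k ^ (- a ord_max)); first by rewrite expfz_neq0 ?tF_neq0.
rewrite -/(val A) e mulmxK ?OM_unit //; apply/matrixP => i j; rewrite !mxE.
rewrite mulrnAr; case: eqP => _; rewrite ?mulr0n ?mulr0 // !mulr1n.
by rewrite -expfzDr ?tF_neq0 // (ea i) addrCA addNr addr0.
Qed.

Lemma cls_inj n n' : nvec n -> nvec n' -> cls n = cls n' -> n = n'.
Proof.
move=> n0 n'0 /eqmodP/asboolP[_ [_ [/GammaP[g [ug ->]] /KP[B [uB ->]]]]].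
rewrite toPGLMg3 => /eqP/toPGL_eq[c nzc /= e].
have anti m (i j : 'I_d) : (i <= j)%N -> nexp m j <= nexp m i.
  by move=> /(aexp_anti m); rewrite lez_nat.
have nzc' : c^-1 != 0 by rewrite invr_eq0.
have [|m em] := @Dmx_unique k R d _ _ g B c^-1 nzc' ug uB (anti n) (anti n').
  by rewrite e scalerA mulVf // scale1r.
(* Both last exponents are 0, which leaves no room for a homothety. *)
have m0 : m = 0.
  by have := em ord_max; rewrite /nexp !aexp_last add0r.
by apply: aexp_inj => // i; have := em i; rewrite m0 addr0 => -[].
Qed.

(* The degree bounds cutting out Gamma :&: D K D^-1. *)
Definition degbound n (g : 'M[{poly k}]_d) :=
  forall i l, (size (g i l) <= (aexp n i).+1 - aexp n l)%N.

(** For a < b the truncated difference forces [p = 0], in accordance with nonzero polynomials having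
    absolute value at least 1. *)
Lemma degboundP (p : {poly k}) (a b : nat) :
  (labs (polytoF p) <= q ^ (a%:Z - b%:Z)) = (size p <= a.+1 - b)%N.
Proof.
have [le_ba|lt_ab] := leqP b a.
  rewrite subSn // -(labs_polytoF_size R) // subzn // -exprnP.
  have [->|nzp] := eqVneq p 0.
    by rewrite rmorph0 labs0 exprn_ge0 ?exprn_gt0 ?q_gt0 // ltW ?q_gt0.
  by rewrite labs_polytoF // ler_eXn2l ?ltr_eXn2l ?q_gt1.
have -> : (a.+1 - b = 0)%N by apply/eqP; rewrite subn_eq0.
rewrite leqn0 size_poly_eq0; have [->|nzp] := eqVneq p 0.
  by rewrite rmorph0 labs0 exprz_ge0 // ltW ?q_gt0.
apply/negbTE; rewrite -ltNge labs_polytoF //; apply: lt_le_trans (_ : 1 <= _).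
  by rewrite -(expr0z q) ltr_eXz2l ?q_gt1 //; lia.
by rewrite exprn_ege1 ?ltW ?q_gt1.
Qed.

(** An element of the stabilizer gives g D = c^-1 D B; determinants show that |c| = 1, so the scalar
    does not disturb the degree bounds. Conversely the bounds make D^-1 g D integral, and its
    determinant has absolute value 1. *)
Lemma stab_DGLP n (x : G k d) : stab (toPGL (DGL n)) x <->
  exists g (ug : g \in unitmx), degbound n g /\ x = toPGL (GLpoly ug).
Proof.
split=> [[/GammaP[g [ug ->]] [_ /KP[B [uB ->]]]]|[g [ug [db ->]]]].
  rewrite toPGLVg toPGLMg3 => /eqP/toPGL_eq[c nzc /= e]; exists g, ug; split=> //.
  have eg : polyM g *m Dmx k (nexp n) = c^-1 *: (Dmx k (nexp n) *m OM B).
    rewrite -[LHS]scale1r -(mulVf nzc) -scalerA scalemxAl -e mulmxKV //.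
    exact: Dmx_unit.
  have c1 : labs c^-1 = 1.
    have := congr1 (fun M => labs (\det M)) eg.
    rewrite detZ !det_mulmx !labsM labs_det_poly // labs_det_O // mul1r mulr1 labsX.
    have /(labs_eq R)[m ->] : c^-1 != 0 by rewrite invr_eq0.
    rewrite labs_det_Dmx exprnP exprz_exp -expfzDr ?q_neq0 // => /q_expzI.
    by move=> em; have -> : m = 0 by lia.
  move=> i l; rewrite -degboundP.
  have := congr1 (fun M : 'M[F]_d => M i l) eg.
  rewrite mul_mx_Dmx [RHS]mxE mul_Dmx ![(map_mx _ _) _ _]mxE.
  move=> /(congr1 labs); rewrite !labsM c1 mul1r !labs_tFz => e'.
  rewrite expfzDr ?q_neq0 // -invr_expz ler_pdivlMr ?exprz_gt0 ?q_gt0 //.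
  by rewrite e' ler_piMr ?labs_OtoF_le1 // exprz_ge0 // ltW ?q_gt0.
split; first by apply/GammaP; exists g, ug.
pose M := invmx (Dmx k (nexp n)) *m polyM g *m Dmx k (nexp n).
have eM : Dmx k (nexp n) *m M = polyM g *m Dmx k (nexp n).
  by rewrite /M !mulmxA mulmxV ?mul1mx // Dmx_unit.
have [|B eB] := @OM_le1 k R d d M.
  move=> i l; have := congr1 (fun M : 'M[F]_d => M i l) eM.
  rewrite mul_mx_Dmx mul_Dmx => /(congr1 labs); rewrite !labsM !labs_tFz => e.
  have := db i l; rewrite -degboundP expfzDr ?q_neq0 // -invr_expz.
  rewrite ler_pdivlMr ?exprz_gt0 ?q_gt0 // => H.
  rewrite -(@ler_pM2l _ (q ^ nexp n i)) ?exprz_gt0 ?q_gt0 // e mulr1.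
  by rewrite [polyM g i l]mxE.
have uB : B \in unitmx.
  rewrite unitmxE; apply/ps_unitP.
  have nz : \det M != 0.
    rewrite !det_mulmx det_inv mulrAC mulVf ?mul1r.
      by have := polyM_unit ug; rewrite unitmxE unitfE.
    by have := Dmx_unit k (nexp n); rewrite unitmxE unitfE.
  have l1 : labs (\det M) = 1.
    have := congr1 (fun M => labs (\det M)) eM; rewrite !det_mulmx !labsM.
    rewrite labs_det_poly // mul1r -[RHS]mulr1 => /mulfI; apply.
    by rewrite labs_det_Dmx expfz_neq0 ?q_neq0.
  move: nz l1; rewrite eB det_map_mx OtoF_eq0 => nz.
  rewrite labs_OtoF // -(expr0z q) => /q_expzI o0.
  by case: (ps_ordP nz); rewrite (_ : ps_ord _ = 0%N) //; lia.
exists (toPGL (GLO uB)); first by apply/KP; exists B, uB.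
rewrite toPGLVg toPGLMg3; congr toPGL; apply: val_inj => /=.
by rewrite -eB eM mulmxK ?Dmx_unit.
Qed.

(** The mass refers to a chosen representative; conjugation by [gam] carries its stabilizer to that
    of the diagonal one. *)
Lemma stab_conj (r : G k d) n : (\pi_(Y k d) r)%qT = cls n ->
  (stab r #= stab (toPGL (DGL n)))%card.
Proof.
move=> /eqmodP/asboolP[gam [kap [Gg Kk e]]].
have -> : stab (toPGL (DGL n)) = [set (gam * x * gam^-1)%g | x in stab r].
  apply/seteqP; split=> x /=; rewrite e.
    move=> [Gx [h Kh hx]]; exists (gam^-1 * x * gam)%g; last first.
      by rewrite !mulgA mulgV mul1g -mulgA mulgV mulg1.
    split; first by apply: imPGLM => //; apply: imPGLM => //; apply: imPGLV.
    exists (kap * h * kap^-1)%g.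
      by apply: imPGLM; [apply: imPGLM | apply: imPGLV].
    by rewrite -hx !invgM !mulgA mulVg mul1g -!mulgA mulVg mulg1.
  move=> [z [Gz [h Kh hz]] <-]; split.
    by apply: imPGLM; [apply: imPGLM | apply: imPGLV].
  exists (kap^-1 * h * kap)%g; first by apply: imPGLM => //; apply: imPGLM => //; apply: imPGLV.
  by rewrite -hz !invgM !mulgA !mulgK.
apply/card_esym/inj_card_eq => x y _ _ /mulIg /mulgI //.
Qed.

End Representatives.

(** Serves to divide out scalars: matrices are counted first, and their images in PGL have fibers of
    constant size. *)
Lemma card_const_fibers (T : finType) (U : choiceType) (A : {pred T}) (f : T -> U) c :
  (forall x, x \in A -> #|[pred y | (y \in A) && (f y == f x)]| = c) ->
  exists N, (N * c)%N = #|A| /\ ([set f x | x in [set x | x \in A]] #= `I_N)%card.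
Proof.
move=> fib; pose s := undup [seq f x | x <- enum A].
exists (size s); split; last first.
  have -> : [set f x | x in [set x | x \in A]] = [set` [fset y in s]%fset].
    apply/seteqP; split=> y /=; rewrite !inE mem_undup.
      by move=> [x xA <-]; apply: map_f; rewrite mem_enum.
    by move=> /mapP[x]; rewrite mem_enum => xA ->; exists x.
  have -> : size s = #|` [fset y in s]%fset| by rewrite card_fseq undup_id ?undup_uniq.
  exact/card_eq_fsetP.
have -> : #|A| = (\sum_(y <- s) #|[pred x | (x \in A) && (f x == y)]|)%N.
  rewrite -sum1_card.
  transitivity (\sum_(x in A) \sum_(y <- s) (f x == y))%N.
    apply: eq_bigr => x xA; rewrite -big_mkcond /= sum1_count.
    rewrite (eq_count (a2 := pred1 (f x))); last by move=> y; rewrite /= eq_sym.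
    by rewrite count_uniq_mem ?undup_uniq // mem_undup map_f ?mem_enum.
  rewrite exchange_big /=; apply: eq_bigr => y _.
  by rewrite -big_mkcondr /= sum1_card; apply: eq_card => x; rewrite !inE.
rewrite big_seq_cond (eq_bigr (fun _ => c)); last first.
  move=> y /andP[]; rewrite mem_undup => /mapP[x]; rewrite mem_enum => xA -> _.
  exact: fib.
by rewrite -big_seq_cond big_const_seq count_predT iter_addn_0 mulnC.
Qed.

(** * Orders of stabilizers *)

Section Mass.
Variables (k : finFieldType) (R : realType) (d' : nat).
Local Notation d := d'.+1.
Local Notation F := (laurent k).
Local Notation qn := (#|k|).
Local Notation polyM := (map_mx (@polytoF k)).
Variable n : {ffun 'I_d -> nat}.
Hypothesis n0 : nvec n.

Definition suppn : {set 'I_d} := [set i | (0 < n i)%N]%SET.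

(** The entries forced to vanish by the degree bounds are exactly the zeros of the parabolic
    subgroup with cuts at the support of n. *)
Lemma aexp_ltE (i l : 'I_d) : (aexp n i < aexp n l)%N =
  has (fun x => l < x <= i)%N [seq val x | x <- enum suppn].
Proof.
apply/idP/seq.hasP => [lt_il|[y /mapP[x]]].
  have le_li : (l <= i)%N.
    by rewrite leqNgt; apply/negP => /ltnW /(aexp_anti n); rewrite leqNgt lt_il.
  have : (0 < \sum_(x < d | (l < x)%N && (x <= i)%N) n x)%N.
    move: lt_il; rewrite /aexp [X in (_ < X)%N](bigID (fun x : 'I_d => (i < x)%N)) /=.
    rewrite [X in (_ < X + _)%N](eq_bigl (fun x : 'I_d => (i < x)%N)); last first.
      by move=> x; case: (ltnP i x) => [H|_]; rewrite ?andbF // andbT (leq_ltn_trans le_li H).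
    rewrite -[X in (X < _)%N]addn0 ltn_add2l.
    by under eq_bigl => x do rewrite -leqNgt.
  rewrite lt0n sum_nat_eq0 negb_forall => /existsP[x].
  rewrite negb_imply => /andP[lxi nx]; exists (val x) => //.
  by apply: map_f; rewrite mem_enum inE lt0n.
rewrite mem_enum inE => nx -> /= /andP[lx xi].
rewrite /aexp [X in (_ < X)%N](bigID (fun x : 'I_d => (i < x)%N)) /=.
rewrite [X in (_ < X + _)%N](eq_bigl (fun x : 'I_d => (i < x)%N)); last first.
  move=> z; case: (ltnP i z) => [H|_]; rewrite ?andbF // andbT.
  exact: leq_ltn_trans (leq_trans (ltnW lx) xi) H.
rewrite -[X in (X < _)%N]addn0 ltn_add2l (bigD1 x) /= ?addn_gt0 ?nx //.
by rewrite lx -leqNgt.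
Qed.

Lemma path_suppn : path ltn 0%N (rcons [seq val x | x <- enum suppn] d).
Proof.
rewrite -cats1 cat_path path_min_sorted; last first.
  apply/allP => y /mapP[x]; rewrite mem_enum inE => nx -> /=; rewrite lt0n.
  by apply: contraTneq nx => x0; rewrite (_ : x = ord0) ?n0 //; apply: val_inj.
apply/andP; split.
  rewrite sorted_map; apply: sorted_filter.
    by move=> y x z /=; exact: ltn_trans.
  by have := iota_ltn_sorted 0 d; rewrite -val_enum_ord sorted_map enumT.
rewrite /= andbT; case: (lastP (enum suppn)) => //= s x.
by rewrite map_rcons last_rcons ltn_ord.
Qed.

(** The number of free coefficients of positive degree: entry (i, l) admits the degrees 1 to a_i -
    a_l, none if this is not positive. *)
Definition rho : nat := (\sum_i \sum_l (aexp n i - aexp n l))%N.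

Let N := aexp n ord0.
Let HT : finType := ('I_d * 'I_d * 'I_N.+1)%type.
Let D : {pred HT} := [pred x : 'I_d * 'I_d * 'I_N.+1 | (x.2 < aexp n x.1.1 - aexp n x.1.2)%N].

Let le_aN i : (aexp n i <= N)%N. Proof. exact: aexp_anti. Qed.

Let cardD : #|D| = rho.
Proof.
rewrite -sum1_card big_mkcond /= (eq_bigr (fun x : HT =>
  (fun ij (t : 'I_N.+1) => (t < aexp n ij.1 - aexp n ij.2)%N : nat) x.1 x.2)); last first.
  by move=> x _; rewrite /D inE /=; case: (_ < _)%N.
rewrite -[LHS](pair_bigA _ (fun (ij : 'I_d * 'I_d) (t : 'I_N.+1) =>
  (t < aexp n ij.1 - aexp n ij.2)%N : nat)) /= /rho [RHS]pair_bigA /=.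
apply: eq_bigr => -[i l] _ /=.
have le_N : (aexp n i - aexp n l <= N.+1)%N.
  by apply: leq_trans (leq_subr _ _) _; apply: leqW.
rewrite -big_mkcond /= -(big_ord_widen _ (fun=> 1%N) le_N) sum1_card card_ord //.
Qed.

Let X : {pred 'M[k]_d * {ffun HT -> k}} :=
  [predX @parabolic k [seq val x | x <- enum suppn] d & pffun_on 0 D {: k}].

(** The constant term comes from the parabolic part; index [t'] of the finite function stands for
    degree t' + 1, hence the length N + 2. *)
Let gma (x : 'M[k]_d * {ffun HT -> k}) : 'M[{poly k}]_d :=
  \matrix_(i, l) \poly_(t < N.+2)
    (if t is t'.+1 then x.2 (i, l, inord t') else x.1 i l).

Let gma_inj : injective gma.
Proof.
move=> [M h] [M' h'] e.
have eil i l := congr1 (fun g : 'M[{poly k}]_d => g i l) e.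
congr pair.
  apply/matrixP => i l; have := congr1 (fun p : {poly k} => p`_0) (eil i l).
  by rewrite !mxE !coef_poly.
apply/ffunP => -[[i l] t]; have := congr1 (fun p : {poly k} => p`_(t.+1)) (eil i l).
by rewrite !mxE !coef_poly ltnS ltn_ord /= !inord_val.
Qed.

Let constM (g : 'M[{poly k}]_d) : 'M[k]_d := map_mx (fun p : {poly k} => p`_0) g.

(** In a nonzero term of the expansion along a permutation s, the degrees add up to at most the sum
    of a_i - a_(s i), which is 0. *)
Let det_degbound (g : 'M[{poly k}]_d) : degbound n g -> \det g = (\det (constM g))%:P.
Proof.
move=> db.
have sz : (size (\det g) <= 1)%N.
  apply: leq_trans (size_sum _ _ _) _; apply/bigmax_leqP => s _.
  rewrite -signr_odd mulr_sign (fun_if (fun p : {poly k} => size p)) size_polyN if_same.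
  have [/existsP[i /eqP gi0]|] := boolP [exists i, g i (s i) == 0].
    by rewrite (bigD1 i) //= gi0 mul0r size_poly0.
  rewrite negb_exists => /forallP nz; rewrite size_prod //.
  rewrite leq_subLR addn1 ltnS cardT size_enum_ord.
  suff : (\sum_i size (g i (s i)) + \sum_i aexp n (s i) <= \sum_i (aexp n i).+1)%N.
    rewrite [(\sum_i aexp n (s i))%N](_ : _ = \sum_i aexp n i)%N; last first.
      by rewrite [RHS](reindex_inj (@perm_inj _ s)).
    under [X in (_ <= X)%N]eq_bigr => i _ do rewrite -addn1.
    by rewrite big_split /= sum_nat_const card_ord muln1 addnC leq_add2l.
  rewrite -big_split /=; apply: leq_sum => i _.
  have := db i (s i); have : (0 < size (g i (s i)))%N by rewrite size_poly_gt0 nz.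
  move=> sz0 le_sz; have := leq_trans sz0 le_sz; rewrite subn_gt0 => /ltnW le.
  by rewrite addnC -leq_subRL.
rewrite [LHS](size1_polyC sz); congr (_%:P).
rewrite /constM -[RHS](_ : (\det (map_mx (horner_eval 0) g)) = _); last first.
  by congr (\det _); apply/matrixP => i l; rewrite !mxE /horner_eval horner_coef0.
by rewrite -horner_coef0 det_map_mx.
Qed.

Let gmaP g : (exists2 x, x \in X & g = gma x) <-> (g \in unitmx /\ degbound n g).
Proof.
have szE i l x : x \in X -> (size (gma x i l) <= (aexp n i).+1 - aexp n l)%N.
  move=> /andP[/andP[_ /forallP Hp] /pffun_onP[/fintype.subsetP sup _]].
  rewrite mxE; apply/leq_sizeP => t le_t; rewrite coef_poly; case: ifP => // lt_t.
  case: t le_t lt_t => [|t] le_t lt_t.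
    apply/eqP; have /forallP/(_ l)/implyP := Hp i; apply.
    by rewrite -aexp_ltE; lia.
  apply/eqP; apply: contraLR le_t => nz.
  have := sup (i, l, inord t) nz; rewrite inE /= inordK //; lia.
split=> [[x xX ->]|[ug db]].
  have db : degbound n (gma x) by move=> i l; exact: szE.
  split=> //; rewrite unitmxE det_degbound //.
  have -> : constM (gma x) = x.1.
    by apply/matrixP => i l; rewrite !mxE coef_poly.
  have /andP[/andP[ux _] _] := xX.
  by apply/poly_unitP; exists (\det x.1) => //; rewrite -unitfE -unitmxE.
pose h : {ffun HT -> k} := [ffun y : 'I_d * 'I_d * 'I_N.+1 =>
  (g y.1.1 y.1.2 : {poly k})`_(val y.2).+1].
exists (constM g, h); last first.
  apply/matrixP => i l; rewrite mxE; apply/polyP => t; rewrite coef_poly.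
  case: ltnP => [lt_t|le_t].
    case: t lt_t => [|t] lt_t; first by rewrite mxE.
    by rewrite ffunE /= inordK.
  apply: nth_default; apply: leq_trans (db i l) (leq_trans _ le_t).
  by have := le_aN i; lia.
apply/andP; split; last first.
  apply/pffun_onP; split=> //; apply/fintype.subsetP => -[[i l] t].
  rewrite !inE ffunE /= => nz; have := db i l.
  have : (t.+1 < size (g i l))%N.
    by rewrite ltnNge; apply: contra nz => le; rewrite nth_default.
  by lia.
apply/andP; split.
  have : \det g \is a GRing.unit by rewrite -unitmxE.
  rewrite det_degbound // => /poly_unitP[c nzc /polyC_inj ec].
  by rewrite unitmxE ec unitfE.
apply/forallP => i; apply/forallP => l; apply/implyP.
rewrite -aexp_ltE mxE => lt; rewrite nth_default //.
by apply: leq_trans (db i l) _; lia.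
Qed.

Let gma_unit x (xX : x \in X) : gma x \in unitmx.
Proof. by have [] := proj1 (gmaP (gma x)) (ex_intro2 _ _ x xX erefl). Qed.

Let phi (x : 'M[k]_d * {ffun HT -> k}) : G k d :=
  toPGL (insubd (GL1 F d) (polyM (gma x))).

Let phiE x (xX : x \in X) : phi x = toPGL (GLpoly (gma_unit xX)).
Proof.
by congr toPGL; apply: val_inj; rewrite val_insubd polyM_unit // gma_unit.
Qed.

Let scal (c : k) (x : 'M[k]_d * {ffun HT -> k}) := (c *: x.1, [ffun y => c * x.2 y]).

Let gma_scal c x : gma (scal c x) = c%:P *: gma x.
Proof.
apply/matrixP => i l; rewrite !mxE; apply/polyP => t; rewrite coefCM !coef_poly.
by case: ifP => _; rewrite ?mulr0 //; case: t => [|t]; rewrite ?mxE ?ffunE.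
Qed.

Let scalX c x : c != 0 -> x \in X -> scal c x \in X.
Proof.
move=> nzc xX; have [ug db] := proj1 (gmaP (gma x)) (ex_intro2 _ _ x xX erefl).
have [|y yX] := proj2 (gmaP (c%:P *: gma x)).
  split.
    by rewrite unitmxE detZ unitrM -unitmxE ug unitrX //; apply/poly_unitP; exists c.
  move=> i l; rewrite mxE mul_polyC; apply: leq_trans (size_scale_leq _ _) (db i l).
by rewrite -gma_scal => /gma_inj ->.
Qed.

(** If two of these matrices agree in PGL, their ratio is a scalar that is an entry of a polynomial
    matrix. Its d-th power divides a unit, so it is a nonzero constant, and there are q - 1 of
    these. *)
Let phi_fiber x : x \in X ->
  #|[pred y | (y \in X) && (phi y == phi x)]| = qn.-1.
Proof.
move=> xX; have ux := gma_unit xX.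
have uM : x.1 \in unitmx by have /andP[/andP[]] := xX.
transitivity #|[seq scal c x | c in [pred c : k | c != 0]]|; last first.
  rewrite fintype.card_image; first by rewrite -[RHS](cardC1 0); apply: eq_card.
  move=> c c' [/(congr1 (mulmx^~ (invmx x.1)))]; rewrite -!scalemxAl mulmxV //.
  by move=> /(congr1 (fun M : 'M[k]_d => M 0 0)); rewrite !mxE !mulr1.
apply: eq_card => y; rewrite !inE.
apply/andP/fintype.imageP => [[yX]|[c nzc ->]]; last first.
  split; first exact: scalX.
  rewrite (phiE xX) (phiE (scalX nzc xX)); apply/toPGL_eq; exists (OtoF (psC c)).
    by rewrite OtoF_eq0; apply: contraNneq nzc => /(congr1 (fun f => pscoef f 0)) /= ->.
  by apply/matrixP => i l; rewrite /= gma_scal !mxE polytoFM polytoFC.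
have uy := gma_unit yX.
rewrite (phiE xX) (phiE yX) => /toPGL_eq[c nzc /= e].
pose p := (gma y *m invmx (gma x)) ord0 ord0.
have ec : polyM (gma y *m invmx (gma x)) = c%:M.
  by rewrite map_mxM polyM_inv // e -scalemxAl mulmxV ?polyM_unit // scalemx1.
have cp : c = polytoF p.
  have := congr1 (fun M : 'M[F]_d => M ord0 ord0) ec.
  by rewrite [polyM _ _ _]mxE [c%:M _ _]mxE eqxx mulr1n => ->.
have ey : gma y = p *: gma x.
  apply/matrixP => i l; apply: polytoF_inj => //.
  have := congr1 (fun M : 'M[F]_d => M i l) e.
  by rewrite cp !mxE polytoFM.
have : p \is a GRing.unit.
  have := uy; rewrite ey unitmxE detZ unitrM => /andP[].
  by rewrite unitrX_pos.
move=> /poly_unitP[c0 nzc0 ep]; exists c0 => //.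
by apply: gma_inj; rewrite gma_scal -ep.
Qed.

Lemma card_stab_mul : exists N, [/\ (stab (toPGL (DGL k n)) #= `I_N)%card &
  (N * qn.-1 = qn ^ 'C(d, 2) * \prod_(l <- Blocks suppn) Qnat k l * qn ^ rho)%N].
Proof.
have [M [cM eM]] := card_const_fibers phi_fiber.
exists M; split.
  suff -> : stab (toPGL (DGL k n)) = [set phi x | x in [set x | x \in X]] by [].
  apply/seteqP; split=> [y /stab_DGLP[//|g [ug [db ->]]]|_ [x /= xX <-]].
    have [|x xX eg] := proj2 (gmaP g); first by [].
    exists x => //; rewrite phiE; congr toPGL; apply: val_inj; rewrite /= eg //.
  apply/stab_DGLP => //; exists (gma x), (gma_unit xX); split; last exact: phiE.
  by have [] := proj1 (gmaP (gma x)) (ex_intro2 _ _ x xX erefl).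
rewrite cM cardX card_pffun_on cardD card_parabolic ?path_suppn //.
Qed.

Lemma mass_cls : mass R (cls k n) = Cconst R qn suppn * (qn%:R ^+ rho)^-1.
Proof.
have [N' [cN eN]] := card_stab_mul.
have cN' : (stab (repr (cls k n)) #= `I_N')%card.
  by apply: card_eq_trans cN; apply: stab_conj; rewrite reprK.
rewrite /mass (card_fset_set cN') /Cconst.
have q1 : (1 < qn)%N by exact: card_finNzRing_gt1.
have Qn0 l : (0 < Qnat k l)%N.
  rewrite /Qnat big_nat; apply: prodn_cond_gt0 => j /andP[j0 _].
  by rewrite subn_gt0 -(exp1n j) ltn_exp2r.
have QE l : Qfact R qn l = (Qnat k l)%:R.
  rewrite /Qfact /Qnat natr_prod !big_nat; apply: eq_bigr => j /andP[j0 _].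
  by rewrite natrB ?natrX // expn_gt0 (ltnW q1).
have /(congr1 (fun x : nat => x%:R : R)) := eN.
rewrite !natrM natr_prod !natrX => {}eN.
have nzq : (qn%:R : R) != 0 by rewrite pnatr_eq0 -lt0n (ltnW q1).
have nzq1 : (qn.-1%:R : R) != 0 by rewrite pnatr_eq0 -lt0n -subn1 subn_gt0.
have -> : (qn%:R - 1 : R) = qn.-1%:R by rewrite -subn1 natrB // ltnW.
rewrite (eq_bigr (fun l => (Qnat k l)%:R^-1)); last by move=> l _; rewrite QE.
rewrite prodfV; set PQ := \prod_(l <- _) _ in eN *.
have nzPQ : PQ != 0.
  rewrite prodf_seq_neq0; apply/allP => l _ /=; rewrite pnatr_eq0 -lt0n Qn0 //.
have nzN : (N'%:R : R) != 0.
  have : (N'%:R * qn.-1%:R : R) != 0 by rewrite eN !mulf_neq0 ?expf_neq0.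
  by rewrite mulf_eq0 negb_or => /andP[].
apply: (mulIf nzN); rewrite mulVf //.
apply: (mulIf nzq1); rewrite -!mulrA eN.
by field; rewrite nzPQ !expf_neq0.
Qed.

End Mass.

(** * The height *)

Section WedgeNorm.
Variables (k : finFieldType) (R : realType).
Local Notation F := (laurent k).
Local Notation labs := (@labs k R).
Local Notation OM := (map_mx (@OtoF k)).
Implicit Types (d j : nat).

Definition increasing_ord j d (f : 'I_j -> 'I_d) :=
  forall a b : 'I_j, (a < b)%N -> (f a < f b)%N.

Lemma inj_sort j d (f : 'I_j -> 'I_d) : injective f ->
  exists s : 'S_j, increasing_ord (fun i => f (s i)).
Proof.
move=> injf; have [s hs] := sort_perm (fun i => - (f i)%:Z).
exists s => a b lt_ab; have := hs a b (ltnW lt_ab).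
rewrite lerN2 lez_nat leq_eqVlt => /orP[/eqP/val_inj/injf/perm_inj eab|//].
by rewrite eab ltnn in lt_ab.
Qed.

Lemma increasing_ord_ge j d (f : 'I_j -> 'I_d) : increasing_ord f ->
  forall i : 'I_j, (i <= f i)%N.
Proof.
move=> incf [i lt_ij]; elim: i lt_ij => // i IH lt_ij.
have := IH (ltnW lt_ij) => /= /leq_ltn_trans; apply; exact: incf.
Qed.

Lemma wedge_ge0 d j (V : 'M[F]_(d, j)) : 0 <= wedge_norm R V.
Proof.
rewrite /wedge_norm; elim/big_ind: _ => // [x y x0 y0|f _]; last exact: labs_ge0.
by rewrite le_max x0.
Qed.

(** The norm sees only increasing row selections, but an arbitrary one is controlled too: a
    repetition gives determinant 0, and sorting changes only the sign. *)
Lemma le_wedge d j (V : 'M[F]_(d, j)) (f : 'I_j -> 'I_d) :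
  labs (\det (rowsub f V)) <= wedge_norm R V.
Proof.
have [injf|] := boolP (injectiveb f); last first.
  move=> /injectivePn[x [y nxy fxy]].
  by rewrite (determinant_alternate nxy) ?labs0 ?wedge_ge0 // => i; rewrite !mxE fxy.
have [s incs] := inj_sort (elimT (injectiveP _) injf).
have -> : labs (\det (rowsub f V)) = labs (\det (rowsub (finfun (fun i => f (s i))) V)).
  have -> : rowsub (finfun (fun i => f (s i))) V = row_perm s (rowsub f V).
    by apply/matrixP => i l; rewrite !mxE ffunE.
  rewrite row_permE det_mulmx det_perm labsM labsX labsN labs1 expr1n mul1r //.
apply: le_bigmax_cond; apply/forallP => a; apply/forallP => b; apply/implyP => lt_ab.
by rewrite !ffunE incs.
Qed.

Lemma wedge_leP d j (V : 'M[F]_(d, j)) (c : R) : 0 <= c ->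
  (forall f : 'I_j -> 'I_d, labs (\det (rowsub f V)) <= c) -> wedge_norm R V <= c.
Proof. by move=> c0 H; apply: bigmax_le => // f _; apply: H. Qed.

(** Cauchy-Binet before grouping: all maps [h] are kept, injective or not, which suffices for
    ultrametric bounds. *)
Lemma det_rowsub_mul d j (B : 'M[F]_d) (V : 'M[F]_(d, j)) (f : 'I_j -> 'I_d) :
  \det (rowsub f (B *m V)) =
  \sum_(h : {ffun 'I_j -> 'I_d}) (\prod_i B (f i) (h i)) * \det (rowsub h V).
Proof.
rewrite {1}/determinant; under eq_bigr => s _.
  under eq_bigr => i _ do rewrite mxE mxE.
  rewrite bigA_distr_bigA mulr_sumr; over.
rewrite exchange_big /=; apply: eq_bigr => h _; rewrite /determinant mulr_sumr.
apply: eq_bigr => s _; rewrite big_split /= mulrCA; congr (_ * (_ * _)).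
by apply: eq_bigr => i _; rewrite mxE.
Qed.

Lemma wedge_OM d j (B : 'M[power_series k]_d) (V : 'M[F]_(d, j)) :
  wedge_norm R (OM B *m V) <= wedge_norm R V.
Proof.
apply: wedge_leP => [|f]; first exact: wedge_ge0.
rewrite det_rowsub_mul; apply: labs_sum_le => [|h _]; first exact: wedge_ge0.
rewrite labsM; apply: le_trans (le_wedge V h); rewrite ler_piMl ?labs_ge0 //.
rewrite labs_prod; apply: prodr_ile1 => i _.
by rewrite labs_ge0 mxE labs_OtoF_le1.
Qed.

Lemma wedge_scale d j (c : F) (V : 'M[F]_(d, j)) :
  wedge_norm R (c *: V) <= labs c ^+ j * wedge_norm R V.
Proof.
apply: wedge_leP => [|f]; first by rewrite mulr_ge0 ?exprn_ge0 ?labs_ge0 ?wedge_ge0.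
have -> : rowsub f (c *: V) = c *: rowsub f V by apply/matrixP => i l; rewrite !mxE.
by rewrite detZ labsM labsX ler_wpM2l ?exprn_ge0 ?labs_ge0 ?le_wedge.
Qed.

End WedgeNorm.

Section Height.
Variables (k : finFieldType) (R : realType) (d' : nat).
Local Notation d := d'.+1.
Local Notation F := (laurent k).
Local Notation q := (#|k|%:R : R).
Local Notation labs := (@labs k R).
Local Notation polyM := (map_mx (@polytoF k)).
Local Notation OM := (map_mx (@OtoF k)).
Variable n : {ffun 'I_d -> nat}.
Local Notation a := (aexp n).

Definition asum : nat := (\sum_i a i)%N.
(** Truncated subtraction keeps only the positive terms. As the a_i are nonincreasing, these form an
    initial segment, so their sum is the largest partial sum E(n). *)
Definition hexp : nat := (\sum_(i < d) (d * a i - asum))%N.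

(* The exponent of the contribution of rank j sublattices. *)
Definition pexp (j : nat) : int := \sum_(i < d | (i < j)%N) ((d * a i)%:Z - asum%:Z).

Lemma hexpE : hexp%:Z = \sum_(i < d) (d * a i - asum)%N%:Z.
Proof. exact: (big_morph Posz PoszD (erefl 0%:Z)). Qed.

Lemma pexp_le j : pexp j <= hexp%:Z.
Proof.
rewrite /pexp hexpE big_mkcond /=.
by apply: ler_sum => i _; case: ifP => _; lia.
Qed.

(* The rank at which the maximum defining alpha is attained. *)
Definition jump : nat := #|[pred i : 'I_d | (asum < d * a i)%N]|.

Lemma jumpP (i : 'I_d) : (i < jump)%N = (asum < d * a i)%N.
Proof.
have le_anti (x y : 'I_d) : (x <= y)%N -> (asum < d * a y)%N -> (asum < d * a x)%N.
  by move=> le_xy /leq_trans; apply; rewrite leq_mul2l (aexp_anti n le_xy) orbT.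
apply/idP/idP => [|lt_i].
  apply: contraLR; rewrite -!leqNgt => le_i.
  have sub : [pred i : 'I_d | (asum < d * a i)%N] \subset [pred x : 'I_d | (x < i)%N].
    apply/fintype.subsetP => x; rewrite !inE ltnNge => lt_x; rewrite ltnNge.
    by apply: contra lt_x => /le_anti H; rewrite leqNgt; apply/negP => /H; rewrite ltnNge le_i.
  apply: leq_trans (subset_leq_card sub) _.
  rewrite -sum1_card -(big_ord_widen _ (fun=> 1%N)) ?sum1_card ?card_ord //.
  exact/ltnW.
have sub : [pred x : 'I_d | (x <= i)%N] \subset [pred i : 'I_d | (asum < d * a i)%N].
  by apply/fintype.subsetP => x; rewrite !inE => /le_anti; apply.
apply: leq_trans (subset_leq_card sub).
by rewrite -sum1_card -(big_ord_widen _ (fun=> 1%N) (ltn_ord i)) sum1_card card_ord.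
Qed.

Lemma jump_lt : (jump < d)%N.
Proof. by rewrite ltnS leqNgt (jumpP ord_max) aexp_last muln0. Qed.

Lemma pexp_jump : pexp jump = hexp%:Z.
Proof.
rewrite /pexp hexpE big_mkcond /=.
by apply: eq_bigr => i _; rewrite jumpP; case: ltnP => H; lia.
Qed.

(** The height ranges over ranks at least 1. When [jump] is 0, rank d replaces it: the full sum of
    the deviations from the mean is 0 as well. *)
Lemma pexp_max : exists j, (1 <= j <= d)%N /\ pexp j = hexp%:Z.
Proof.
have [J0|Jpos] := posnP jump; last first.
  by exists jump; rewrite pexp_jump Jpos ltnW ?jump_lt.
exists d; rewrite leqnn -pexp_jump J0; split=> //.
rewrite /pexp [RHS]big_pred0 // (eq_bigl xpredT); last by move=> i; rewrite ltn_ord.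
rewrite big_split /= sumrN sumr_const card_ord -(big_morph Posz PoszD (erefl 0%:Z)).
by rewrite -big_distrr /= -/asum -mulr_natl; lia.
Qed.

Lemma pexpE j (le_jd : (j <= d)%N) :
  pexp j = (d * \sum_(i < j) a (widen_ord le_jd i))%N%:Z - (j * asum)%N%:Z.
Proof.
rewrite /pexp big_split /= sumrN; congr (_ - _).
  rewrite big_distrr /= (big_morph Posz PoszD (erefl 0%:Z)).
  pose G x := if insub x is Some i then (d * a i)%N%:Z else 0.
  rewrite (eq_bigr (fun i : 'I_d => G i)); last by move=> i _; rewrite /G valK.
  rewrite -(big_ord_widen _ G le_jd); apply: eq_bigr => i _.
  by rewrite /G (_ : val i = val (widen_ord le_jd i)) ?valK.
by rewrite -(big_ord_widen _ (fun=> asum%:Z) le_jd) sumr_const card_ord -mulr_natl; lia.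
Qed.

Variables (c : F) (B : 'M[power_series k]_d) (g : 'M[{poly k}]_d).
Hypotheses (nzc : c != 0) (uB : B \in unitmx) (ug : g \in unitmx).
(** The height is taken at the inverse of a representative, hence the negated exponents; [c], [B]
    and [g] absorb the choice within the double coset. *)
Let Dm := Dmx k (fun i => - nexp n i).
Let Gm := c *: (OM B *m Dm *m polyM g).

Lemma lattice_cols j (V : 'M[F]_(d, j)) :
  (forall b, lattice Gm (col b V)) <-> exists W, V = Gm *m polyM W.
Proof.
split=> [H|[W ->] b]; last first.
  exists (col b W) => //; apply/matrixP => i l; rewrite !mxE.
  by apply: eq_bigr => x _; rewrite !mxE.
have H' b : {w | col b V = Gm *m polyM w}.
  by apply: cid; have [w _ <-] := H b; exists w.
exists (\matrix_(i, b) (sval (H' b)) i 0); apply/matrixP => i b.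
have := congr1 (fun M : 'cV[F]_d => M i 0) (svalP (H' b)); rewrite mxE => ->.
by rewrite !mxE; apply: eq_bigr => l _; rewrite !mxE.
Qed.

Lemma labs_detG : labs (\det Gm) = labs c ^+ d * q ^ (- asum%:Z).
Proof.
rewrite detZ !det_mulmx !labsM labsX labs_det_poly // labs_det_O // mul1r mulr1.
rewrite labs_det_Dmx sumrN /nexp /asum; congr (_ * _ ^ (- _)).
by rewrite (big_morph Posz PoszD (erefl 0%:Z)).
Qed.

(** Undoing [c] and the isometry [B] leaves D^-1 times a polynomial matrix of full column rank. On
    rows f where it is nonsingular, the minor is a product of t^(-a_(f i)) times a nonzero
    polynomial, of absolute value at least 1. As a is nonincreasing, the first j rows give the worst
    case. *)
Lemma wedge_lower j (le_jd : (j <= d)%N) (V : 'M[F]_(d, j)) :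
  (forall b, lattice Gm (col b V)) -> \rank V = j ->
  labs c ^+ j * q ^ (- (\sum_(i < j) a (widen_ord le_jd i))%N%:Z) <= wedge_norm R V.
Proof.
move=> /lattice_cols[W eV] rV.
pose V' := Dm *m polyM (g *m W).
have eV' : V' = c^-1 *: (OM (invmx B) *m V).
  rewrite eV /Gm -scalemxAl -scalemxAr scalerA mulVf // scale1r.
  rewrite -!mulmxA [OM (invmx B) *m _]mulmxA OM_inv // mulVmx ?OM_unit //.
  by rewrite mul1mx /V' map_mxM.
have lcj : 0 < labs c ^+ j by rewrite exprn_gt0 ?labs_gt0.
rewrite mulrC -ler_pdivlMr //.
have : wedge_norm R V' <= wedge_norm R V / labs c ^+ j.
  rewrite eV'; apply: le_trans (wedge_scale _ _ _) _.
  by rewrite labsV exprVn mulrC ler_wpM2r ?invr_ge0 ?(ltW lcj) ?wedge_OM.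
apply: le_trans.
have rV' : row_full (polyM (g *m W)).
  have rk (A : 'M[F]_d) : A \in unitmx -> \rank (A *m polyM W) = \rank (polyM W).
    by move=> uA; rewrite (eqmxMfull _ (_ : row_full A)) ?row_full_unit.
  have uG : Gm \in unitmx.
    rewrite unitmxZ ?unitfE //.
    by rewrite (unitmx_mul (OM B *m Dm)) (unitmx_mul (OM B)) OM_unit ?Dmx_unit ?polyM_unit.
  by rewrite /row_full map_mxM rk ?polyM_unit // -(rk _ uG) -eV rV.
have := fullrowsub_unit rV'; set f := fullrankfun rV' => uf.
have injf : injective f by exact: fullrankfun_inj.
apply: le_trans (le_wedge _ V' f).
have -> : rowsub f V' = diag_mx (\row_i tF k ^ (- nexp n (f i))) *m rowsub f (polyM (g *m W)).
  apply/matrixP => i l; rewrite mul_diag_mx !mxE (bigD1 (f i)) //= big1 => [|x nx].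
    by rewrite !mxE eqxx mulr1n addr0.
  by rewrite !mxE eq_sym (negPf nx) mulr0n mul0r.
rewrite det_mulmx labsM det_diag labs_prod.
under eq_bigr => i _ do rewrite mxE labs_tFz.
rewrite q_prodz -[leLHS]mulr1 ler_pM ?exprz_ge0 ?(ltW (q_gt0 k R)) //.
  rewrite ler_eXz2l ?q_gt1 // sumrN lerN2.
  rewrite (big_morph Posz PoszD (erefl 0%:Z)).
  have [s incs] := inj_sort injf.
  rewrite (reindex_inj (@perm_inj _ s)) /=; apply: ler_sum => i _.
  by rewrite lez_nat; apply: aexp_anti; exact: (increasing_ord_ge incs).
have e : rowsub f (polyM (g *m W)) = polyM (rowsub f (g *m W)).
  by apply/matrixP => i l; rewrite !mxE.
move: uf; rewrite e unitmxE unitfE det_map_mx (polytoF_eq0 R) => nz.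
by rewrite labs_polytoF // exprn_ege1 // ltW ?q_gt1.
Qed.

(** The first j standard vectors, pulled back through [g], reach the lower bound. *)
Lemma wedge_attained j (le_jd : (j <= d)%N) : exists V : 'M[F]_(d, j),
  [/\ forall b, lattice Gm (col b V), \rank V = j &
   wedge_norm R V <= labs c ^+ j * q ^ (- (\sum_(i < j) a (widen_ord le_jd i))%N%:Z)].
Proof.
pose P : 'M[{poly k}]_(d, j) := \matrix_(i, b) (i == widen_ord le_jd b)%:R.
(* The same 0-1 matrix over the power series ring: its minors are integral, hence of absolute value
   at most 1. *)
pose P' : 'M[power_series k]_(d, j) := \matrix_(i, b) (i == widen_ord le_jd b)%:R.
pose V := Gm *m polyM (invmx g *m P).
have eV : V = c *: (OM B *m (Dm *m polyM P)).
  rewrite /V /Gm map_mxM polyM_inv // -scalemxAl !mulmxA -[_ *m _ *m invmx _]mulmxA.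
  by rewrite (mulmxV (polyM_unit ug)) mulmx1.
have PP' : polyM P = OM P'.
  by apply/matrixP => i l; rewrite !mxE !rmorph_nat.
exists V; split; first by apply/lattice_cols; eexists.
  rewrite eV mxrank_scale_nz // !mulmxA.
  rewrite -mxrank_tr trmx_mul mxrankMfree; last first.
    by rewrite /row_free mxrank_tr mxrank_unit // (unitmx_mul (OM B)) (OM_unit uB) Dmx_unit.
  apply/eqP; rewrite -/(row_free _); apply/row_freeP; exists (polyM P).
  apply/matrixP => i l; rewrite !mxE (bigD1 (widen_ord le_jd l)) //= big1 => [|x nx].
    rewrite !mxE eqxx rmorph1 mulr1 addr0 rmorph_nat; congr (_%:R).
    by rewrite eq_sym -(inj_eq val_inj) /=.
  by rewrite !mxE (negPf nx) rmorph0 mulr0.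
rewrite eV; apply: le_trans (wedge_scale _ _ _) _.
rewrite ler_wpM2l ?exprn_ge0 ?labs_ge0 //; apply: le_trans (wedge_OM _ _ _) _.
apply: wedge_leP => [|f]; first by rewrite exprz_ge0 // ltW ?q_gt0.
have -> : rowsub f (Dm *m polyM P) = rowsub f (OM P') *m
    diag_mx (\row_i tF k ^ (- nexp n (widen_ord le_jd i))).
  apply/matrixP => i l; rewrite mxE mul_mx_diag mul_Dmx PP' mulrC !mxE.
  by case: eqP => [->//|_]; rewrite rmorph0 !mul0r.
rewrite det_mulmx labsM det_diag labs_prod.
under eq_bigr => i _ do rewrite mxE labs_tFz.
rewrite q_prodz sumrN -(big_morph Posz PoszD (erefl 0%:Z)).
apply: ler_piMl; first by rewrite exprz_ge0 // ltW ?q_gt0.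
have -> : rowsub f (OM P') = OM (rowsub f P') by apply/matrixP => i l; rewrite !mxE.
by rewrite det_map_mx labs_OtoF_le1.
Qed.

(** With |c| = q^m, the covolume contributes q^(m j), which cancels |c|^j in the wedge norm. Rank j
    then contributes at most q^([pexp j] / d), and this is attained. *)
Lemma lattice_heightE : lattice_height R Gm = q `^ (hexp%:R / d%:R).
Proof.
have [m em] := labs_eq R nzc.
have dn0 : (d%:R : R) != 0 by rewrite pnatr_eq0.
have detE j : labs (\det Gm) `^ (j%:R / d%:R) =
    q `^ (m%:~R * j%:R - asum%:R * j%:R / d%:R).
  rewrite labs_detG em exprnP exprz_exp -expfzDr ?q_neq0 //.
  rewrite -powR_intmul ?ltW ?q_gt0 // -powRrM; congr (_ `^ _).
  by rewrite rmorphB rmorphM /=; field.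
have lowE j (le_jd : (j <= d)%N) :
    labs c ^+ j * q ^ (- (\sum_(i < j) a (widen_ord le_jd i))%N%:Z) =
    q `^ (m%:~R * j%:R - (\sum_(i < j) a (widen_ord le_jd i))%N%:R).
  rewrite em exprnP exprz_exp -expfzDr ?q_neq0 //.
  by rewrite -powR_intmul ?ltW ?q_gt0 // rmorphB rmorphM /=.
have valE j (le_jd : (j <= d)%N) : q `^ (m%:~R * j%:R - asum%:R * j%:R / d%:R) /
    q `^ (m%:~R * j%:R - (\sum_(i < j) a (widen_ord le_jd i))%N%:R) =
    q `^ ((pexp j)%:~R / d%:R).
  rewrite -powRN -powRD; last by rewrite q_neq0 implybT.
  congr (_ `^ _); rewrite (pexpE le_jd) rmorphB /= -!pmulrn !natrM; field.
  by rewrite nat1r.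
have ub : ubound (height_values (R := R) Gm) (q `^ (hexp%:R / d%:R)).
  move=> _ [j [V [/andP[j1 le_jd] lV rV ->]]].
  rewrite detE; apply: le_trans (_ : q `^ ((pexp j)%:~R / d%:R) <= _).
    rewrite -(valE j le_jd) ler_wpM2l ?powR_ge0 // lef_pV2 ?posrE ?powR_gt0 ?q_gt0 //.
      by rewrite -lowE wedge_lower.
    apply: lt_le_trans (wedge_lower le_jd lV rV); rewrite lowE powR_gt0 ?q_gt0 //.
  apply: ler_powR; first by rewrite ltW ?q_gt1.
  rewrite ler_pM2r ?invr_gt0 ?ltr0n //.
  by rewrite -[hexp%:R]/(hexp%:Z%:~R) ler_int pexp_le.
have [j [/andP[j1 le_jd] ej]] := pexp_max.
have [V [lV rV wV]] := wedge_attained le_jd.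
have mem : height_values (R := R) Gm (q `^ (hexp%:R / d%:R)).
  exists j, V; split=> //; first by rewrite j1.
  have -> : wedge_norm R V = labs c ^+ j * q ^ (- (\sum_(i < j) a (widen_ord le_jd i))%N%:Z).
    by apply/eqP; rewrite eq_le wV wedge_lower.
  by rewrite detE lowE valE ej.
apply/eqP; rewrite eq_le; apply/andP; split.
  by apply: ge_sup => //; exists (q `^ (hexp%:R / d%:R)).
by apply: ub_le_sup => //; exists (q `^ (hexp%:R / d%:R)).
Qed.

End Height.

Local Notation OM := (map_mx (@OtoF _)).
Local Notation polyM := (map_mx (@polytoF _)).

Lemma alpha_cls (k : finFieldType) (R : realType) (d' : nat)
    (n : {ffun 'I_d'.+1 -> nat}) :
  alpha R (cls k n) = (#|k|%:R : R) `^ ((hexp n)%:R / d'.+1%:R).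
Proof.
rewrite /alpha; set r : G k d'.+1 := repr (cls k n).
have : (\pi_(Y k d'.+1) r)%qT = cls k n by rewrite reprK.
move=> /eqmodP/asboolP[_ [_ [/GammaP[g [ug ->]] /KP[B [uB ->]]]]].
rewrite -{1}[r]toPGLK toPGLMg3 => /eqP/toPGL_eq[c nzc /= e].
set A := val (repr r) in e *; have uA : A \in unitmx := valP (repr r).
transitivity (lattice_height R
    (c *: (OM B *m Dmx k (fun i => - nexp n i) *m polyM g))); last first.
  exact: (@lattice_heightE k R d' n c B g nzc uB ug).
congr lattice_height.
have uD := Dmx_unit k (nexp n).
have eN : Dmx k (fun i => - nexp n i) *m Dmx k (nexp n) = 1%:M.
  apply/matrixP => i j; rewrite mul_Dmx !mxE mulrnAr.
  by case: eqP => [->|_]; rewrite ?mulr0n // -expfzDr ?tF_neq0 // addNr expr0z.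
apply: (can_inj (mulmxK uA)); rewrite (mulVmx uA).
rewrite -[(_ *: _) *m A]scalemxAl.
apply: (can_inj (mulmxK (OM_unit uB))); rewrite mul1mx -scalemxAl -!mulmxA.
rewrite [polyM g *m _]mulmxA scalemxAr scalemxAr -e.
by rewrite [Dmx _ _ *m _]eN mulmx1.
Qed.

(** * Linear recurrent sequences *)

Section RationalSequences.
Variable K : fieldType.
Implicit Types a b : nat -> K.

(* Sequences spanning, together with their shifts, a finite-dimensional space. *)
Definition ratseq a := exists (I : finType) (M : I -> I -> K) (f : I -> nat -> K) (l : I -> K),
  (forall i N, f i N.+1 = \sum_j M i j * f j N) /\ forall N, a N = \sum_i l i * f i N.

Lemma ratseq_ext a b : a =1 b -> ratseq a -> ratseq b.
Proof. by move=> ab [I [M [f [l [H1 H2]]]]]; exists I, M, f, l; split=> // N; rewrite -ab. Qed.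

Definition conv a b N := \sum_(i < N.+1) a i * b (N - i)%N.

Lemma ratseqZ c a : ratseq a -> ratseq (fun N => c * a N).
Proof.
move=> [I [M [f [l [H1 H2]]]]]; exists I, M, f, (fun i => c * l i); split=> // N.
by rewrite H2 mulr_sumr; apply: eq_bigr => i _; rewrite mulrA.
Qed.

Lemma ratseqD a b : ratseq a -> ratseq b -> ratseq (fun N => a N + b N).
Proof.
move=> [I [M [f [l [H1 H2]]]]] [J [M' [g [l' [H1' H2']]]]].
pose MM (x y : I + J) := match x, y with
  | inl i, inl i' => M i i' | inr j, inr j' => M' j j' | _, _ => 0 end.
pose h (x : I + J) := match x with inl i => f i | inr j => g j end.
pose ll (x : I + J) := match x with inl i => l i | inr j => l' j end.
exists (I + J)%type, MM, h, ll; split=> [[i|j] N|N].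
- by rewrite big_sumType /= [X in _ + X]big1 ?addr0 ?H1 // => j _; rewrite mul0r.
- by rewrite big_sumType /= big1 ?add0r ?H1' // => i _; rewrite mul0r.
by rewrite big_sumType /= H2 H2'.
Qed.

Lemma ratseq0 : ratseq (fun=> 0).
Proof.
exists void, (fun _ _ => 0), (fun _ _ => 0), (fun=> 0).
by split=> [[]|N]; rewrite big1 // => -[].
Qed.

Lemma ratseq_sum (T : Type) (r : seq T) (P : pred T) (a : T -> nat -> K) :
  (forall i, P i -> ratseq (a i)) -> ratseq (fun N => \sum_(i <- r | P i) a i N).
Proof.
move=> H; elim: r => [|i r IH].
  by apply: ratseq_ext ratseq0 => N; rewrite big_nil.
case Pi : (P i); last by apply: ratseq_ext IH => N; rewrite big_cons Pi.
by apply: ratseq_ext (ratseqD (H i Pi) IH) => N; rewrite big_cons Pi.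
Qed.

(** The state space is the tensor product of the two state spaces. *)
Lemma ratseqM a b : ratseq a -> ratseq b -> ratseq (fun N => a N * b N).
Proof.
move=> [I [M [f [l [H1 H2]]]]] [J [M' [g [l' [H1' H2']]]]].
exists (I * J)%type, (fun x y => M x.1 y.1 * M' x.2 y.2),
  (fun x N => f x.1 N * g x.2 N), (fun x => l x.1 * l' x.2); split=> [[i j] N|N] /=.
  rewrite H1 H1' big_distrlr /= pair_bigA /=.
  by apply: eq_bigr => x _; rewrite mulrACA.
rewrite H2 H2' big_distrlr /= pair_bigA /=.
by apply: eq_bigr => x _; rewrite mulrACA.
Qed.

Lemma ratseq_geom x : ratseq (fun N => x ^+ N).
Proof.
exists unit, (fun _ _ => x), (fun _ N => x ^+ N), (fun=> 1).
by split=> [[] N|N]; rewrite (bigD1 tt) //= big1 ?addr0 ?exprS ?mul1r // => -[].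
Qed.

Lemma ratseq_delay c a : ratseq a -> ratseq (fun N => if N is N'.+1 then a N' else c).
Proof.
move=> [I [M [f [l [H1 H2]]]]].
pose MM (x y : unit + I) := match x, y with
  | inl _, inr i => l i | inr i, inr i' => M i i' | _, _ => 0 end.
pose h (x : unit + I) N := match x with inl _ => (if N is N'.+1 then a N' else c) | inr j => f j N end.
exists (unit + I)%type, MM, h, (fun x => (x == inl tt)%:R); split=> [[[]|i] N|N].
- by rewrite big_sumType /= big1 ?add0r ?H2 // => i _; rewrite mul0r.
- by rewrite big_sumType /= big1 ?add0r ?H1 // => j _; rewrite mul0r.
rewrite big_sumType /= (bigD1 tt) //= big1 => [|[] //].
by rewrite big1 ?addr0 ?mul1r // => i _; rewrite mul0r.
Qed.

Lemma ratseq_shift s a : ratseq a ->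
  ratseq (fun N => if (s <= N)%N then a (N - s)%N else 0).
Proof.
elim: s => [|s IH] ra; first by apply: ratseq_ext ra => N; rewrite subn0.
by apply: ratseq_ext (ratseq_delay 0 (IH ra)) => -[|N].
Qed.

(** State (i, r) is live when e divides N + r. Advancing N turns r into r + 1, and the wrap-around
    at the last value of r performs one step of [M]. *)
Lemma ratseq_stretch e a : (0 < e)%N -> ratseq a ->
  ratseq (fun N => if (e %| N)%N then a (N %/ e)%N else 0).
Proof.
case: e => // e _ [I [M [f [l [H1 H2]]]]].
pose h (x : I * 'I_e.+1) N := if (e.+1 %| N + x.2)%N then f x.1 ((N + x.2) %/ e.+1)%N else 0.
pose MM (x y : I * 'I_e.+1) := if (x.2 < e)%N then ((y.1 == x.1) && (y.2 == x.2.+1 :> nat))%:R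
  else M x.1 y.1 * (y.2 == ord0)%:R.
exists (I * 'I_e.+1)%type, MM, h, (fun x => l x.1 * (x.2 == ord0)%:R); split=> [[i r] N|N].
  rewrite /h /MM /=; case: ltnP => [lt_re|le_er].
    have lt_r1 : (r.+1 < e.+1)%N by [].
    rewrite (bigD1 (i, Ordinal lt_r1)) //= !eqxx mul1r big1 ?addr0 ?addSnnS // => -[i' r'] /=.
    move=> ne; case: eqP => [ei|]; rewrite ?mul0r //=; case: eqP => [er|]; rewrite ?mul0r //.
    by case/eqP: ne; congr pair => //; apply: val_inj.
  have -> : (r : nat) = e by apply/eqP; rewrite eqn_leq le_er -ltnS ltn_ord.
  rewrite addSn -addnS dvdn_addl // divnDr // divnn /= addn1.
  rewrite -(pair_bigA _ (fun i' (r' : 'I_e.+1) => M i i' * (r' == ord0)%:R *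
    (if (e.+1 %| N + r')%N then f i' ((N + r') %/ e.+1)%N else 0))) /=.
  under eq_bigr => i' _.
    rewrite (bigD1 ord0) //= big1 ?addr0; last by move=> r' /negPf ->; rewrite mulr0 mul0r.
    rewrite mulr1 addn0; over.
  case: ifP => _; last by rewrite big1 // => i' _; rewrite mulr0.
  by rewrite H1.
rewrite -(pair_bigA _ (fun i' (r' : 'I_e.+1) => l i' * (r' == ord0)%:R * h (i', r') N)) /=.
under eq_bigr => i' _.
  rewrite (bigD1 ord0) //= big1 ?addr0; last by move=> r' /negPf ->; rewrite mulr0 mul0r.
  rewrite mulr1 /h /= addn0; over.
by rewrite H2; case: ifP => // _; rewrite big1 // => i _; rewrite mulr0.
Qed.

Lemma ratseq_periodic p r : (r < p)%N -> ratseq (fun N => (N %% p == r)%N%:R).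
Proof.
move=> lt_rp; have p0 : (0 < p)%N by apply: leq_ltn_trans lt_rp.
apply: ratseq_ext (ratseq_shift r (ratseq_stretch p0 (ratseq_geom 1))) => N.
have [le_rN|lt_Nr] := leqP r N.
  rewrite expr1n -(eqn_mod_dvd _ le_rN) eq_sym [(r %% p)%N]modn_small // eq_sym.
  by case: eqP.
by rewrite modn_small ?(ltn_trans lt_Nr) // ltn_eqF.
Qed.

Lemma convS a b N : conv a b N.+1 = a 0%N * b N.+1 + conv (fun n => a n.+1) b N.
Proof. by rewrite /conv big_ord_recl subn0; congr (_ + _); apply: eq_bigr. Qed.

Lemma conv_suml (I : finType) (c : I -> K) (f : I -> nat -> K) b N :
  conv (fun n => \sum_i c i * f i n) b N = \sum_i c i * conv (f i) b N.
Proof.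
rewrite /conv; under eq_bigr => x _ do rewrite mulr_suml.
rewrite exchange_big /=; apply: eq_bigr => i _; rewrite mulr_sumr.
by apply: eq_bigr => x _; rewrite mulrA.
Qed.

(** The convolutions of the states of [a] with [b], joined to the states of [b], are closed under
    the shift: by [convS] the only extra term is a multiple of the next value of [b]. *)
Lemma ratseq_conv a b : ratseq a -> ratseq b -> ratseq (conv a b).
Proof.
move=> [I [M [f [l [H1 H2]]]]] [J [M' [g [l' [H1' H2']]]]].
pose MM (x y : I + J) := match x, y with
  | inl i, inl i' => M i i' | inr j, inr j' => M' j j'
  | inl i, inr j => f i 0%N * \sum_j' l' j' * M' j' j | _, _ => 0 end.
pose h (x : I + J) := match x with inl i => conv (f i) b | inr j => g j end.
pose ll (x : I + J) := match x with inl i => l i | inr j => 0 end.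
exists (I + J)%type, MM, h, ll; split=> [[i|j] N|N].
- rewrite big_sumType /= convS [RHS]addrC; congr (_ + _).
    rewrite H2' mulr_sumr; under [RHS]eq_bigr => j _ do rewrite -mulrA mulr_suml mulr_sumr.
    rewrite exchange_big /=; apply: eq_bigr => j' _; rewrite H1' !mulr_sumr.
    by apply: eq_bigr => j _; rewrite !mulrA.
  by rewrite -conv_suml /conv; apply: eq_bigr => x _; rewrite H1.
- by rewrite big_sumType /= big1 ?add0r ?H1' // => i _; rewrite mul0r.
rewrite big_sumType /= [X in _ + X]big1 ?addr0 => [|j _]; last by rewrite mul0r.
by rewrite -conv_suml /conv; apply: eq_bigr => x _; rewrite H2.
Qed.

Lemma horner_mx_orbit n (A : 'M[K]_n.+1) (F : nat -> 'cV[K]_n.+1) (p : {poly K}) N :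
  (forall N, F N.+1 = A *m F N) ->
  horner_mx A p *m F N = \sum_(i < size p) p`_i *: F (N + i)%N.
Proof.
move=> HF; have FE i : F (N + i)%N = A ^+ i *m F N.
  elim: i => [|i IH]; first by rewrite addn0 expr0 mul1mx.
  by rewrite addnS HF IH mulmxA exprS.
rewrite -[p in LHS]coefK poly_def rmorph_sum /= mulmx_suml.
apply: eq_bigr => i _; rewrite linearZ /= rmorphXn /= horner_mx_X FE.
by rewrite -scalemxAl.
Qed.

(** Cayley-Hamilton gives the recurrence. [Q] is the reversed characteristic polynomial, nonzero
    since its constant term is the leading coefficient 1; [P] collects the initial terms, where the
    recurrence does not yet apply. *)
Lemma ratseq_recurrence a : ratseq a -> exists P Q : {poly K},
  Q != 0 /\ forall N, conv (fun i => Q`_i) a N = P`_N.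
Proof.
move=> [I [M [f [l [H1 H2]]]]].
have [I0|[m cI]] : #|I| = 0%N \/ exists m, #|I| = m.+1.
  by case: #|I|; [left | right; eexists].
  exists 0, 1; split; rewrite ?oner_neq0 // => N; rewrite coef0 /conv big1 // => i _.
  by rewrite H2 big1 ?mulr0 // => x _; have := fintype0 x I0.
pose ev (i : 'I_m.+1) : I := enum_val (cast_ord (esym cI) i).
have ev_bij : bijective ev.
  exists (fun x => cast_ord cI (enum_rank x)) => x; rewrite /ev.
    by rewrite enum_valK cast_ordKV.
  by rewrite cast_ordK enum_rankK.
pose A : 'M[K]_m.+1 := \matrix_(i, j) M (ev i) (ev j).
pose F N : 'cV[K]_m.+1 := \col_i f (ev i) N.
have HF N : F N.+1 = A *m F N.
  apply/matrixP => i j; rewrite !mxE H1 (reindex ev (onW_bij _ ev_bij)) /=.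
  by apply: eq_bigr => x _; rewrite !mxE.
pose L : 'rV[K]_m.+1 := \row_i l (ev i).
have aE N : a N = (L *m F N) 0 0.
  rewrite H2 (reindex ev (onW_bij _ ev_bij)) /= mxE.
  by apply: eq_bigr => x _; rewrite !mxE.
pose chi := char_poly A.
have rec N : \sum_(i < m.+2) chi`_i * a (N + i)%N = 0.
  have := horner_mx_orbit chi N HF; rewrite Cayley_Hamilton mul0mx size_char_poly.
  move=> /(congr1 (fun v => (L *m v) 0 0)); rewrite mulmx0 mxE mulmx_sumr summxE => e.
  apply: etrans (esym e).
  by apply: eq_bigr => i _; rewrite aE -scalemxAr [RHS]mxE.
pose Q := \poly_(i < m.+2) chi`_(m.+1 - i).
exists (\poly_(N < m.+1) conv (fun i => Q`_i) a N), Q; split.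
  apply/eqP => /(congr1 (fun p : {poly K} => p`_0)); rewrite coef_poly coef0 /= subn0.
  have /monicP := char_poly_monic A; rewrite lead_coefE size_char_poly /= => ->.
  by apply/eqP; exact: oner_neq0.
move=> N; rewrite coef_poly; case: ltnP => // le_mN.
rewrite /conv -[RHS](rec (N - m.+1)%N).
rewrite (bigID (fun i : 'I_N.+1 => (i < m.+2)%N)) /= [X in _ + X]big1 ?addr0; last first.
  by move=> i /negPf Hi; rewrite coef_poly Hi mul0r.
rewrite -(big_ord_widen _ (fun i => Q`_i * a (N - i)%N) (_ : m.+2 <= N.+1)%N) //.
rewrite (reindex_inj rev_ord_inj) /=; apply: eq_bigr => i _.
have lt_i := ltn_ord i; rewrite coef_poly ifT; last by lia.
by congr (chi`_ _ * a _); lia.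
Qed.

End RationalSequences.

(** * Generating polynomials of weighted lattice points *)

Section LatticePointSeries.
Variable K : fieldType.
Implicit Types a b : nat -> K.

Lemma ratseq_delta : ratseq (fun N => (N == 0%N)%:R : K).
Proof. by apply: ratseq_ext (ratseq_delay 1 (ratseq0 K)) => -[]. Qed.

Variables (T : finType) (f : T -> nat -> K).
Implicit Types (w : T -> nat).

(* Coefficients of \prod_i \sum_t f_i(t) X^(w i t) Y^(w' i t). *)
Lemma coef_prod2 (N : nat) w w' A B :
  \sum_(z : {ffun T -> 'I_N} | ((\sum_i w i * z i)%N == A) && ((\sum_i w' i * z i)%N == B))
     \prod_i f i (z i) =
  ((\prod_i \sum_(t < N) ((f i t)%:P * 'X^(w i * t))%:P * 'X^(w' i * t))`_B : {poly K})`_A.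
Proof.
rewrite bigA_distr_bigA coef_sum coef_sum [LHS]big_mkcond /=; apply: eq_bigr => z _.
rewrite big_split /= -rmorph_prod big_split /= -rmorph_prod !prodrXr.
move: (\sum_i w' i * z i)%N (\sum_i w i * z i)%N => SB SA.
rewrite coefCM coefXn [B == _]eq_sym; case: (SB == B); last by rewrite andbF mulr0 coef0.
rewrite mulr1 andbT coefCM coefXn [A == _]eq_sym.
by case: (SA == A); rewrite ?mulr1 ?mulr0.
Qed.

Definition wpoly (N : nat) w i : {poly K} := \sum_(t < N) (f i t)%:P * 'X^(w i * t).

(** Each index contributes to only one of the two variables, so the bivariate product separates. *)
Lemma coef_prod2_split (N : nat) (b : pred T) w A B :
  \sum_(z : {ffun T -> 'I_N} | ((\sum_(i | b i) w i * z i)%N == A) &&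
      ((\sum_(i | ~~ b i) w i * z i)%N == B)) \prod_i f i (z i) =
  (\prod_(i | b i) wpoly N w i)`_A * (\prod_(i | ~~ b i) wpoly N w i)`_B.
Proof.
transitivity (((\prod_(i | b i) wpoly N w i)%:P *
   map_poly polyC (\prod_(i | ~~ b i) wpoly N w i))`_B`_A); last first.
  by rewrite coefCM coef_map /= coefMC.
transitivity (((\prod_i \sum_(t < N) ((f i t)%:P * 'X^((if b i then w i else 0) * t))%:P *
    'X^((if b i then 0 else w i) * t))`_B : {poly K})`_A).
  rewrite -coef_prod2; apply: eq_bigl => z; congr (_ && _); congr (_ == _).
    by rewrite big_mkcond; apply: eq_bigr => i _; case: (b i).
  by rewrite big_mkcond; apply: eq_bigr => i _; case: (b i).
suff -> : \prod_i \sum_(t < N) ((f i t)%:P * 'X^((if b i then w i else 0) * t))%:P *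
    'X^((if b i then 0 else w i) * t) =
    (\prod_(i | b i) wpoly N w i)%:P * map_poly polyC (\prod_(i | ~~ b i) wpoly N w i) by [].
rewrite (bigID b) /=; congr (_ * _).
  rewrite rmorph_prod; apply: eq_bigr => i bi; rewrite rmorph_sum /=.
  by apply: eq_bigr => t _; rewrite bi mul0n expr0 mulr1.
rewrite rmorph_prod; apply: eq_bigr => i /negPf bi; rewrite rmorph_sum /=.
by apply: eq_bigr => t _; rewrite bi mul0n expr0 mulr1 rmorphM /= map_polyC map_polyXn.
Qed.

Lemma coef_wpoly (N : nat) w i x : (0 < w i)%N -> (x < N)%N ->
  (wpoly N w i)`_x = if (w i %| x)%N then f i (x %/ w i)%N else 0.
Proof.
move=> w0 lt_xN; rewrite coef_sum.
have [/dvdnP[t et]|ndvd] := boolP (w i %| x)%N; last first.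
  rewrite big1 // => t _; rewrite coefCM coefXn; case: eqP => [ex|]; rewrite ?mulr0 //.
  by rewrite ex dvdn_mulr in ndvd.
have lt_tN : (t < N)%N by apply: leq_ltn_trans lt_xN; rewrite et leq_pmulr.
rewrite et mulnK // (bigD1 (Ordinal lt_tN)) //= big1 ?addr0 => [|s nst].
  by rewrite coefCM coefXn mulnC eqxx mulr1.
rewrite coefCM coefXn mulnC eqn_pmul2l //; case: eqP => [e|]; rewrite ?mulr0 //.
by case/eqP: nst; apply: val_inj.
Qed.

(** Cutting the series at N does not affect coefficients below N, so one sequence serves for all
    N. *)
Lemma ratseq_prod_wpoly (P : pred T) w : (forall i, P i -> (0 < w i)%N) ->
  (forall i, ratseq (f i)) ->
  exists2 a, ratseq a & forall N x, (x < N)%N -> (\prod_(i | P i) wpoly N w i)`_x = a x.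
Proof.
move=> w0 rf; elim: (index_enum T) => [|i r [a ra aE]].
  by exists (fun N => (N == 0%N)%:R); [exact: ratseq_delta | move=> N x _; rewrite big_nil coef1].
have [Pi|nPi] := boolP (P i); last first.
  by exists a => // N x lt; rewrite big_cons (negPf nPi) aE.
exists (conv (fun x => if (w i %| x)%N then f i (x %/ w i)%N else 0) a).
  by apply: ratseq_conv => //; apply: ratseq_stretch => //; exact: w0.
move=> N x lt; rewrite big_cons Pi coefM /conv; apply: eq_bigr => y _.
rewrite coef_wpoly ?w0 ?aE //; first by apply: leq_ltn_trans (leq_subr _ _) lt.
by apply: leq_trans (ltn_ord y) lt.
Qed.

End LatticePointSeries.

(** * Level sums of a piecewise linear exponent *)

Section PiecewiseExponent.
Variable K : fieldType.
Variables (al be : nat -> K).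
Hypotheses (ral : ratseq al) (rbe : ratseq be).
Variables (e j : nat).
Hypotheses (e0 : (0 < e)%N) (j0 : (0 < j)%N).
Local Notation d := (j + e)%N.

(** The value of E at the threshold in terms of the low sum A and the high sum B, with e = d - j.
    Rounding in the threshold produces the corrections, periodic in the difference of A and B. *)
Definition pwexp (A B : nat) : nat :=
  if (B <= A)%N then (d * A + j * (e - (A - B) %% e))%N
  else (d * B + e * (j - ((B - A).-1 %% j).+1))%N.

Lemma sum_delta_stretch (g : nat -> K) s m : 
  \sum_(A < m.+1) ((d * A + s)%N == m)%:R * g A =
  if (s <= m)%N then (if (d %| m - s)%N then g ((m - s) %/ d)%N else 0) else 0.
Proof.
have d0 : (0 < d)%N by rewrite addn_gt0 j0.
have [le_sm|lt_ms] := leqP s m; last first.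
  rewrite big1 // => A _; case: eqP => [eA|_]; last by rewrite mul0r.
  by rewrite -eA ltnNge leq_addl in lt_ms.
have [/dvdnP[t et]|ndvd] := boolP (d %| m - s)%N; last first.
  rewrite big1 // => A _; case: eqP => [eA|_]; last by rewrite mul0r.
  by rewrite -eA addnK dvdn_mulr in ndvd.
have em : m = (d * t + s)%N by rewrite mulnC -et subnK.
have lt_tm : (t < m.+1)%N.
  by rewrite ltnS em; apply: leq_trans (leq_addr _ _); rewrite leq_pmull.
rewrite et mulnK // (bigD1 (Ordinal lt_tm)) //= -em eqxx mul1r big1 ?addr0 // => A nA.
case: eqP => [eA|_]; last by rewrite mul0r.
case/eqP: nA; apply: val_inj => /=; apply/eqP; rewrite -(eqn_pmul2l d0).
by rewrite -(eqn_add2r s) eA em.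
Qed.

Lemma ratseq_delta_stretch (g : nat -> K) s : ratseq g ->
  ratseq (fun m => \sum_(A < m.+1) ((d * A + s)%N == m)%:R * g A).
Proof.
move=> rg; apply: ratseq_ext (ratseq_shift s (ratseq_stretch (e := d) _ rg)).
  by move=> m; rewrite sum_delta_stretch.
by rewrite addn_gt0 j0.
Qed.

(** On each piece, with the remainder r fixed, the exponent depends on A alone or on B alone. The
    other variable is summed by convolution with a periodic indicator; what remains is a termwise
    product, stretched by d and shifted. *)
Lemma ratseq_pwexp : ratseq (fun m => \sum_(A < m.+1) \sum_(B < m.+1)
  (pwexp A B == m)%:R * (al A * be B)).
Proof.
pose per p r N : K := (N %% p == r)%N%:R.
(* The delay accounts for the strict inequality A < B and the predecessor of B - A in [pwexp]. *)
pose per' p r N : K := if N is N'.+1 then per p r N' else 0.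
pose g1 (r : 'I_e) A := al A * conv be (per e r) A.
pose g2 (r : 'I_j) B := be B * conv al (per' j r) B.
apply: ratseq_ext (_ : ratseq (fun m =>
  \sum_(r < e) (\sum_(A < m.+1) ((d * A + j * (e - r))%N == m)%:R * g1 r A) +
  \sum_(r < j) (\sum_(B < m.+1) ((d * B + e * (j - r.+1))%N == m)%:R * g2 r B))); last first.
  apply: ratseqD; apply: ratseq_sum => r _; apply: ratseq_delta_stretch; apply: ratseqM => //.
    by apply: ratseq_conv => //; apply: ratseq_periodic.
  by apply: ratseq_conv => //; apply: ratseq_delay; apply: ratseq_periodic.
move=> m.
transitivity (\sum_(A < m.+1) \sum_(B < m.+1 | (B <= A)%N) (pwexp A B == m)%:R * (al A * be B) +
  \sum_(B < m.+1) \sum_(A < m.+1 | (A < B)%N) (pwexp A B == m)%:R * (al A * be B)); last first.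
  rewrite [X in _ + X](exchange_big_dep xpredT) //= -big_split /=.
  apply: eq_bigr => A _; rewrite [RHS](bigID (fun B : 'I_m.+1 => (B <= A)%N)) /=.
  by congr (_ + _); apply: eq_bigl => B; rewrite ltnNge.
congr (_ + _).
  rewrite exchange_big /=; apply: eq_bigr => A _.
  transitivity (\sum_(B < A.+1) (pwexp A B == m)%:R * (al A * be B)); last first.
    exact: (big_ord_widen _ (fun B => (pwexp A B == m)%:R * (al A * be B)) (ltn_ord A)).
  rewrite /g1 /conv; under eq_bigr => r _ do rewrite mulrA mulr_sumr.
  rewrite exchange_big /=; apply: eq_bigr => B _.
  rewrite (bigD1 (Ordinal (ltn_pmod (A - B) e0))) //= big1 => [|r nr]; last first.
    rewrite /per; case: ((A - B) %% e =P r)%N => [er|_]; last by rewrite !mulr0.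
    by case/eqP: nr; apply: val_inj.
  by rewrite addr0 /per eqxx mulr1 /pwexp -ltnS ltn_ord mulrA.
rewrite exchange_big /=; apply: eq_bigr => B _.
transitivity (\sum_(A < B) (pwexp A B == m)%:R * (al A * be B)); last first.
  exact: (big_ord_widen _ (fun A => (pwexp A B == m)%:R * (al A * be B)) (ltnW (ltn_ord B))).
rewrite /g2 /conv; under eq_bigr => r _.
  rewrite big_ord_recr /= subnn mulr0 addr0 mulrA mulr_sumr; over.
rewrite exchange_big /=; apply: eq_bigr => A _.
have eBA : (B - A = (B - A).-1.+1)%N by rewrite prednK // subn_gt0 ltn_ord.
rewrite (bigD1 (Ordinal (ltn_pmod (B - A).-1 j0))) //= big1 => [|r nr]; last first.
  rewrite /per' eBA /per; case: ((B - A).-1 %% j =P r)%N => [er|_]; last by rewrite !mulr0.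
  by case/eqP: nr; apply: val_inj.
rewrite addr0 /per' {2}eBA /per eqxx mulr1 /pwexp leqNgt ltn_ord /=.
by rewrite -mulrA [be B * _]mulrC.
Qed.

End PiecewiseExponent.

(** * Lattice points of given height *)

Section WeightSums.
Variable d' : nat.
Local Notation d := d'.+1.
Implicit Types (n : {ffun 'I_d -> nat}).

Lemma aexpE n i : aexp n i = (\sum_(x < d) (i < x)%N * n x)%N.
Proof. by rewrite /aexp big_mkcond; apply: eq_bigr => x _; case: ltnP; rewrite ?mul1n. Qed.

Lemma count_lt (m : nat) (p : nat) : (m <= p)%N -> (\sum_(i < p) (i < m)%N = m)%N.
Proof.
by move=> le_mp; rewrite -big_mkcond /= -(big_ord_widen _ (fun=> 1%N) le_mp) sum1_card card_ord.
Qed.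

Lemma asumE n : asum n = (\sum_(x < d) x * n x)%N.
Proof.
rewrite /asum; under eq_bigr => i _ do rewrite aexpE.
rewrite exchange_big /=; apply: eq_bigr => x _; rewrite -big_distrl /=.
by rewrite count_lt // ltnW.
Qed.

(** n_x enters a_i - a_l exactly for i < x <= l, which makes x (d - x) pairs. *)
Lemma rhoE n : rho n = (\sum_(x < d) x * (d - x) * n x)%N.
Proof.
rewrite /rho; transitivity (\sum_(i < d) \sum_(l < d) \sum_(x < d) (i < x)%N * (x <= l)%N * n x)%N.
  apply: eq_bigr => i _; apply: eq_bigr => l _.
  have [le_il|lt_li] := leqP i l.
    apply: (@addIn (aexp n l)); rewrite subnK ?aexp_anti // !aexpE -big_split /=.
    apply: eq_bigr => x _; have [le_xl|lt_lx] := leqP x l.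
      by rewrite muln1 mul0n addn0.
    by rewrite (leq_ltn_trans le_il lt_lx) muln0 mul0n add0n.
  rewrite (eqP (_ : aexp n i - aexp n l == 0)%N) ?subn_eq0 ?aexp_anti ?(ltnW lt_li) //.
  rewrite big1 // => x _; have [le_xl|] := leqP x l; last by rewrite muln0.
  by rewrite (leq_gtF (leq_trans le_xl (ltnW lt_li))).
under eq_bigr => i _ do rewrite exchange_big /=.
rewrite exchange_big /=; apply: eq_bigr => x _.
under eq_bigr => i _ do rewrite -big_distrl -big_distrr /=.
rewrite -!big_distrl /= count_lt ?(ltnW (ltn_ord x)) //; congr (_ * _ * _)%N.
rewrite -[in RHS](count_lt (ltnW (ltn_ord x))).
apply: (@addIn (\sum_(i < d) (i < x)%N)%N); rewrite subnK; last first.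
  by rewrite count_lt ltnW.
rewrite -big_split /= (eq_bigr (fun=> 1%N)); first by rewrite sum1_card card_ord.
by move=> i _; case: ltnP.
Qed.

Definition lowsum (j : nat) n : nat := (\sum_(i < d | (i < j)%N) i * n i)%N.
Definition highsum (j : nat) n : nat := (\sum_(i < d | (j < i)%N) (d - i) * n i)%N.

Lemma big_ord_split3 (j : 'I_d) (G : 'I_d -> nat) :
  (\sum_i G i = \sum_(i < d | (i < j)%N) G i + (G j + \sum_(i < d | (j < i)%N) G i))%N.
Proof.
rewrite (bigID (fun i : 'I_d => (i < j)%N)) /=; congr (_ + _)%N.
rewrite (bigD1 j) /= ?ltnn //; congr (_ + _)%N; apply: eq_bigl => i.
by rewrite -leqNgt ltn_neqAle eq_sym andbC.
Qed.

Lemma aexp_pred_lt (j i : 'I_d) n : j = i.+1 :> nat ->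
  (asum n < d * aexp n i)%N = (lowsum j n < (d - j) * n j + highsum j n)%N.
Proof.
move=> ej; rewrite asumE aexpE big_distrr /= !(big_ord_split3 j).
rewrite [X in (_ < X + _)%N]big1 ?add0n => [|x lt_xj]; last first.
  by rewrite ltnNge -ltnS -ej lt_xj mul0n muln0.
rewrite -/(lowsum j n) ej ltnSn mul1n.
rewrite [X in (_ < _ + X)%N](eq_bigr (fun x : 'I_d => ((x : nat) * n x + (d - x) * n x)%N))
    => [|x lt_jx]; last first.
  rewrite (ltn_trans (ltnSn _) lt_jx) mul1n -mulnDl subnKC //; exact: ltnW.
rewrite big_split /= -/(highsum _ n).
have e : (d * n j = i.+1 * n j + (d - i.+1) * n j)%N.
  by rewrite -mulnDl subnKC // -ej ltnW.
by rewrite e; lia.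
Qed.

Lemma aexp_le (j : 'I_d) n :
  (d * aexp n j <= asum n)%N = (highsum j n <= j * n j + lowsum j n)%N.
Proof.
rewrite asumE aexpE big_distrr /= !(big_ord_split3 j).
rewrite [X in (X + _ <= _)%N]big1 ?add0n => [|x lt_xj]; last first.
  by rewrite ltnNge (ltnW lt_xj) mul0n muln0.
rewrite ltnn mul0n muln0 add0n -/(lowsum j n).
rewrite (eq_bigr (fun x : 'I_d => ((x : nat) * n x + (d - x) * n x)%N)) => [|x lt_jx]; last first.
  by rewrite lt_jx mul1n -mulnDl subnKC //; exact: ltnW.
by rewrite big_split /= -/(highsum _ n); lia.
Qed.

(** Row j - 1 must exceed the mean and row j must not. Cleared of denominators, the two deviations
    are (d - j) n_j + high - low and high - low - j n_j. *)
Lemma jumpE (j : 'I_d) n : (0 < j)%N ->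
  (jump n == j :> nat) = (lowsum j n < (d - j) * n j + highsum j n)%N &&
                         (highsum j n <= j * n j + lowsum j n)%N.
Proof.
move=> j0; have lt_i : (j.-1 < d)%N by apply: leq_ltn_trans (leq_pred _) _.
rewrite -(@aexp_pred_lt j (Ordinal lt_i)) ?prednK // -aexp_le -jumpP.
by rewrite [(d * aexp n j <= _)%N]leqNgt -(jumpP n j) -leqNgt /= prednK // eqn_leq andbC.
Qed.

(** If no row exceeds the mean, then d a_0 is at most the sum of the rows. That sum is at most (d -
    1) a_0, because the last row is 0; so a_0 and all other rows vanish. *)
Lemma jump0 n : nvec n -> (jump n == 0%N) = (n == [ffun=> 0%N]).
Proof.
move=> n0; apply/eqP/eqP => [J0|->]; last first.
  apply/eqP; rewrite -leqn0 leqNgt.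
  apply/negP => lt0; have := jumpP [ffun=> 0%N] (ord0 : 'I_d); rewrite lt0.
  by rewrite aexpE big1 ?muln0 // => x _; rewrite ffunE muln0.
have le_a (i : 'I_d) : (d * aexp n i <= asum n)%N by rewrite leqNgt -jumpP J0.
have ub (i : 'I_d) : (aexp n i <= aexp n ord0)%N by apply: aexp_anti.
have all0 : aexp n ord0 = 0%N.
  have := le_a ord0; rewrite /asum (bigD1 ord_max) //= aexp_last add0n => le1.
  have le2 : (\sum_(i < d | i != ord_max) aexp n i <= d' * aexp n ord0)%N.
    have -> : (d' * aexp n ord0 = \sum_(i < d | i != ord_max) aexp n ord0)%N.
      by rewrite sum_nat_const cardC1 card_ord.
    by apply: leq_sum => i _; apply: ub.
  have := leq_trans le1 le2; rewrite mulSn -[leqRHS]add0n leq_add2r leqn0.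
  by move=> /eqP.
apply: aexp_inj => //; rewrite /nvec /= ?ffunE // => i.
rewrite [RHS]aexpE big1 => [|x _]; last by rewrite ffunE muln0.
by apply/eqP; rewrite -leqn0 -all0 ub.
Qed.

Lemma hexp_jump (j : 'I_d) n : jump n = j ->
  hexp n = ((d - j) * lowsum j n + j * highsum j n + j * (d - j) * n j)%N.
Proof.
move=> ej; have := pexp_jump n; rewrite ej (pexpE _ (ltnW (ltn_ord j))).
set s := (\sum_(i < j) _)%N.
have -> : s = (lowsum j n + j * n j + \sum_(x < d | (j < x)%N) j * n x)%N.
  rewrite /s; under eq_bigr => i _ do rewrite aexpE /=.
  rewrite exchange_big /= (big_ord_split3 j) addnA; congr (_ + _ + _)%N.
  - apply: eq_bigr => x lt_xj; rewrite -big_distrl /= count_lt //; exact: ltnW.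
  - by rewrite -big_distrl /= count_lt.
  apply: eq_bigr => x lt_jx; rewrite -big_distrl /=; congr (_ * _)%N.
  rewrite (eq_bigr (fun=> 1%N)); first by rewrite sum1_card card_ord.
  by move=> i _; rewrite (ltn_trans (ltn_ord i) lt_jx).
rewrite asumE (big_ord_split3 j) -/(lowsum j n) => e.
have e2 : (d * \sum_(x < d | (j < x)%N) j * n x =
    j * highsum j n + j * \sum_(x < d | (j < x)%N) x * n x)%N.
  rewrite /highsum !big_distrr -big_split /=; apply: eq_bigr => x _.
  rewrite [LHS]mulnCA -[RHS]mulnDr; congr (_ * _)%N.
  by rewrite -[RHS]mulnDl (subnK (ltnW (ltn_ord x))).
have e3 := subnKC (ltnW (ltn_ord j)).
move: e2 e3 e; move: (\sum_(x < d | _) _)%N (\sum_(x < d | _) _)%N (lowsum j n) (highsum j n).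
move: (j : nat) (n j) (hexp n) (d - j)%N => jj nj h dj s1 s2 A B.
move=> e2 e3 e.
have e4 : (d * A = jj * A + dj * A)%N by rewrite -mulnDl e3.
have e5 : (d * (jj * nj) = jj * (jj * nj) + jj * dj * nj)%N by rewrite -e3; ring.
by move: e; rewrite !mulnDr e2 e4 e5; lia.
Qed.

(** The least n_j satisfying both inequalities of [jumpE]; the strict one is binding for B <= A, the
    weak one otherwise. *)
Definition thresh (j A B : nat) : nat :=
  if (B <= A)%N then ((A - B) %/ (d - j)).+1 else ((B - A).-1 %/ j).+1.

Lemma threshP (j A B x : nat) : (0 < j < d)%N ->
  (thresh j A B <= x)%N = (A < (d - j) * x + B)%N && (B <= j * x + A)%N.
Proof.
move=> /andP[j0 jd]; have dj0 : (0 < d - j)%N by rewrite subn_gt0.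
rewrite /thresh; have [le_BA|lt_AB] := leqP B A.
  rewrite ltn_divLR // [(B <= _)%N](leq_trans le_BA (leq_addl _ _)) andbT.
  by rewrite ltn_subLR // mulnC addnC.
rewrite ltn_divLR // [(A < _)%N](leq_trans lt_AB (leq_addl _ _)) /=.
rewrite prednK ?subn_gt0 // leq_subLR mulnC addnC; exact: (esym (prednK _)) || by [].
Qed.

Lemma thresh_exp (j A B : nat) : (0 < j < d)%N ->
  ((d - j) * A + j * B + j * (d - j) * thresh j A B =
   if B <= A then d * A + j * ((d - j) - (A - B) %% (d - j))
   else d * B + (d - j) * (j - ((B - A).-1 %% j).+1))%N.
Proof.
move=> /andP[j0 jd]; have dj0 : (0 < d - j)%N by rewrite subn_gt0.
have ed := subnKC (ltnW jd); move: dj0 ed; rewrite /thresh; move: (d - j)%N => e e0 ed.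
have [le_BA|lt_AB] := leqP B A.
  have := divn_eq (A - B) e; have := ltn_pmod (A - B) e0.
  move: (_ %/ _)%N (_ %% _)%N => x r lt_r eAB.
  have eA : A = (B + (x * e + r))%N by rewrite -eAB subnKC.
  have h1 : (j * A = j * B + j * e * x + j * r)%N by rewrite eA; ring.
  have h2 : (j * (e - r) + j * r = j * e)%N by rewrite -mulnDr subnK // ltnW.
  by rewrite -ed mulnDl mulnS h1; move: h2; lia.
have := divn_eq (B - A).-1 j; have := ltn_pmod (B - A).-1 j0.
move: (_ %/ _)%N (_ %% _)%N => x r lt_r eB.
have eBA : B = (A + (x * j + r).+1)%N by rewrite -eB prednK ?subn_gt0 // subnKC // ltnW.
have h1 : (e * B = e * A + j * e * x + e * r.+1)%N by rewrite eBA; ring.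
have h2 : (e * (j - r.+1) + e * r.+1 = e * j)%N by rewrite -mulnDr subnK.
by rewrite -ed [((j + e) * B)%N]mulnDl mulnS h1; move: h2; lia.
Qed.

Section Piece.
Variable j : 'I_d.
Hypothesis j0 : (0 < j)%N.
Implicit Types (z : {ffun idx j -> nat}).

Definition ins z x : {ffun 'I_d -> nat} :=
  [ffun i => if i == j then x else if insub i is Some i' then z i' else 0%N].

Lemma ins_j z x : ins z x j = x.
Proof. by rewrite ffunE eqxx. Qed.

Lemma ins_val z x (i : idx j) : ins z x (val i) = z i.
Proof.
by rewrite ffunE valK; case: eqP => // e; have /andP[_] := valP i; rewrite e eqxx.
Qed.

Lemma ins_nvec z x : nvec (ins z x).
Proof.
rewrite /nvec /= ffunE; case: eqP => [e|_]; first by have := j0; rewrite -e.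
by case: insubP => // u /=.
Qed.

Lemma ins_surj n : nvec n -> exists z, n = ins z (n j).
Proof.
move=> n0; exists [ffun i => n (val i)]; apply/ffunP => i; rewrite ffunE.
case: eqP => [-> //|/eqP nij]; case: insubP => [u _ eu|]; first by rewrite ffunE eu.
rewrite nij andbT lt0n negbK => /eqP i0; rewrite -n0; congr (n _).
exact: val_inj.
Qed.

Lemma big_ins z x (P : pred 'I_d) (G : 'I_d -> nat) :
  (forall i, P i -> i != j) ->
  (\sum_(i | P i) G i * ins z x i = \sum_(i : idx j | P (val i)) G (val i) * z i)%N.
Proof.
move=> Pj; rewrite (bigID (fun i : 'I_d => (0 < i)%N)) /= [X in (_ + X)%N]big1 ?addn0; last first.
  move=> i /andP[_]; rewrite -eqn0Ngt => /eqP i0.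
  rewrite (_ : i = ord0); last exact: val_inj.
  by rewrite (ins_nvec z x) muln0.
rewrite (@reindex_omap _ _ _ _ _ (val : idx j -> 'I_d) insub) /=; last first.
  move=> i /andP[Pi i0]; case: insubP => [u _ /= eu|]; by rewrite ?eu // i0 Pj.
apply: eq_big => [i|i _]; last by rewrite ins_val.
by rewrite valK eqxx andbT; have /andP[-> _] := valP i; rewrite andbT.
Qed.

Definition lowz z : nat := (\sum_(i : idx j | (val i < j)%N) val i * z i)%N.
Definition highz z : nat := (\sum_(i : idx j | (j < val i)%N) (d - val i) * z i)%N.

Lemma lowsum_ins z x : lowsum j (ins z x) = lowz z.
Proof.
apply: (@big_ins z x (fun i : 'I_d => (i < j)%N) (fun i : 'I_d => i : nat)) => i.
by apply: contraTneq => ->; rewrite ltnn.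
Qed.

Lemma highsum_ins z x : highsum j (ins z x) = highz z.
Proof.
apply: (@big_ins z x (fun i : 'I_d => (j < i)%N) (fun i : 'I_d => d - i)%N) => i.
by apply: contraTneq => ->; rewrite ltnn.
Qed.

Definition jthresh z := thresh j (lowz z) (highz z).

Lemma jump_ins z x : (jump (ins z x) == j :> nat) = (jthresh z <= x)%N.
Proof.
by rewrite jumpE // lowsum_ins highsum_ins ins_j threshP // j0 ltn_ord.
Qed.

(** The value of E at the first point of the fiber over [z]. *)
Definition zexp z : nat :=
  ((d - j) * lowz z + j * highz z + j * (d - j) * jthresh z)%N.

Lemma hexp_ins z t : hexp (ins z (jthresh z + t)) = (zexp z + j * (d - j) * t)%N.
Proof.
have /eqP/hexp_jump -> : jump (ins z (jthresh z + t)) == j :> nat.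
  by rewrite jump_ins leq_addr.
by rewrite lowsum_ins highsum_ins ins_j mulnDr addnA.
Qed.

Lemma rho_ins z x : rho (ins z x) =
  ((d - j) * lowz z + j * highz z + j * (d - j) * x + Rexp z)%N.
Proof.
rewrite rhoE (big_ord_split3 j) ins_j.
rewrite (@big_ins z x (fun i : 'I_d => (i < j)%N) (fun i : 'I_d => i * (d - i))%N); last first.
  by move=> i; apply: contraTneq => ->; rewrite ltnn.
rewrite (@big_ins z x (fun i : 'I_d => (j < i)%N) (fun i : 'I_d => i * (d - i))%N); last first.
  by move=> i; apply: contraTneq => ->; rewrite ltnn.
pose R1 := (\sum_(i : idx j | (val i < j)%N) val i * (j - val i) * z i)%N.
pose R2 := (\sum_(i : idx j | (j < val i)%N) (val i - j) * (d - val i) * z i)%N.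
have -> : Rexp z = (R1 + R2)%N by [].
have -> : (\sum_(i : idx j | (val i < j)%N) val i * (d - val i) * z i = (d - j) * lowz z + R1)%N.
  rewrite /lowz big_distrr /= -big_split /=; apply: eq_bigr => i lt_ij.
  rewrite mulnCA !mulnA -!mulnDl -mulnDr; congr (_ * _ * _)%N.
  by rewrite addnBA ?subnK // ltnW.
have -> : (\sum_(i : idx j | (j < val i)%N) val i * (d - val i) * z i = j * highz z + R2)%N.
  rewrite /highz big_distrr /= -big_split /=; apply: eq_bigr => i lt_ij.
  by rewrite mulnA -!mulnDl subnKC // ltnW.
by lia.
Qed.

Lemma rho_hexp_ins z t :
  rho (ins z (jthresh z + t)) = (hexp (ins z (jthresh z + t)) + Rexp z)%N.
Proof.
by rewrite hexp_ins rho_ins /zexp mulnDr !addnA.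
Qed.

Lemma suppn_ins z x : (0 < x)%N -> suppn (ins z x) = (j |: supp z)%SET.
Proof.
move=> x0; apply/setP => i; rewrite !inE ffunE.
have [//|nij] /= := eqVneq i j.
apply/idP/finset.imsetP => [|[i']]; last by rewrite inE => zi ->; rewrite valK.
case: insubP => // u _ eu zu; exists u; by rewrite ?inE.
Qed.

Lemma jthresh_gt0 z : (0 < jthresh z)%N.
Proof. by rewrite /jthresh /thresh; case: ifP. Qed.

Lemma ins_bij : set_bij [set: {ffun idx j -> nat} * nat]
  [set n | nvec n /\ jump n = j] (fun zt => ins zt.1 (jthresh zt.1 + zt.2)).
Proof.
split.
- move=> [z t] _ /=; split; first exact: ins_nvec.
  by apply/eqP; rewrite jump_ins leq_addr.
- move=> [z t] [z' t'] _ _ /= e.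
  have ez : z = z' by apply/ffunP => i; rewrite -(ins_val z (jthresh z + t)) e ins_val.
  have := congr1 (fun n : {ffun 'I_d -> nat} => n j) e; rewrite !ins_j ez.
  by move/addnI ->.
move=> n [n0 /eqP Jn]; have [z en] := ins_surj n0.
exists (z, n j - jthresh z)%N => //=; rewrite subnKC -?en //.
by rewrite -jump_ins -en Jn.
Qed.

Lemma zexp_ge z (i : idx j) : (z i <= zexp z)%N.
Proof.
have jd := ltn_ord j; have dj0 : (0 < d - j)%N by rewrite subn_gt0.
have /andP[i0 nij] := valP i.
have [lt_ij|] := ltnP (val i) j.
  have : (z i <= lowz z)%N.
    by rewrite /lowz (bigD1 i) //=; apply: leq_trans (leq_addr _ _); rewrite leq_pmull.
  move=> H; rewrite /zexp -addnA; apply: leq_trans (leq_addr _ _).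
  exact: leq_trans H (leq_pmull _ dj0).
rewrite leq_eqVlt eq_sym (inj_eq val_inj) (negPf nij) /= => lt_ji.
have : (z i <= highz z)%N.
  rewrite /highz (bigD1 i) //=; apply: leq_trans (leq_addr _ _).
  by rewrite leq_pmull // subn_gt0 ltn_ord.
move=> H; rewrite /zexp; apply: leq_trans (leq_addr _ _); apply: leq_trans (leq_addl _ _).
exact: leq_trans H (leq_pmull _ j0).
Qed.

End Piece.
End WeightSums.

Lemma esum_finType (R : realType) (T : finType) (P : pred T) (a : T -> R) :
  (forall x, P x -> 0 <= a x) ->
  \esum_(x in [set x | P x]) (a x)%:E = (\sum_(x | P x) a x)%:E.
Proof.
move=> a0; rewrite esum_fset; last 2 first.
- exact: finite_finset.
- by move=> x; rewrite inE => /a0; rewrite lee_fin.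
rewrite -sumEFin; apply/esym; apply: (@bigfs _ _ _ _ (index_enum T) P).
  exact: index_enum_uniq.
by move=> x _; rewrite mem_index_enum.
Qed.

(** * Weighted sums over the remaining coordinates z *)

Section WeightSeries.
Variables (R : realType) (d' q : nat).
Local Notation d := d'.+1.
Hypothesis q1 : (1 < q)%N.
Implicit Types (n : {ffun 'I_d -> nat}).

Lemma Qfact_gt0 l : 0 < Qfact R q l.
Proof.
rewrite /Qfact big_nat; apply: prodr_gt0 => i /andP[i0 _].
by rewrite subr_gt0 -natrX ltr1n -(exp1n i) ltn_exp2r.
Qed.

Lemma Cconst_gt0 (I : {set 'I_d}) : 0 < Cconst R q I.
Proof.
rewrite /Cconst !mulr_gt0 ?invr_gt0 ?exprn_gt0 ?subr_gt0 ?ltr1n ?ltr0n //; try by apply: ltnW.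
by apply: prodr_gt0 => l _; rewrite invr_gt0 Qfact_gt0.
Qed.

Let qgt0 : 0 < (q%:R : R). Proof. by rewrite ltr0n ltnW. Qed.
Let qn0 : (q%:R : R) != 0. Proof. by rewrite gt_eqF. Qed.

Definition nweight n : R := Cconst R q (suppn n) * (q%:R ^+ rho n)^-1.

Lemma nweight_ge0 n : 0 <= nweight n.
Proof. by rewrite mulr_ge0 ?invr_ge0 ?exprn_ge0 ?ler0n // ltW ?Cconst_gt0. Qed.

Section OnePiece.
Variable j : 'I_d.
Hypothesis j0 : (0 < j)%N.
Implicit Types (z : {ffun idx j -> nat}) (I : {set idx j}).
Local Notation e := (j * (d - j))%N.

Definition zweight z : R := Cconst R q (j |: supp z)%SET * (q%:R ^+ Rexp z)^-1.

Lemma zweight_gt0 z : 0 < zweight z.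
Proof. by rewrite mulr_gt0 ?invr_gt0 ?exprn_gt0 ?Cconst_gt0. Qed.

Definition boxz N (z : {ffun idx j -> 'I_N}) : {ffun idx j -> nat} := [ffun i => val (z i)].

Definition hbox N m : R := \sum_(z : {ffun idx j -> 'I_N} | zexp (boxz z) == m) zweight (boxz z).
(* The box is large enough: by zexp_ge, zexp z = m forces z i <= m for all i. *)
Definition hseq m := hbox m.+1 m.

Lemma boxz_bij N m : (m < N)%N ->
  set_bij [set z | zexp (@boxz N z) == m] [set z | zexp z = m] (@boxz N).
Proof.
move=> lt_mN; split.
- by move=> z /= /eqP.
- move=> z z' _ _ /ffunP ez; apply/ffunP => i; apply: val_inj.
  by have := ez i; rewrite !ffunE.
move=> z /= zm; have lt_zN i : (z i < N)%N.
  by apply: leq_ltn_trans lt_mN; rewrite -zm; apply: zexp_ge.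
have eb : boxz [ffun i => Ordinal (lt_zN i)] = z by apply/ffunP => i; rewrite !ffunE.
by exists [ffun i => Ordinal (lt_zN i)] => //; rewrite /= eb zm.
Qed.

Lemma esum_hbox N m : (m < N)%N ->
  \esum_(z in [set z | zexp z = m]) (zweight z)%:E = (hbox N m)%:E.
Proof.
move=> lt_mN; rewrite -esum_finType; last by move=> z _; rewrite ltW ?zweight_gt0.
by apply: (@reindex_esum _ _ _ _ _ (@boxz N)); exact: boxz_bij.
Qed.

Lemma esum_hseqZ m (c : R) : 0 <= c ->
  \esum_(z in [set z | zexp z = m]) (zweight z * c)%:E = (hseq m * c)%:E.
Proof.
move=> c0; rewrite /hseq /hbox mulr_suml -esum_finType; last first.
  by move=> z _; rewrite mulr_ge0 // ltW ?zweight_gt0.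
by apply: (@reindex_esum _ _ _ _ _ (@boxz m.+1)); exact: boxz_bij.
Qed.

Lemma hboxE N m : (m < N)%N -> hbox N m = hseq m.
Proof. by move=> lt_mN; apply: EFin_inj; rewrite -!esum_hbox. Qed.

Lemma hseq_ge0 m : 0 <= hseq m.
Proof. by apply: sumr_ge0 => z _; rewrite ltW ?zweight_gt0. Qed.

Lemma esum_zweight : \esum_(z in [set: {ffun idx j -> nat}]) (zweight z)%:E =
  (\sum_(0 <= m <oo) (hseq m)%:E)%E.
Proof.
rewrite nneseries_esumT; last by move=> m; rewrite lee_fin hseq_ge0.
have -> : [set: {ffun idx j -> nat}] = \bigcup_(m in [set: nat]) [set z | zexp z = m].
  by apply/seteqP; split=> // z _; exists (zexp z).
rewrite esum_bigcupT; last 2 first.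
- by move=> m m' _ _ [z [/= -> ->]].
- by move=> z; rewrite lee_fin ltW ?zweight_gt0.
by apply: eq_esum => m _; rewrite (esum_hbox (ltnSn m)).
Qed.

Definition xw (i : idx j) : R :=
  (q%:R ^+ (if (val i < j)%N then val i * (j - val i) else (val i - j) * (d - val i))%N)^-1.

Lemma idx_neq (i : idx j) : val i != j.
Proof. by have /andP[] := valP i. Qed.

Lemma xw_Rexp z : (q%:R ^+ Rexp z)^-1 = \prod_i xw i ^+ z i.
Proof.
rewrite /Rexp exprD invfM -!prodrXr -!prodfV [RHS](bigID (fun i : idx j => (val i < j)%N)) /=.
congr (_ * _).
  by apply: eq_bigr => i lt_ij; rewrite /xw lt_ij exprM exprVn.
apply: eq_big => [i|i lt_ji].
  by rewrite -leqNgt [RHS]leq_eqVlt eq_sym (inj_eq val_inj) (negPf (idx_neq i)).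
by rewrite /xw ltnNge (ltnW lt_ji) /= exprM exprVn.
Qed.

Lemma xw_ge0 i : 0 <= xw i.
Proof. by rewrite invr_ge0 exprn_ge0 ?ler0n. Qed.

Lemma xw_le_half i : xw i <= 2^-1.
Proof.
rewrite /xw lef_pV2 ?posrE ?exprn_gt0 //.
apply: le_trans (_ : q%:R ^+ 1 <= _); first by rewrite expr1 ler_nat.
rewrite ler_weXn2l ?ler1n ?(ltnW q1) //; have /andP[i0 nij] := valP i.
case: (ltnP (val i) j) => [lt_ij|]; first by rewrite muln_gt0 i0 subn_gt0.
rewrite leq_eqVlt eq_sym (inj_eq val_inj) (negPf nij) /= => lt_ji.
by rewrite muln_gt0 !subn_gt0 lt_ji ltn_ord.
Qed.

(** The constants [Cconst] are bounded by their sum over all index sets. The rest is dominated by a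
    product of geometric series of ratio at most 1/2, each with sum at most 2. *)
Lemma sum_hseq_bounded : exists M : R, forall N, \sum_(m < N) hseq m <= M.
Proof.
pose C := \sum_(I : {set 'I_d}) Cconst R q I.
have CP (I : {set 'I_d}) : Cconst R q I <= C.
  rewrite /C (bigD1 I) //= lerDl sumr_ge0 // => J _; by rewrite ltW ?Cconst_gt0.
exists (C * 2 ^+ #|{: idx j}|) => N.
have -> : \sum_(m < N) hseq m = \sum_(z : {ffun idx j -> 'I_N} | (zexp (boxz z) < N)%N)
    zweight (boxz z).
  under eq_bigr => m _ do rewrite -(hboxE (ltn_ord m)) /hbox.
  rewrite (exchange_big_dep (fun z : {ffun idx j -> 'I_N} => (zexp (boxz z) < N)%N)) /=; last first.
    by move=> m z _ /eqP ->.
  apply: eq_bigr => z lt_zN; rewrite (big_pred1 (Ordinal lt_zN)) // => m.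
apply: le_trans (_ : \sum_(z : {ffun idx j -> 'I_N}) C * \prod_i xw i ^+ z i <= _).
  rewrite big_mkcond /=; apply: ler_sum => z _.
  have p0 : 0 <= \prod_i xw i ^+ z i by apply: prodr_ge0 => i _; rewrite exprn_ge0 ?xw_ge0.
  case: ifP => _; last by rewrite mulr_ge0 // (le_trans _ (CP finset.set0)) // ltW ?Cconst_gt0.
  rewrite /zweight xw_Rexp; under eq_bigr => i _ do rewrite ffunE.
  by rewrite ler_wpM2r.
rewrite -mulr_sumr ler_wpM2l //; first by rewrite (le_trans _ (CP finset.set0)) // ltW ?Cconst_gt0.
rewrite -(bigA_distr_bigA (fun i (t : 'I_N) => xw i ^+ t)) /=.
rewrite -[2 ^+ _]prodr_const; apply: ler_prod => i _.
rewrite sumr_ge0 => [|t _]; last by rewrite exprn_ge0 ?xw_ge0.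
have x1 : 0 < 1 - xw i.
  by rewrite subr_gt0 (le_lt_trans (xw_le_half i)) // invf_lt1 ?ltr1n.
rewrite -(ler_pM2l x1) -subrX1_opp || rewrite -(ler_pM2l x1).
have -> : (1 - xw i) * (\sum_(t < N) xw i ^+ t) = 1 - xw i ^+ N.
  by rewrite -[RHS]opprB subrX1 -mulNr opprB.
apply: le_trans (_ : 1 <= _); first by rewrite lerBlDr lerDl exprn_ge0 ?xw_ge0.
have := xw_le_half i; lra.
Qed.

(** [Cconst] depends on z only through its support. The indicator fixes the support to [I] while
    keeping the summand a product over coordinates. *)
Definition support_factor I (i : idx j) t : R := ((0 < t)%N == (i \in I))%:R * xw i ^+ t.

Lemma support_factor_ratseq I i : ratseq (support_factor I i).
Proof.
rewrite /support_factor; case: (i \in I).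
  apply: ratseq_ext (ratseq_delay 0 (ratseqZ (xw i) (ratseq_geom (xw i)))).
  by case=> [|t]; rewrite ?mul0r //= mul1r exprS.
apply: ratseq_ext (ratseq_delta R) => -[|t]; rewrite ?mul1r ?expr0 //=.
by rewrite mul0r.
Qed.

Lemma prod_support_factor I z :
  \prod_i support_factor I i (z i) = (I == [set i | (0 < z i)%N]%SET)%:R * \prod_i xw i ^+ z i.
Proof.
rewrite big_split /=; congr (_ * _).
have [->|nI] := eqVneq I _.
  by rewrite big1 // => i _; rewrite inE eqxx.
have [i Hi] : exists i, (0 < z i)%N != (i \in I).
  apply/existsP; apply: contraNT nI; rewrite negb_exists => /forallP H.
  by apply/eqP/setP => i; rewrite inE; have := H i; rewrite negbK => /eqP ->.
by rewrite (bigD1 i) //= (negPf Hi) mul0r.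
Qed.

(** For a fixed support the joint weight of the values A and B of the low and high sums factors as
    [al I A * be I B]; [ratseq_pwexp] regroups these by [zexp], and finitely many supports are
    added. *)
Lemma hseq_ratseq : ratseq hseq.
Proof.
have d_j0 : (0 < d - j)%N by rewrite subn_gt0.
pose low (i : idx j) := (val i < j)%N.
pose w (i : idx j) := (if (val i < j)%N then val i : nat else d - val i)%N.
have w0 i : (0 < w i)%N.
  rewrite /w; have /andP[i0 _] := valP i; case: ifP => // _; by rewrite subn_gt0 ltn_ord.
have rI I := ratseq_prod_wpoly (P := low) (f := support_factor I)
  (fun i _ => w0 i) (support_factor_ratseq I).
have rI' I := ratseq_prod_wpoly (P := predC low) (f := support_factor I)
  (fun i _ => w0 i) (support_factor_ratseq I).
pose al I := projT1 (cid2 (rI I)); pose be I := projT1 (cid2 (rI' I)).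
have [ral alE] : (forall I, ratseq (al I)) /\ forall I N x, (x < N)%N ->
    (\prod_(i | low i) wpoly (support_factor I) N w i)`_x = al I x.
  by split=> I; rewrite /al; case: cid2.
have [rbe beE] : (forall I, ratseq (be I)) /\ forall I N x, (x < N)%N ->
    (\prod_(i | ~~ low i) wpoly (support_factor I) N w i)`_x = be I x.
  by split=> I; rewrite /be; case: cid2.
pose g I m := \sum_(A < m.+1) \sum_(B < m.+1)
  (pwexp (d - j) j A B == m)%:R * (al I A * be I B).
have H : ratseq (fun m => \sum_(I : {set idx j})
    Cconst R q (j |: [set val i | i in I])%SET * g I m).
  by apply: ratseq_sum => I _; apply: ratseqZ; apply: ratseq_pwexp.
apply: ratseq_ext H => m.
have lowE (z : {ffun idx j -> 'I_m.+1}) :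
    (\sum_(i | low i) w i * z i)%N = lowz (boxz z).
  by apply: eq_bigr => i; rewrite /low /w ffunE => ->.
have highE (z : {ffun idx j -> 'I_m.+1}) :
    (\sum_(i | ~~ low i) w i * z i)%N = highz (boxz z).
  apply: eq_big => [i|i /negPf]; last by rewrite /low /w ffunE => ->.
  by rewrite /low -leqNgt leq_eqVlt eq_sym (inj_eq val_inj) (negPf (idx_neq i)).
have zE z : zexp z = pwexp (d - j) j (lowz z) (highz z).
  rewrite /zexp /jthresh thresh_exp ?j0 ?ltn_ord // /pwexp.
  by rewrite subnKC // ltnW ?ltn_ord.
(* Neither sum exceeds [zexp z], so on level m the values A and B may be cut at m. *)
have le_low z : zexp z = m -> (lowz z < m.+1)%N.
  by move=> <-; rewrite ltnS /zexp -addnA; apply: leq_trans (leq_addr _ _); rewrite leq_pmull.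
have le_high z : zexp z = m -> (highz z < m.+1)%N.
  move=> <-; rewrite ltnS /zexp; apply: leq_trans (leq_addr _ _); apply: leq_trans (leq_addl _ _).
  by rewrite leq_pmull.
have gE I : g I m = \sum_(z : {ffun idx j -> 'I_m.+1} | zexp (boxz z) == m)
    \prod_i support_factor I i (z i).
  transitivity (\sum_(A < m.+1) \sum_(B < m.+1) \sum_(z : {ffun idx j -> 'I_m.+1} |
      (zexp (boxz z) == m) && ((lowz (boxz z) == A) && (highz (boxz z) == B)))
      \prod_i support_factor I i (z i)).
    apply: eq_bigr => A _; apply: eq_bigr => B _.
    rewrite -(alE _ m.+1) // -(beE _ m.+1) // -coef_prod2_split.
    rewrite mulr_natl mulrb; case: eqP => [eAB|nAB]; last first.
      rewrite big_pred0 // => z; apply/negbTE; apply/negP => /andP[/eqP zm /andP[/eqP eA /eqP eB]].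
      by apply: nAB; rewrite -eA -eB -zE.
    apply: eq_bigl => z; rewrite lowE highE.
    case: eqP => [eA|]; rewrite ?andbF //; case: eqP => [eB|]; rewrite ?andbF //.
    by rewrite zE eA eB eAB eqxx.
  rewrite pair_bigA /=.
  rewrite (exchange_big_dep (fun z : {ffun idx j -> 'I_m.+1} => zexp (boxz z) == m)) /=; last first.
    by move=> AB z _ /andP[].
  apply: eq_bigr => z /eqP zm.
  rewrite (big_pred1 (Ordinal (le_low _ zm), Ordinal (le_high _ zm))) // => -[A B] /=.
  by rewrite zm eqxx /= xpair_eqE -!(inj_eq val_inj) /= ![_ == val _]eq_sym.
rewrite /hseq /hbox; under eq_bigr => I _ do rewrite gE mulr_sumr.
rewrite exchange_big /=; apply: eq_bigr => z _.
rewrite [LHS](bigD1 ([set i | (0 < z i)%N]%SET : {set idx j})) //= [X in _ + X]big1 => [|I nI]; last first.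
  have -> : \prod_i support_factor I i (z i) = \prod_i support_factor I i (boxz z i).
    by apply: eq_bigr => i _; rewrite ffunE.
  rewrite prod_support_factor (_ : I == _ = false) ?mul0r ?mulr0 //.
  apply: contra_neqF nI => /eqP ->; apply/setP => i; by rewrite !inE ffunE.
rewrite addr0 /zweight.
have -> : \prod_i support_factor [set i | (0 < z i)%N]%SET i (z i) =
    \prod_i support_factor [set i | (0 < z i)%N]%SET i (boxz z i).
  by apply: eq_bigr => i _; rewrite ffunE.
rewrite prod_support_factor xw_Rexp.
have eS : [set i | (0 < z i)%N]%SET = [set i | (0 < boxz z i)%N]%SET.
  by apply/setP => i; rewrite !inE ffunE.
rewrite eS eqxx mul1r; congr (Cconst _ _ (_ :|: _)%SET * _).
Qed.

End OnePiece.
End WeightSeries.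

(** * Total mass at each height *)

Section LevelSeries.
Variables (R : realType) (d' q : nat).
Local Notation d := d'.+1.
Hypothesis q1 : (1 < q)%N.
Implicit Types (n : {ffun 'I_d -> nat}).

Let qgt0 : 0 < (q%:R : R). Proof. by rewrite ltr0n ltnW. Qed.
Let qn0 : (q%:R : R) != 0. Proof. by rewrite gt_eqF. Qed.

Lemma esum_ord (a : nat -> R) N : (forall m, 0 <= a m) ->
  \esum_(m in `I_N) (a m)%:E = (\sum_(m < N) a m)%:E.
Proof.
move=> a0; rewrite esum_fset ?finite_II // => [|m _]; last by rewrite lee_fin.
by rewrite -fsbig_ord sumEFin.
Qed.

(* q^m times the mass of the points of height q^(m/d) with jump j. *)
Definition bjseq (j : 'I_d) : nat -> R :=
  conv (fun t => (j * (d - j) %| t)%N%:R) (@hseq R d' q j).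

Definition bseq m : R := (m == 0%N)%:R * Cconst R q (finset.set0 : {set 'I_d}) +
  \sum_(j : 'I_d | (0 < j)%N) bjseq j m.

Lemma bjseq_ge0 j m : 0 <= bjseq j m.
Proof. by apply: sumr_ge0 => i _; rewrite mulr_ge0 ?ler0n ?hseq_ge0. Qed.

Lemma bseq_ge0 m : 0 <= bseq m.
Proof.
apply: addr_ge0; first by rewrite mulr_ge0 ?ler0n // ltW ?Cconst_gt0.
by apply: sumr_ge0 => j _; apply: bjseq_ge0.
Qed.

Lemma step_gt0 (j : 'I_d) : (0 < j)%N -> (0 < j * (d - j))%N.
Proof. by move=> j0; rewrite muln_gt0 j0 subn_gt0 ltn_ord. Qed.

(** A point is given by z and its rise s = e t above the threshold height, with [zexp z] = m - s. By
    [rho_hexp_ins] its weight is [zweight z] divided by q^m, whatever the rise, so the sum is a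
    convolution. *)
Lemma esum_jump (j : 'I_d) m : (0 < j)%N ->
  \esum_(n in [set n : {ffun 'I_d -> nat} | (nvec n /\ hexp n = m) /\ jump n = j]) (nweight R q n)%:E =
  (bjseq j m * (q%:R ^+ m)^-1)%:E.
Proof.
move=> j0; set e := (j * (d - j))%N; have e0 : (0 < e)%N := step_gt0 j0.
pose J s : set {ffun idx j -> nat} := [set z | (e %| s)%N /\ zexp z = (m - s)%N].
pose f (sz : nat * {ffun idx j -> nat}) := ins sz.2 (jthresh sz.2 + sz.1 %/ e)%N.
have [fS fI fE] := ins_bij j0.
rewrite (@reindex_esum _ _ _ (`I_m.+1 `*`` J) _ f); last first.
  split.
  - move=> [s z] /= [lt_s [/dvdnP[t et] ez]].
    have [n0 Jn] := fS (z, s %/ e)%N I; split=> //; split=> //.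
    by rewrite /f /= hexp_ins // ez -/e {2}et mulnK // mulnC -et subnK.
  - move=> [s z] [s' z']; rewrite !inE /= => -[_ [/divnK es _]] [_ [/divnK es' _]] ef.
    have := fI (z, s %/ e)%N (z', s' %/ e)%N; rewrite !inE => /(_ I I ef)[-> e2].
    by rewrite -es e2 es'.
  move=> n [[n0 hn] Jn]; have [[z t] _ /= ez] := fE n (conj n0 Jn).
  have hz : (zexp z + e * t)%N = m by rewrite -hn -ez hexp_ins.
  exists (e * t, z)%N; last by rewrite /f /= mulKn.
  split=> /=; first by rewrite ltnS -hz leq_addl.
  by rewrite /J /= dvdn_mulr // -hz addnK.
have -> : \esum_(i in `I_m.+1 `*`` J) (nweight R q (f i))%:E =
    \esum_(i in `I_m.+1 `*`` J) ((zweight R q i.2 * (q%:R ^+ m)^-1)%:E).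
  apply: eq_esum => -[s z] /= [lt_s [/dvdnP[t et] ez]].
  rewrite /nweight /zweight /f suppn_ins //; last first.
    by rewrite addn_gt0 jthresh_gt0.
  rewrite rho_hexp_ins // hexp_ins // ez -/e [in (e * _)%N]et mulnK // [(e * t)%N]mulnC -et subnK //.
  by rewrite /= exprD invfM mulrA mulrAC.
rewrite -(esum_esum (a := fun s z => (zweight R q z * (q%:R ^+ m)^-1)%:E)); last first.
  by move=> s z _ _; rewrite lee_fin mulr_ge0 ?invr_ge0 ?exprn_ge0 ?ltW ?zweight_gt0.
rewrite (eq_esum (b := fun s => ((e %| s)%N%:R * hseq R q j (m - s) * (q%:R ^+ m)^-1)%:E)).
  rewrite esum_ord; last by move=> s; rewrite !mulr_ge0 ?ler0n ?hseq_ge0 ?invr_ge0 ?exprn_ge0 ?ltW.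
  by rewrite /bjseq /conv mulr_suml.
move=> s lt_s; case: (boolP (e %| s)%N) => [es|/negPf nes]; last first.
  by rewrite (_ : J s = set0) ?esum_set0 ?mul0r //; apply/seteqP; split=> // z [] /=; rewrite nes.
have -> : J s = [set z | zexp z = (m - s)%N] by apply/seteqP; split=> // z [].
by rewrite mul1r esum_hseqZ // invr_ge0 exprn_ge0 ?ltW.
Qed.

Lemma esum_nweight m : \esum_(n in [set n : {ffun 'I_d -> nat} | nvec n /\ hexp n = m]) (nweight R q n)%:E =
  (bseq m * (q%:R ^+ m)^-1)%:E.
Proof.
have w0 n : (0 <= (nweight R q n)%:E)%E by rewrite lee_fin nweight_ge0.
transitivity (\esum_(n in [set n : {ffun 'I_d -> nat} | nvec n /\ hexp n = m])
  (\sum_(j : 'I_d) if n \in [set n | jump n = j] then (nweight R q n)%:E else 0)%E).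
  apply: eq_esum => n _; rewrite (bigD1 (Ordinal (jump_lt n))) //= mem_set // big1 ?adde0 //.
  move=> j nj; case: ifPn => //; rewrite inE /= => Jn; case/eqP: nj; exact: val_inj.
rewrite esum_sum; last by move=> n j _ _; case: ifP.
rewrite (bigD1 ord0) //= /bseq mulrDl EFinD; congr (_ + _)%E.
  rewrite -esum_mkcondr; have [->|m0] := eqVneq m 0%N.
    have -> : [set n : {ffun 'I_d -> nat} | nvec n /\ hexp n = 0%N] `&`
        [set n | jump n = (ord0 : 'I_d)] = [set [ffun=> 0%N]].
      apply/seteqP; split=> n /=.
        by move=> [[n0 _] /eqP]; rewrite jump0 // => /eqP.
      move=> ->; have n0 : nvec [ffun _ : 'I_d => 0%N] by rewrite /nvec /= ffunE.
      split; last by apply/eqP; rewrite jump0.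
      split=> //; rewrite /hexp big1 // => i _.
      by rewrite aexpE big1 ?muln0 ?sub0n // => x _; rewrite ffunE muln0.
    rewrite esum_set1 // mul1r expr0 invr1 mulr1 /nweight rhoE big1 ?expr0 ?invr1 ?mulr1.
      by congr (Cconst _ _ _)%:E; apply/setP => i; rewrite !inE ffunE.
    by move=> x _; rewrite ffunE muln0.
  rewrite (_ : _ `&` _ = set0) ?esum_set0 ?mul0r //; apply/seteqP; split=> // n /=.
  move=> [[n0 hn] /eqP]; rewrite jump0 // => /eqP en.
  case/eqP: m0; rewrite -hn en /hexp big1 // => i _.
  by rewrite aexpE big1 ?muln0 ?sub0n // => x _; rewrite ffunE muln0.
rewrite mulr_suml -sumEFin; apply: eq_big => [j|j]; first by rewrite lt0n.
rewrite -lt0n => j0; rewrite -esum_mkcondr -esum_jump //.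
Qed.

(** Coefficient form of (1 - v^e) times the series of [bjseq j] being that of [hseq j], for e = j (d
    - j). *)
Lemma bjseq_rec (j : 'I_d) m : (0 < j)%N -> bjseq j m = hseq R q j m +
  if (j * (d - j) <= m)%N then bjseq j (m - j * (d - j))%N else 0.
Proof.
move=> /step_gt0; set e := (j * (d - j))%N => e0.
rewrite /bjseq /conv -/e; have [le_em|lt_me] := leqP e m; last first.
  rewrite addr0 big_ord_recl /= dvdn0 mul1r subn0 big1 ?addr0 // => i _.
  rewrite (_ : (e %| _)%N = false) ?mul0r //; apply/negbTE/negP => /dvdn_leq /=.
  by have := ltn_ord i; rewrite /bump /=; lia.
rewrite -(big_mkord xpredT (fun i => (e %| i)%N%:R * hseq R q j (m - i)%N)).
rewrite (big_cat_nat (n := e)) //=; last exact: leqW.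
congr (_ + _).
  rewrite big_ltn // dvdn0 mul1r subn0 big_nat big1 ?addr0 // => i /andP[i0 lt_ie].
  by rewrite gtnNdvd ?mul0r.
rewrite -{1}[e]add0n big_addn subSn // big_mkord.
by apply: eq_bigr => i _; rewrite dvdn_addl // subnDA subnAC.
Qed.

Lemma bjseq_bounded (j : 'I_d) : (0 < j)%N -> exists M, forall m, bjseq j m <= M.
Proof.
move=> j0; have [M HM] := sum_hseq_bounded R q1 j0; exists M => m.
apply: le_trans (HM m.+1); rewrite [leRHS](reindex_inj rev_ord_inj) /=.
by apply: ler_sum => i _; rewrite subSS ler_piMl ?hseq_ge0 // lern1 leq_b1.
Qed.

End LevelSeries.

(** * The complex exponential *)

Section RealTaylor.
Variable R : realType.
Implicit Types (x y C : R).

(** Mean value theorem. The factor 1/(n + 1) that integration would give is dropped, so the constant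
    stays the same along the chain of estimates. *)
Lemma taylor_step (g dg : R -> R) C (n : nat) : g 0 = 0 ->
  (forall x, is_derive x 1 g (dg x)) ->
  (forall x, `|x| <= 1 -> `|dg x| <= C * `|x| ^+ n) ->
  forall x, `|x| <= 1 -> `|g x| <= C * `|x| ^+ n.+1.
Proof.
move=> g0 dgP dgC x x1.
have cg : continuous g.
  move=> y; apply: differentiable_continuous; apply/derivable1_diffP.
  by have [] := dgP y.
have C0 : 0 <= C.
  have := dgC 1; rewrite normr1 expr1n mulr1 => /(_ (lexx _)).
  exact: le_trans.
have key c : `|c| <= `|x| -> g x = dg c * x -> `|g x| <= C * `|x| ^+ n.+1.
  move=> cx ->; rewrite normrM exprSr mulrA ler_wpM2r //.
  apply: le_trans (dgC c (le_trans cx x1)) _.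
  by rewrite ler_wpM2l // lerXn2r.
have [x0|x0] := leP 0 x.
  have [c cI] := MVT_segment x0 (fun y _ => dgP y) (continuous_subspaceT cg).
  rewrite g0 !subr0; apply: key; move: cI; rewrite in_itv /= => /andP[c0 cx].
  by rewrite !ger0_norm.
have [c cI] := MVT_segment (ltW x0) (fun y _ => dgP y) (continuous_subspaceT cg).
rewrite g0 !sub0r mulrN => /oppr_inj; apply: key.
move: cI; rewrite in_itv /= => /andP[xc c0].
by rewrite !ler0_norm ?lerN2 // ltW.
Qed.

Lemma sin_taylor1 y : `|y| <= 1 -> `|sin y| <= `|y|.
Proof.
move=> y1; have := @taylor_step (@sin R) (@cos R) 1 0 (sin0 R) (@is_derive_sin R) _ y y1.
rewrite mul1r expr1; apply=> x _; rewrite expr0 mul1r ler_norml.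
by rewrite cos_geN1 cos_le1.
Qed.

Lemma cos_taylor1 y : `|y| <= 1 -> `|cos y - 1| <= `|y| ^+ 2.
Proof.
move=> y1; rewrite -[leRHS]mul1r.
apply: (@taylor_step (fun y => cos y - 1) (fun y => - sin y)) y1 => [|x|x x1].
- by rewrite cos0 subrr.
- by apply: is_derive_eq; rewrite subr0.
by rewrite normrN mul1r expr1 sin_taylor1.
Qed.

Lemma sin_taylor2 y : `|y| <= 1 -> `|sin y - y| <= `|y| ^+ 3.
Proof.
move=> y1; rewrite -[leRHS]mul1r.
apply: (@taylor_step (fun y => sin y - y) (fun y => cos y - 1)) y1 => [|x x1].
  by rewrite sin0 subrr.
by rewrite mul1r cos_taylor1.
Qed.

Lemma cos_taylor2 y : `|y| <= 1 -> `|cos y - 1 + y ^+ 2 / 2| <= `|y| ^+ 4.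
Proof.
move=> y1; rewrite -[leRHS]mul1r.
apply: (@taylor_step (fun y => cos y - 1 + y ^+ 2 / 2) (fun y => y - sin y)) y1 => [|x|x x1].
- by rewrite cos0 subrr add0r expr0n mul0r.
- apply: is_derive_eq; rewrite /GRing.scale /=; lra.
by rewrite mul1r distrC sin_taylor2.
Qed.

Lemma expR_taylor0 x : `|x| <= 1 -> `|expR x| <= expR 1.
Proof.
by rewrite ler_norml => /andP[_ x1]; rewrite ger0_norm ?expR_ge0 // ler_expR.
Qed.

Lemma expR_taylor1 x : `|x| <= 1 -> `|expR x - 1| <= expR 1 * `|x|.
Proof.
move=> x1; rewrite -[X in _ * X]expr1.
apply: (@taylor_step (fun x => expR x - 1) (fun x => expR x)) x1 => [|y|y y1].
- by rewrite expR0 subrr.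
- by apply: is_derive_eq; rewrite subr0.
by rewrite expr0 mulr1 expR_taylor0.
Qed.

Lemma expR_taylor2 x : `|x| <= 1 -> `|expR x - 1 - x| <= expR 1 * `|x| ^+ 2.
Proof.
apply: (@taylor_step (fun x => expR x - 1 - x) (fun x => expR x - 1)) => [|y|y y1].
- by rewrite expR0 !subrr.
- by apply: is_derive_eq; rewrite subr0.
by rewrite expr1 expR_taylor1.
Qed.

Lemma expR_taylor3 x : `|x| <= 1 -> `|expR x - 1 - x - x ^+ 2 / 2| <= expR 1 * `|x| ^+ 3.
Proof.
apply: (@taylor_step (fun x => expR x - 1 - x - x ^+ 2 / 2) (fun x => expR x - 1 - x)) => [|y|y y1].
- by rewrite expR0 !subrr expr0n mul0r subr0.
- apply: is_derive_eq; rewrite /GRing.scale /=; lra.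
by rewrite expR_taylor2.
Qed.

End RealTaylor.

Section ComplexExp.
Variable R : realType.
Local Notation C := R[i].
Implicit Types (z w s p : C) (x y : R).

Lemma cexpE x y : cexp (x +i* y) = (expR x * cos y) +i* (expR x * sin y).
Proof. by rewrite /cexp /=; simpc. Qed.

Lemma cexpD z w : cexp (z + w) = cexp z * cexp w.
Proof.
case: z w => [a b] [c d]; rewrite !cexpE; simpc.
rewrite expRD cosD sinD; congr (_ +i* _); ring.
Qed.

Lemma cexp0 : cexp 0 = 1 :> C.
Proof. by rewrite cexpE expR0 cos0 sin0 mulr0 mulr1. Qed.

Lemma cexp_neq0 z : cexp z != 0.
Proof.
apply/eqP => z0; have : cexp z * cexp (- z) = 1 by rewrite -cexpD subrr cexp0.
by rewrite z0 mul0r => /eqP; rewrite eq_sym oner_eq0.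
Qed.

Lemma norm_cexp z : `|cexp z| = (expR (complex.Re z))%:C.
Proof.
case: z => a b; rewrite cexpE normc_def /=; congr (_%:C).
by rewrite !exprMn -mulrDr cos2Dsin2 mulr1 sqrtr_sqr ger0_norm ?expR_ge0.
Qed.

Lemma cexpR x : cexp x%:C = (expR x)%:C :> C.
Proof. by rewrite cexpE cos0 sin0 mulr1 mulr0. Qed.

Lemma cexpMn z n : cexp (z *+ n) = cexp z ^+ n.
Proof. by elim: n => [|n IH]; rewrite ?mulr0n ?cexp0 // mulrS cexpD IH exprS. Qed.

Lemma norm_le_ReIm z : `|z| <= (`|complex.Re z| + `|complex.Im z|)%:C.
Proof.
rewrite {1}[z]complexE; case: z => a b /=.
apply: le_trans (ler_normD _ _) _.
rewrite rmorphD /= normrM !normc_def /=.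
by rewrite !expr0n /= !expr1n !addr0 !add0r !sqrtr_sqr sqrtr1 mul1r lexx.
Qed.

Lemma Re_le_norm z : `|complex.Re z|%:C <= `|z|.
Proof. exact: normc_ge_Re. Qed.

Lemma Im_le_norm z : `|complex.Im z|%:C <= `|z|.
Proof.
by case: z => a b; rewrite normc_def /= lecR -[leLHS]sqrtr_sqr ler_wsqrtr // lerDr sqr_ge0.

Qed.

(** The real part of the remainder splits into three products of real remainders and the imaginary
    part into two, each at most e |z|^3; hence the constant 5 e. *)
Lemma cexp_taylor z : `|z| <= 1 ->
  `|cexp z - 1 - z - z ^+ 2 / 2| <= (5 * expR 1)%:C * `|z| ^+ 3.
Proof.
move=> z1; have [r rE] : exists r, `|z| = r%:C by case: (z) => a b; eexists; rewrite normc_def.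
have r0 : 0 <= r by rewrite -ler0c -rE normr_ge0.
have := Re_le_norm z; have := Im_le_norm z; rewrite rE !lecR.
move: z1; rewrite rE -[X in _ <= X]/(1%:C) lecR => r1.
case: z {rE} => a b /= bb aa.
have a1 := le_trans aa r1; have b1 := le_trans bb r1.
have pw n : `|a| ^+ n <= r ^+ n /\ `|b| ^+ n <= r ^+ n by split; rewrite lerXn2r ?nnegrE.
have e1 : 1 <= expR 1 :> R by rewrite -(expR0 R) ler_expR.
have half : (2 : C)^-1 = (2^-1)%:C by rewrite fmorphV rmorph_nat.
have cE : cexp (a +i* b) - 1 - (a +i* b) - (a +i* b) ^+ 2 / 2 =
  ((expR a - 1 - a - a ^+ 2 / 2) + expR a * (cos b - 1 + b ^+ 2 / 2)
    - (expR a - 1) * (b ^+ 2 / 2)) +i*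
  (expR a * (sin b - b) + b * (expR a - 1 - a)).
  rewrite half cexpE expr2 -[1]/(1 +i* 0); simpc.
  by apply/eqP; rewrite eq_complex /=; apply/andP; split; apply/eqP; field.
rewrite cE; apply: le_trans (norm_le_ReIm _) _.
rewrite -[r%:C ^+ 3]rmorphXn -rmorphM lecR.
rewrite /=.
have c0 := expR_taylor0 a1; have c1 := expR_taylor1 a1.
have c2 := expR_taylor2 a1; have c3 := expR_taylor3 a1.
have s2 := sin_taylor2 b1; have k2 := cos_taylor2 b1.
have E0 : 0 <= expR 1 :> R := expR_ge0 1.
have r4 : r ^+ 4 <= r ^+ 3 by rewrite exprS ler_piMl ?exprn_ge0.
have -> : 5 * expR 1 * r ^+ 3 = (expR 1 * r ^+ 3 + expR 1 * r ^+ 3 + expR 1 * r ^+ 3)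
  + (expR 1 * r ^+ 3 + expR 1 * r ^+ 3) by ring.
apply: lerD; [apply: le_trans (ler_normB _ _) _; apply: lerD|apply: le_trans (ler_normD _ _) _; apply: lerD].
- apply: le_trans (ler_normD _ _) _; apply: lerD.
    by apply: le_trans c3 _; rewrite ler_wpM2l // (pw 3).1.
  rewrite normrM; apply: ler_pM => //.
  by apply: le_trans k2 _; apply: le_trans r4; exact: (pw 4).2.
- have -> : expR 1 * r ^+ 3 = (expR 1 * r) * r ^+ 2 :> R by ring.
  rewrite normrM; apply: ler_pM => //.
    by apply: le_trans c1 _; rewrite ler_wpM2l.
  rewrite normrM normrX (@ger0_norm _ (2^-1)) ?invr_ge0 // -[leRHS]mulr1.
  by apply: ler_pM => //; [exact: (pw 2).2|rewrite invf_le1 ?ler1n].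
- rewrite normrM; apply: ler_pM => //.
  by apply: le_trans s2 _; exact: (pw 3).2.
have -> : expR 1 * r ^+ 3 = r * (expR 1 * r ^+ 2) :> R by ring.
rewrite normrM; apply: ler_pM => //.
by apply: le_trans c2 _; rewrite ler_wpM2l // (pw 2).1.
Qed.

End ComplexExp.

(** * Complex differentiability and poles *)

Section Holomorphic.
Variable R : realType.
Local Notation C := (R[i]^o).
Implicit Types (l p s h : C) (P Q : {poly R[i]}).

Lemma cexp_taylor1 (z : R[i]) : `|z| <= 1 ->
  `|cexp z - 1 - z| <= (5 * expR 1 + 1)%:C * `|z| ^+ 2.
Proof.
move=> z1; have -> : cexp z - 1 - z = (cexp z - 1 - z - z ^+ 2 / 2) + z ^+ 2 / 2.
  by rewrite subrK.
have E0 : (0 : R[i]) <= (5 * expR 1)%:C by rewrite ler0c mulr_ge0 ?expR_ge0.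
apply: le_trans (ler_normD _ _) _; rewrite rmorphD mulrDl; apply: lerD.
  apply: le_trans (cexp_taylor z1) _; rewrite ler_wpM2l //.
  by rewrite exprS ler_piMl ?exprn_ge0.
rewrite normrM normrX normfV normr_nat mulrC ler_wpM2r ?exprn_ge0 //.
by rewrite invf_le1 ?ler1n ?ltr0n.
Qed.

(** Converts the explicit estimates for the exponential into complex derivatives. *)
Lemma derivable_taylor (f : C -> C) (a D M delta : C) : 0 < delta ->
  (forall h, `|h| <= delta -> `|f (a + h) - f a - D * h| <= M * `|h| ^+ 2) ->
  derivable f a 1.
Proof.
move=> d0 fM; apply/cvg_ex; exists D; apply/cvgrPdist_le => e e0.
have M0 : 0 <= M.
  have := fM delta; rewrite gtr0_norm // lexx => /(_ isT) dM.
  by have := le_trans (normr_ge0 _) dM; rewrite pmulr_lge0 ?exprn_gt0.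
have M1 : 0 < M + 1 by rewrite ltr_wpDl.
near=> h.
have h0 : h != 0 by near: h; exact: nbhs_dnbhs_neq.
have hd : `|h| <= delta by near: h; exact: dnbhs0_le.
have he : `|h| <= e / (M + 1) by near: h; apply: dnbhs0_le; rewrite divr_gt0.
rewrite /= /shift /= [h *: 1]mulr1 [h + a]addrC distrC.
have -> : h^-1 *: (f (a + h) - f a) - D = h^-1 * (f (a + h) - f a - D * h).
  by rewrite /GRing.scale /= [RHS]mulrBr; congr (_ - _); rewrite mulrCA mulVf ?mulr1.
rewrite normrM normfV mulrC ler_pdivrMr ?normr_gt0 //.
apply: le_trans (fM h hd) _; rewrite expr2 mulrA ler_wpM2r //.
move: he; rewrite ler_pdivlMr // => he; apply: le_trans he.
by rewrite mulrC ler_wpM2l // lerDl.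
Unshelve. all: by end_near. Qed.

Lemma derivable_cexpM l s : derivable (fun x : C => cexp (l * x) : C) s 1.
Proof.
(* This radius ensures |l h| <= 1, as the Taylor estimate requires, and makes sense for l = 0
   too. *)
have l1 : 0 < (1 + `|l|)^-1 :> C by rewrite invr_gt0 ltr_pwDl.
apply: (@derivable_taylor _ _ (cexp (l * s) * l)
  (`|cexp (l * s)| * ((5 * expR 1 + 1)%:C * `|l| ^+ 2)) _ l1) => h hl.
have lh : `|l * h| <= 1.
  rewrite normrM; have l2 : 0 < 1 + `|l| by rewrite -invr_gt0.
  move: hl; rewrite -[X in _ <= X]mul1r ler_pdivlMr // => /(le_trans _); apply.
  by rewrite mulrC ler_wpM2l // lerDr.
have -> : cexp (l * (s + h)) - cexp (l * s) - cexp (l * s) * l * h =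
  cexp (l * s) * (cexp (l * h) - 1 - l * h) by rewrite mulrDr cexpD; ring.
rewrite normrM -mulrA ler_wpM2l // -mulrA -exprMn -normrM.
exact: cexp_taylor1.
Qed.

Lemma nbhs_neq (a b : C) : a != b -> \forall x \near nbhs a, x != b.
Proof.
move=> ab; have r0 : 0 < `|a - b| by rewrite normr_gt0 subr_eq0.
near=> x.
have : `|a - x| < `|a - b|.
  near: x; have /cvgrPdist_lt : (x @[x --> a] --> (a : C)) by exact: cvg_id.
  by apply.
by apply: contraTneq => ->; rewrite ltxx.
Unshelve. all: by end_near. Qed.

(* The removable singularity at p is filled in. *)
Definition expquot l p s : C :=
  if s == p then l else (cexp (l * s - l * p) - 1) / (s - p).

Lemma cexp_expquot l p s :
  cexp (l * s) - cexp (l * p) = cexp (l * p) * expquot l p s * (s - p).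
Proof.
rewrite /expquot; case: eqP => [->|/eqP sp]; first by rewrite !subrr mulr0.
rewrite -mulrA divfK ?subr_eq0 // mulrBr mulr1 -cexpD; congr (cexp _ - _); ring.
Qed.

(** At p the derivative is l^2 / 2: dividing by s - p costs one order, which is why the exponential
    is needed up to a cubic remainder. Elsewhere the function is locally an ordinary quotient. *)
Lemma derivable_expquot l p s : derivable (expquot l p) s 1.
Proof.
have [->|sp] := eqVneq s p.
  have l1 : 0 < (1 + `|l|)^-1 :> C by rewrite invr_gt0 ltr_pwDl.
  apply: (@derivable_taylor _ _ (l ^+ 2 / 2)
    ((5 * expR 1)%:C * `|l| ^+ 3) _ l1) => h hl.
  have lh : `|l * h| <= 1.
    rewrite normrM; have l2 : 0 < 1 + `|l| by rewrite -invr_gt0.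
    move: hl; rewrite -[X in _ <= X]mul1r ler_pdivlMr // => /(le_trans _); apply.
    by rewrite mulrC ler_wpM2l // lerDr.
  have ph : (p + h == p) = (h == 0) by rewrite -subr_eq0 addrAC subrr add0r.
  rewrite /expquot eqxx ph.
  have [->|h0] := eqVneq h 0.
    by rewrite subrr sub0r mulr0 oppr0 normr0 expr0n mulr0.
  have -> : (cexp (l * (p + h) - l * p) - 1) / (p + h - p) - l - l ^+ 2 / 2 * h =
    (cexp (l * h) - 1 - l * h - (l * h) ^+ 2 / 2) / h.
    have -> : p + h - p = h by rewrite addrAC subrr add0r.
    have -> : l * (p + h) - l * p = l * h by rewrite -mulrBr addrAC subrr add0r.
    move: (cexp _ : R[i]) => c; rewrite !mulrBl exprMn [l * h / h]mulfK //.
    by congr (_ - _); rewrite mulrAC -[RHS]mulrA [2^-1 / h]mulrC mulrA expr2 mulrA mulfK // mulrAC.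
  rewrite normrM normfV ler_pdivrMr ?normr_gt0 //.
  by apply: le_trans (cexp_taylor lh) _; rewrite normrM exprMn mulrA -[_ * `|h|]mulrA -exprSr.
apply: (@near_eq_derivable _ _ _
  ((fun x : C => cexp (l * x) * cexp (- (l * p)) - 1 : C) * (fun x : C => (x - p)^-1))).
  near=> x; rewrite /expquot /= ifN ?cexpD //.
  by near: x; exact: nbhs_neq.
have dE := @derivableM _ _ _ _ _ _ (@derivable_cexpM l s)
  (derivable_cst (cexp (- (l * p)) : C) s 1).
have dN : derivable (fun x : C => x - p) s 1 :=
  derivableB (@derivable_id _ _ s 1) (derivable_cst p s 1).
apply: (derivableM (derivableB dE (derivable_cst (1 : C) s 1))).
by apply: (derivableV _ dN); rewrite subr_eq0.
Unshelve. all: by end_near. Qed.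

Lemma derivable_horner_comp P (u : C -> C) s :
  derivable u s 1 -> derivable (fun x : C => P.[u x] : C) s 1.
Proof.
move=> du; elim/poly_ind: P => [|P c IH].
  rewrite (_ : (fun _ => _) = cst (0 : C)); first exact: derivable_cst.
  by apply/funext => x; rewrite horner0.
pose f (x : C) : C := P.[u x].
have -> : (fun x : C => (P * 'X + c%:P).[u x] : C) = (f * u) + cst (c : C).
  by apply/funext => x; rewrite hornerMXaddC.
have df : derivable (f * u) s 1 := derivableM IH du.
exact: (derivableD df (derivable_cst (c : C) s 1)).
Qed.

Lemma derivable_mul (f g : C -> C) s : derivable f s 1 -> derivable g s 1 ->
  derivable (fun x : C => f x * g x : C) s 1.
Proof. exact: derivableM. Qed.

Lemma derivable_expn (f : C -> C) s m :
  derivable f s 1 -> derivable (fun x : C => f x ^+ m : C) s 1.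
Proof.
move=> df; elim: m => [|m IH]; first exact: (derivable_cst (1 : C)).
have -> : (fun x : C => f x ^+ m.+1 : C) = f * (fun x : C => f x ^+ m : C).
  by apply/funext => x; rewrite exprS.
exact: (derivableM df IH).
Qed.

Lemma derivable_continuous (f : C -> C) s : derivable f s 1 -> {for s, continuous f}.
Proof. by move=> /derivable1_diffP; exact: differentiable_continuous. Qed.

(** The factor u(s) - u(p) equals u(p) [expquot l p s] (s - p), so m zeros of the denominator in u
    become exactly m zeros in s. The value u(p) l of the quotient at p is u'(p), whence its power in
    [h p]. *)
Lemma pole_form l p P Q1 m : l != 0 -> Q1.[cexp (l * p)] != 0 ->
  exists h : R[i] -> R[i],
  [/\ holomorphic_at h p, h p = P.[cexp (l * p)] / (Q1.[cexp (l * p)] * (cexp (l * p) * l) ^+ m)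
   & forall s, P.[cexp (l * s)] / (Q1 * ('X - (cexp (l * p))%:P) ^+ m).[cexp (l * s)] =
     h s / (s - p) ^+ m].
Proof.
move=> l0 Q0; pose u (s : C) : C := cexp (l * s).
have du s : derivable u s 1 := @derivable_cexpM l s.
pose f (x : C) : C := Q1.[u x].
pose g (x : C) : C := (u p * expquot l p x) ^+ m.
pose den (x : C) : C := f x * g x.
pose fP (x : C) : C := P.[u x].
pose iden (x : C) : C := (den x)^-1.
exists (fun x : C => fP x * iden x : C); split.
- have dden (s : C) : derivable den s 1.
    apply: derivable_mul; first exact: derivable_horner_comp.
    apply: derivable_expn; apply: (derivable_mul (derivable_cst (u p) s 1)).
    exact: derivable_expquot.
  have : \forall s \near nbhs (p : C), den s != 0.
    apply: (derivable_continuous (dden p) (nbhs_neq _)).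
    rewrite /den /f /g /= mulf_neq0 // expf_neq0 // mulf_neq0 //; first exact: cexp_neq0.
    by rewrite /expquot eqxx.
  apply: filterS => s ds.
  apply: derivable_mul; first exact: derivable_horner_comp.
  exact: derivableV.
- by rewrite /fP /iden /den /f /g /expquot eqxx.
move=> s; rewrite hornerM horner_exp hornerXsubC cexp_expquot.
rewrite /fP /iden /den /f /g exprMn mulrA invfM mulrA.
by rewrite /u.
Qed.

Lemma meromorphic_exp_quotient l P Q : l != 0 -> Q != 0 ->
  meromorphic (fun s => P.[cexp (l * s)] / Q.[cexp (l * s)]).
Proof.
move=> l0 Q0 p; have [m [Q1 nQ ->]] := multiplicity_XsubC Q (cexp (l * p)).
rewrite Q0 in nQ; have [h [hp _ hE]] := pole_form P m l0 nQ.
by exists m, h; split => //; near=> s; exact: hE.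
Unshelve. all: by end_near. Qed.

End Holomorphic.

(** * Rational generating series *)

Section Rational.
Variable K : fieldType.
Implicit Types (P Q : {poly K}) (f g : power_series K) (x L : K).

Definition ps_poly P : power_series K := PowerSeries (fun n => P`_n).

Lemma ps_poly0 : ps_poly 0 = 0.
Proof. by apply: psP => n /=; rewrite coef0 if_same. Qed.

Lemma ps_polyD P Q : ps_poly (P + Q) = ps_poly P + ps_poly Q.
Proof. by apply: psP => n /=; rewrite coefD. Qed.

Lemma ps_polyM P Q : ps_poly (P * Q) = ps_poly P * ps_poly Q.
Proof. by apply: psP => n /=; rewrite coefM. Qed.

Lemma ps_poly_eq0 P : (ps_poly P == 0) = (P == 0).
Proof.
apply/eqP/eqP => [P0|->]; last exact: ps_poly0.
by apply/polyP => i; rewrite coef0 -[LHS]/(pscoef (ps_poly P) i) P0 /= if_same.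
Qed.

(* f is the expansion of a fraction that is regular at x with value L. *)
Definition frac_at f x L := exists P Q : {poly K},
  [/\ Q.[x] != 0, P.[x] = L * Q.[x] & ps_poly Q * f = ps_poly P].

Lemma frac_at_poly P x : frac_at (ps_poly P) x P.[x].
Proof.
exists P, 1; rewrite hornerC oner_neq0 mulr1; split=> //.
by rewrite -ps_polyM mul1r.
Qed.

Lemma frac_atD f g x L M : frac_at f x L -> frac_at g x M -> frac_at (f + g) x (L + M).
Proof.
move=> [P [Q [Qx Px QP]]] [P' [Q' [Qx' Px' QP']]].
exists (P * Q' + P' * Q), (Q * Q'); rewrite !(hornerM, hornerD) mulf_neq0 //; split=> //.
  by rewrite Px Px' mulrDl !mulrA [M * _ * _]mulrAC.
rewrite ps_polyD !ps_polyM mulrDr; congr (_ + _).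
  by rewrite -QP mulrAC.
by rewrite -QP' -mulrA mulrC.
Qed.

Lemma frac_at_sum I (r : seq I) (p : pred I) (F : I -> power_series K) x (l : I -> K) :
  (forall i, p i -> frac_at (F i) x (l i)) ->
  frac_at (\sum_(i <- r | p i) F i) x (\sum_(i <- r | p i) l i).
Proof.
move=> H; elim/big_ind2: _ => //; last by move=> *; exact: frac_atD.
by have := frac_at_poly 0 x; rewrite ps_poly0 horner0.
Qed.

Lemma frac_at_div D f x L : D.[x] != 0 -> frac_at (ps_poly D * f) x L ->
  frac_at f x (L / D.[x]).
Proof.
move=> Dx [P [Q [Qx Px QP]]]; exists P, (Q * D); split; rewrite ?hornerM ?mulf_neq0 //.
  by rewrite Px; field.
by rewrite ps_polyM -mulrA.
Qed.

Lemma coprime_recurrence f P Q : Q != 0 -> ps_poly Q * f = ps_poly P ->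
  exists D P1 Q1, [/\ D != 0, P = P1 * D, Q = Q1 * D, coprimep P1 Q1
    & ps_poly Q1 * f = ps_poly P1].
Proof.
move=> Q0 QP; pose D := gcdp P Q.
have D0 : D != 0 by rewrite gcdp_eq0 negb_and Q0 orbT.
have PE : P = P %/ D * D by rewrite divpK // dvdp_gcdl.
have QE : Q = Q %/ D * D by rewrite divpK // dvdp_gcdr.
exists D, (P %/ D), (Q %/ D); split=> //.
  by rewrite coprimep_div_gcd // Q0 orbT.
move: QP; rewrite {1}QE {1}PE !ps_polyM mulrAC => /mulIf; apply.
by rewrite ps_poly_eq0.
Qed.

(** The fraction of (1 - X) f is nonzero at 1, so exactly one factor X - 1 survives in the reduced
    denominator of f; rewriting 1 - X as -(X - 1) gives the sign of L. Coprimality is retained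
    because it later excludes zeros of the denominator where the series converges. *)
Lemma simple_pole_reduce f L : L != 0 -> frac_at (ps_poly (1 - 'X) * f) 1 L ->
  exists P Q : {poly K}, [/\ coprimep P (Q * ('X - 1)), Q.[1] != 0,
    P.[1] = - L * Q.[1] & ps_poly (Q * ('X - 1)) * f = ps_poly P].
Proof.
move=> L0 [P [Q [Qx Px QP]]].
have Q0 : Q != 0 by apply: contraNneq Qx => ->; rewrite horner0.
have X0 : 1 - 'X != 0 :> {poly K}.
  by rewrite subr_eq0 eq_sym -subr_eq0 -[1]/(1%:P) polyXsubC_eq0.
rewrite mulrA -ps_polyM in QP.
have [D [P1 [Q1 [D0 PE QE cop QP1]]]] := coprime_recurrence (mulf_neq0 Q0 X0) QP.
(* As L != 0, the common factor does not vanish at the pole. *)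
have D1 : D.[1] != 0.
  apply: contraNneq (mulf_neq0 L0 Qx) => D1.
  by rewrite -Px PE hornerM D1 mulr0.
have /factor_theorem[Q2 Q2E] : root Q1 1.
  move/(congr1 (horner^~ 1)): QE; rewrite !hornerM !hornerE subrr mulr0 => /esym/eqP.
  by rewrite mulf_eq0 (negPf D1) orbF.
have QE2 : Q = - (Q2 * D).
  by apply: (mulIf X0); rewrite QE Q2E mulNr -mulrN opprB mulrAC polyC1.
move: Qx Px; rewrite QE2 PE hornerN !hornerM oppr_eq0 mulf_eq0 negb_or => /andP[Q21 _] Px.
exists P1, Q2; rewrite (_ : 'X - 1 = 'X - 1%:P) // -Q2E; split=> //.
by apply: (mulIf D1); rewrite Px; ring.
Qed.

End Rational.

(** * Values of fractions and sums of convergent series *)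

Section Summation.
Variable K : numFieldType.
Local Notation C := (K^o).
Implicit Types (a : nat -> K) (v L : K) (P Q : {poly K}).

Definition psum a v (N : nat) : C := \sum_(m < N) a m * v ^+ m.

Lemma psum_poly P v N : (size P <= N)%N -> psum (fun i => P`_i) v N = P.[v].
Proof. by move=> PN; rewrite (horner_coef_wide _ PN). Qed.

Lemma conv_mulX_poly Q a c N : conv (fun i => (Q * 'X + c%:P)`_i) a N =
  c * a N + (if N is N'.+1 then conv (fun i => Q`_i) a N' else 0).
Proof.
rewrite /conv big_ord_recl subn0 coefD coefMX coefC /= add0r; congr (_ + _).
case: N => [|N]; first by rewrite big_ord0.
by apply: eq_bigr => i _; rewrite coefD coefMX coefC /= addr0 subSS.
Qed.

(** One factor is a polynomial, so induction on it replaces a Cauchy product theorem, and plain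
    convergence suffices. *)
Lemma psum_conv Q a v L : psum a v @ \oo --> (L : C) ->
  psum (conv (fun i => Q`_i) a) v @ \oo --> (Q.[v] * L : C).
Proof.
move=> aL; elim/poly_ind: Q => [|Q c IH].
  rewrite horner0 mul0r (_ : psum _ v = cst 0); first exact: cvg_cst.
  apply/funext => N; rewrite /psum big1 // => m _.
  by rewrite /conv big1 ?mul0r // => i _; rewrite coef0 mul0r.
rewrite -cvg_shiftS /=.
have -> : (fun N => psum (conv (fun i => (Q * 'X + c%:P)`_i) a) v N.+1) =
    (fun N => c * psum a v N.+1 + v * psum (conv (fun i => Q`_i) a) v N).
  apply/funext => N; rewrite {1}/psum.
  under eq_bigr do rewrite conv_mulX_poly mulrDl.
  rewrite big_split /=; congr (_ + _).
    by rewrite /psum mulr_sumr; apply: eq_bigr => i _; rewrite mulrA.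
  rewrite big_ord_recl mul0r add0r /psum mulr_sumr; apply: eq_bigr => i _.
  by rewrite /= exprS mulrCA.
rewrite hornerMXaddC mulrDl addrC [Q.[v] * v]mulrC -mulrA.
apply: cvgD; first by apply: cvgMl_tmp; move: aL; rewrite -cvg_shiftS.
exact: cvgMl_tmp.
Qed.

(** Stated without division, so that it also applies at a zero of [Q] and shows that [P] vanishes
    there. *)
Lemma psum_recurrence P Q a v L :
  (forall N, conv (fun i => Q`_i) a N = P`_N) ->
  psum a v @ \oo --> (L : C) -> Q.[v] * L = P.[v].
Proof.
move=> QP /(@psum_conv Q) H; apply: (cvg_unique (@norm_hausdorff _ _) H).
have -> : psum (conv (fun i => Q`_i) a) v = psum (fun i => P`_i) v.
  by apply/funext => N; apply: eq_bigr => m _; rewrite QP.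
apply: cvg_near_cst; near=> N; apply: psum_poly; near: N.
exact: nbhs_infty_ge.
Unshelve. all: by end_near. Qed.

(** In lowest terms a zero of the denominator at 1 would, by [psum_recurrence], be a zero of the
    numerator too. *)
Lemma frac_at_summable a L : ratseq a -> psum a 1 @ \oo --> (L : C) ->
  frac_at (PowerSeries a) 1 L.
Proof.
move=> /ratseq_recurrence[P [Q [Q0 QP]]] aL.
have QPs : ps_poly Q * PowerSeries a = ps_poly P by exact: psP.
have [D [P1 [Q1 [_ _ _ cop QP1]]]] := coprime_recurrence Q0 QPs.
have QP1' N : conv (fun i => Q1`_i) a N = P1`_N.
  by have := congr1 (fun f => pscoef f N) QP1.
have PL := psum_recurrence QP1' aL.
exists P1, Q1; split=> //; last by rewrite -PL mulrC.
apply/eqP => Q1x; rewrite coprimep_sym in cop.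
have := coprimep_root cop (introT eqP Q1x).
by rewrite -PL Q1x mul0r eqxx.
Qed.

End Summation.

(** * The pole of the generating series at v = 1 *)

Section HeightSeries.
Variables (R : realType) (d' q : nat).
Hypothesis q1 : (1 < q)%N.
Local Notation d := d'.+1.
Implicit Types (j : 'I_d).

Definition hsum j : R := limn (psum (hseq R q j) 1).

Lemma hsum_cvg j : (0 < j)%N -> psum (hseq R q j) 1 @ \oo --> (hsum j : R^o).
Proof.
move=> j0; have [M hM] := sum_hseq_bounded R q1 j0.
have pE N : psum (hseq R q j) 1 N = \sum_(m < N) hseq R q j m.
  by apply: eq_bigr => m _; rewrite expr1n mulr1.
apply: (@nondecreasing_is_cvgn R).
  apply/nondecreasing_seqP => n; rewrite !pE big_ord_recr /= lerDl.
  exact: hseq_ge0.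
by exists M => _ [N _ <-]; rewrite pE.
Qed.

Lemma esum_zweight_hsum j : (0 < j)%N ->
  \esum_(z in [set: {ffun idx j -> nat}]) (zweight R q z)%:E = (hsum j)%:E.
Proof.
move=> j0; rewrite esum_zweight // /hsum -EFin_lim; last first.
  by apply: cvgP; exact: hsum_cvg.
congr (limn _); apply/funext => N /=.
rewrite -sumEFin big_mkord; apply: eq_bigr => m _.
by rewrite expr1n mulr1.
Qed.

Lemma hsum_gt0 j : (0 < j)%N -> 0 < hsum j.
Proof.
move=> j0; rewrite -lte_fin -esum_zweight_hsum //.
pose z0 : {ffun idx j -> nat} := [ffun=> 0%N].
apply: (@lt_le_trans _ _ (zweight R q z0)%:E); first by rewrite lte_fin zweight_gt0.
apply: esum_ge; exists [set z0]; last by rewrite fsbig_set1.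
by split; [exact: finite_set1|].
Qed.

Definition step j := (j * (d - j))%N.

(* The value at v = 1 of (1 - v) \sum_m bseq m v^m. *)
Definition residue_sum : R := \sum_(j < d | (0 < j)%N) (step j)%:R^-1 * hsum j.

Lemma residue_sum_gt0 : (0 < d')%N -> 0 < residue_sum.
Proof.
(* The hypothesis d >= 2 supplies the index j = 1, so the sum is not empty. *)
move=> d0; pose j1 : 'I_d := inord 1.
have j1E : val j1 = 1%N by rewrite /= inordK.
rewrite /residue_sum (bigD1 j1) ?j1E //= ltr_wpDr //.
  apply: sumr_ge0 => j /andP[j0 _]; rewrite mulr_ge0 ?invr_ge0 //.
  exact: ltW (hsum_gt0 j0).
rewrite mulr_gt0 ?invr_gt0 ?ltr0n ?hsum_gt0 ?j1E //.
by rewrite step_gt0 ?j1E.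
Qed.

Lemma ps_bjseq j : (0 < j)%N ->
  ps_poly (1 - 'X^(step j)) * PowerSeries (bjseq R q j) = PowerSeries (hseq R q j).
Proof.
move=> j0; have -> : ps_poly (1 - 'X^(step j)) = 1 - ps_poly ('X^(step j) : {poly R}).
  by apply: psP => n /=; rewrite coefB coef1 coefXn; case: eqP.
rewrite mulrBl mul1r; apply: psP => n /=; rewrite [in LHS](bjseq_rec _ q1) //.
apply/eqP; rewrite subr_eq addrC; apply/eqP; rewrite [RHS]addrC; congr (_ + _).
under eq_bigr do rewrite coefXn.
case: ifP => [sn|/negbT sn]; last first.
  rewrite big1 // => i _; case: eqP => [iE|_]; last by rewrite mul0r.
  by case/negP: sn; rewrite -/(step j) -iE -ltnS.
rewrite (bigD1 (Ordinal (sn : (step j < n.+1)%N))) //= eqxx mul1r big1 ?addr0 // => i.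
by rewrite -val_eqE /= => /negPf->; rewrite mul0r.
Qed.

Lemma ps_bseq : PowerSeries (bseq R d' q) =
  psC (Cconst R q (finset.set0 : {set 'I_d})) +
  \sum_(j < d | (0 < j)%N) PowerSeries (bjseq R q j).
Proof.
have psum_coef (I : Type) (r : seq I) (p : pred I) (F : I -> power_series R) n :
    pscoef (\sum_(i <- r | p i) F i) n = \sum_(i <- r | p i) pscoef (F i) n.
  by apply: (big_morph (fun f => pscoef f n)) => //=; rewrite if_same.
apply: psP => n; rewrite /= psum_coef /bseq.
by case: eqP; rewrite ?mul1r ?mul0r.
Qed.

(** Since 1 - X^e is (1 - X)(1 + ... + X^(e-1)) and the second factor is e at 1, the piece of jump j
    contributes [hsum j] divided by e = j (d - j). The term of n = 0 is a constant and is killed by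
    1 - X. *)
Lemma frac_at_bseq :
  frac_at (ps_poly (1 - 'X) * PowerSeries (bseq R d' q)) 1 residue_sum.
Proof.
rewrite ps_bseq mulrDr mulr_sumr -[residue_sum]add0r; apply: frac_atD.
  have -> : psC (Cconst R q (finset.set0 : {set 'I_d})) =
      ps_poly (Cconst R q (finset.set0 : {set 'I_d}))%:P.
    by apply: psP => n /=; rewrite coefC.
  rewrite -ps_polyM; set P := _ * _.
  have -> : 0 = P.[1] by rewrite /P hornerM hornerD hornerN hornerX (hornerC 1) subrr mul0r.
  exact: frac_at_poly.
apply: frac_at_sum => j j0.
have e1 : (\sum_(i < step j) 'X^i : {poly R}).[1] = (step j)%:R.
  rewrite horner_sum; under eq_bigr do rewrite hornerXn expr1n.
  by rewrite sumr_const card_ord.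
have e0 : (step j)%:R != 0 :> R by rewrite pnatr_eq0 -lt0n step_gt0.
rewrite [_^-1 * _]mulrC -e1; apply: frac_at_div; first by rewrite e1.
have eX : (\sum_(i < step j) 'X^i) * (1 - 'X) = 1 - 'X^(step j) :> {poly R}.
  by rewrite -[1 - 'X]opprB mulrN mulrC -subrX1 opprB.
rewrite mulrA -ps_polyM eX ps_bjseq //.
by apply: frac_at_summable; [exact: hseq_ratseq|exact: hsum_cvg].
Qed.

Lemma bseq_bounded : exists2 M : R, 0 <= M & forall m, bseq R d' q m <= M.
Proof.
have [M hM] : exists M : 'I_d -> R, forall j, (0 < j)%N -> forall m, bjseq R q j m <= M j.
  have /choice[M hM] : forall j, exists M : R, (0 < j)%N -> forall m, bjseq R q j m <= M.
    move=> j; have [jn|j0] := leqP j 0; first by exists 0.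
    by have [M hM] := bjseq_bounded R q1 j0; exists M.
  by exists M.
pose B := Cconst R q (finset.set0 : {set 'I_d}) + \sum_(j < d | (0 < j)%N) M j.
have C0 := Cconst_gt0 R q1 (finset.set0 : {set 'I_d}).
have bB m : bseq R d' q m <= B.
  rewrite /bseq lerD // ?ler_sum //; last by move=> j j0; exact: hM.
  by case: eqP; rewrite ?mul1r ?mul0r // ltW.
by exists B => //; exact: le_trans (bseq_ge0 R d' q1 0) (bB 0%N).
Qed.

Lemma bseq_cvg (x : R) : 0 <= x < 1 -> cvgn (psum (bseq R d' q) x : R^o ^nat).
Proof.
move=> /andP[x0 x1]; have [M M0 bM] := bseq_bounded.
apply: (@nondecreasing_is_cvgn R).
  apply/nondecreasing_seqP => n; rewrite /psum big_ord_recr /= lerDl.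
  by rewrite mulr_ge0 ?bseq_ge0 ?exprn_ge0.
exists (M / (1 - x)) => _ [N _ <-].
have H : \sum_(m < N) x ^+ m <= (1 - x)^-1.
  rewrite -[leRHS]mul1r ler_pdivlMr ?subr_gt0 // mulrC -opprB mulNr -subrX1 opprB.
  by rewrite gerBl exprn_ge0.
apply: le_trans (ler_wpM2l M0 H); rewrite mulr_sumr; apply: ler_sum => m _.
by rewrite ler_wpM2r ?exprn_ge0.
Qed.

(** A positive coefficient of the series for j = 1 is repeated with period [step j1] by the
    recurrence, so the partial sums grow linearly. *)
Lemma bseq_lower : (0 < d')%N -> exists2 e : R, 0 < e &
  forall T : nat, exists N, T%:R * e <= \sum_(m < N) bseq R d' q m.
Proof.
move=> d0; pose j1 : 'I_d := inord 1.
have j1E : val j1 = 1%N by rewrite /= inordK.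
have j0 : (0 < j1)%N by rewrite j1E.
have [m0 h0] : exists m0, 0 < hseq R q j1 m0.
  apply: contrapT => H; have := hsum_gt0 j0.
  have h0 m : hseq R q j1 m = 0.
    apply/eqP; rewrite eq_le hseq_ge0 // andbT leNgt; apply/negP => hm.
    by apply: H; exists m.
  have -> : hsum j1 = 0; last by rewrite ltxx.
  rewrite /hsum (_ : psum _ 1 = cst 0) ?lim_cst //.
  by apply/funext => N; rewrite /psum big1 // => m _; rewrite h0 mul0r.
exists (hseq R q j1 m0) => // T; exists (m0 + step j1 * T)%N.
have bj_ge t : hseq R q j1 m0 <= bjseq R q j1 (m0 + step j1 * t).
  elim: t => [|t IH].
    rewrite muln0 addn0 (bjseq_rec _ q1) // lerDl; case: ifP => // _.
    exact: bjseq_ge0.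
  rewrite (bjseq_rec _ q1) // -/(step j1) ifT; last by rewrite mulnS; lia.
  have -> : (m0 + step j1 * t.+1 - step j1 = m0 + step j1 * t)%N by rewrite mulnS; lia.
  by apply: le_trans IH _; rewrite lerDr hseq_ge0.
have b_ge t : hseq R q j1 m0 <= bseq R d' q (m0 + step j1 * t).
  apply: le_trans (bj_ge t) _; rewrite /bseq (bigD1 j1) //= addrCA lerDl addr_ge0 //.
    by rewrite mulr_ge0 // ltW // Cconst_gt0.
  by apply: sumr_ge0 => j _; exact: bjseq_ge0.
elim: T => [|T IH]; first by rewrite mul0r sumr_ge0 // => m _; rewrite bseq_ge0.
have st : (0 < step j1)%N by exact: step_gt0.
(* The range is cut just after the index m0 + [step j1] T, which provides the additional summand. *)
have -> : (m0 + step j1 * T.+1 = (m0 + step j1 * T).+1 + (step j1).-1)%N by rewrite mulnS; lia.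
rewrite big_split_ord /= -[leLHS]addr0 lerD //; last first.
  by apply: sumr_ge0 => m _; exact: bseq_ge0.
by rewrite big_ord_recr /= mulrSr mulrDl mul1r lerD.
Qed.

End HeightSeries.

(** * The height zeta function *)

Section Levels.
Variables (R : realType) (k : finFieldType) (d' : nat).
Local Notation d := d'.+1.
Local Notation q := #|k|.
Local Notation Yd := (Y k d).
Implicit Types (y : Yd) (s : R[i]) (m : nat).

Lemma card_gt1 : (1 < q)%N.
Proof. by rewrite -(ltr_nat R) q_gt1. Qed.

Definition level m : set Yd := @cls k d' @` [set n | nvec n /\ hexp n = m].

Lemma bigcup_level : \bigcup_m level m = [set: Yd].
Proof.
apply/seteqP; split=> // y _; have [n n0 <-] := cls_surj R y.
by exists (hexp n) => //; exists n.
Qed.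

Lemma trivIset_level : trivIset [set: nat] level.
Proof.
move=> m m' _ _ [y [[n [n0 nm] <-] [n' [n0' nm'] /(cls_inj R n0' n0) nn]]].
by rewrite -nm -nm' nn.
Qed.

Lemma measurable_Y (A : set Yd) : measurable A.
Proof. by []. Qed.

Definition level_mass m : R := bseq R d' q m / q%:R ^+ m.

Lemma level_mass_ge0 m : 0 <= level_mass m.
Proof. by rewrite divr_ge0 ?exprn_ge0 // bseq_ge0 // card_gt1. Qed.

Lemma nu_level m : nu R (level m) = (level_mass m)%:E.
Proof.
rewrite /nu (@reindex_esum R _ _ [set n | nvec n /\ hexp n = m] (level m) (@cls k d')).
  rewrite -(esum_nweight R d' card_gt1); apply: eq_esum => n [n0 _].
  by rewrite mass_cls.
split.
- by move=> n nP; exists n.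
- by move=> n n' /set_mem[n0 _] /set_mem[n0' _]; exact: (cls_inj R).
- by move=> y [n nP <-]; exists n.
Qed.

Lemma alpha_level m y : level m y -> alpha R y = q%:R `^ (m%:R / d%:R).
Proof. by move=> [n [_ <-] <-]; exact: alpha_cls. Qed.

Lemma ge0_integral_level (phi : nat -> R) (f : Yd -> R) :
  (forall m, 0 <= phi m) -> (forall m y, level m y -> f y = phi m) ->
  (\int[@nu k d R]_(y in [set: Yd]) (f y)%:E =
   \sum_(0 <= m <oo) (phi m * level_mass m)%:E)%E.
Proof.
move=> phi0 fphi; rewrite -bigcup_level.
rewrite (@ge0_integral_bigcup _ _ R (@nu k d R) level (fun y => (f y)%:E)) //.
- apply: eq_eseriesr => m _.
  rewrite (eq_integral (cst (phi m)%:E)) => [|y /set_mem ym]; last by rewrite /= (fphi m).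
  by rewrite EFinM -nu_level; exact: integral_cst.
- by move=> y [m _ ym]; rewrite lee_fin (fphi m).
exact: trivIset_level.
Qed.

(** Absolute convergence of the level series yields integrability, which a signed function needs to
    be integrated level by level. *)
Lemma integral_level (phi : nat -> R) (f : Yd -> R) :
  (forall m y, level m y -> f y = phi m) ->
  cvgn (series (fun m => `|phi m| * level_mass m)) ->
  series (fun m => phi m * level_mass m) @ \oo -->
    (\int[@nu k d R]_(y in [set: Yd]) f y : R).
Proof.
move=> fphi cv.
have cv' : cvgn (series (fun m => phi m * level_mass m)).
  apply: normed_cvg; have -> // : [normed series (fun m => phi m * level_mass m)] =
    series (fun m => `|phi m| * level_mass m).
  apply/funext => N; apply: eq_bigr => m _.
  by rewrite /= normrM (ger0_norm (level_mass_ge0 m)).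
have lim_sum (a : nat -> R) : cvgn (series a) ->
    (\sum_(0 <= m <oo) (a m)%:E)%E = (limn (series a))%:E.
  move=> ca; rewrite -EFin_lim //; congr (limn _).
  by apply/funext => N; rewrite /= sumEFin.
have int_f : (@nu k d R).-integrable [set: Yd] (fun y => (f y)%:E).
  apply/integrableP; split; first by move=> mD B mB; exact: measurable_Y.
  rewrite (eq_integral (fun y => (`|f y|)%:E)) //.
  rewrite (@ge0_integral_level (fun m => `|phi m|)) //; last first.
    by move=> m y ym; rewrite (fphi m).
  by rewrite lim_sum // ltry.
rewrite /Rintegral -bigcup_level integral_bigcup //; first last.
- by rewrite bigcup_level.
- exact: trivIset_level.
rewrite (_ : (\sum_(0 <= i <oo) _)%E = (\sum_(0 <= m <oo) (phi m * level_mass m)%:E)%E).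
  by rewrite lim_sum.
apply: eq_eseriesr => m _.
rewrite (eq_integral (cst (phi m)%:E)) => [|y /set_mem ym]; last by rewrite /= (fphi m).
by rewrite EFinM -nu_level; exact: integral_cst.
Qed.

Definition rate : R := ln q%:R / d%:R.

Lemma rate_gt0 : 0 < rate.
Proof. by rewrite divr_gt0 ?ltr0n // ln_gt0 // q_gt1. Qed.

Lemma cpow_rate s : cpow (q%:R : R) (s / d%:R) = cexp (rate%:C * s).
Proof. by rewrite /cpow /rate rmorphM fmorphV rmorph_nat; congr cexp; ring. Qed.

Lemma cpow_level m y s : level m y ->
  cpow (alpha R y) s = cexp (rate%:C * s) ^+ m.
Proof.
move=> /alpha_level ->; rewrite /cpow ln_powR -cexpMn /rate; congr cexp.
by rewrite !rmorphM !fmorphV !rmorph_nat -mulr_natr; ring.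
Qed.

(** The absolute value of v = q^(s/d) / q, as a real number. *)
Definition modulus s : R := expR (rate * complex.Re s) / q%:R.

Lemma norm_cexp_rate s : `|cexp (rate%:C * s)| = (expR (rate * complex.Re s))%:C.
Proof. by rewrite norm_cexp; case: s => a b /=; rewrite mul0r subr0. Qed.

Lemma modulus_ge0 s : 0 <= modulus s.
Proof. by rewrite divr_ge0 ?expR_ge0. Qed.

Lemma modulus_lt1 s : (modulus s < 1) = (complex.Re s < d%:R).
Proof.
have q0 : 0 < q%:R :> R by exact: q_gt0.
rewrite /modulus ltr_pdivrMr // mul1r -[ltRHS](lnK) ?posrE // ltr_expR /rate.
have l0 : 0 < ln q%:R :> R by rewrite ln_gt0 // q_gt1.
by rewrite mulrAC ltr_pdivrMr ?ltr0n // ltr_pM2l.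
Qed.

Lemma modulus_term s m :
  expR (rate * complex.Re s) ^+ m * level_mass m = bseq R d' q m * modulus s ^+ m.
Proof. by rewrite /modulus /level_mass exprMn exprVn; ring. Qed.

Lemma abs_convergent_level s : (0 < d')%N ->
  @abs_convergent R k d s <-> complex.Re s < d%:R.
Proof.
move=> d0; rewrite -modulus_lt1 /abs_convergent.
rewrite (@ge0_integral_level (fun m => expR (rate * complex.Re s) ^+ m)); first last.
- by move=> m y ym; rewrite (cpow_level _ ym) normrX norm_cexp_rate -rmorphXn.
- by move=> m; rewrite exprn_ge0 ?expR_ge0.
under eq_eseriesr do rewrite modulus_term.
split=> [fin|s1].
  (* For |v| >= 1 the terms dominate [bseq m], whose partial sums exceed any bound by [bseq_lower];
     an integer above S / e gives the contradiction. *)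
  rewrite ltNge; apply/negP => s1.
  have b0 m : (0 <= (bseq R d' q m * modulus s ^+ m)%:E)%E.
    by rewrite lee_fin mulr_ge0 ?exprn_ge0 ?modulus_ge0 // bseq_ge0 // card_gt1.
  have [e e0 He] := bseq_lower R card_gt1 d0.
  move: fin; set S := (\sum_(0 <= m <oo) _)%E => fin.
  have S0 : (0 <= S)%E by apply: nneseries_ge0 => m _ _; exact: b0.
  have Sf : S \is a fin_num by rewrite ge0_fin_numE.
  have [N HN] := He (Num.bound (fine S / e)).
  have : (fine S / e) * e < (Num.bound (fine S / e))%:R * e.
    by rewrite ltr_pM2r // archi_boundP // divr_ge0 ?fine_ge0 // ltW.
  rewrite divfK ?gt_eqF // => lt1; have := lt_le_trans lt1 HN.
  apply/negP; rewrite -leNgt -lee_fin fineK //.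
  apply: (@le_trans _ _ (\sum_(0 <= m < N) (bseq R d' q m * modulus s ^+ m)%:E)%E); last first.
    by apply: nneseries_lim_ge => m _ _; exact: b0.
  rewrite sumEFin lee_fin big_mkord; apply: ler_sum => m _.
  by rewrite ler_peMr ?exprn_ege1 // bseq_ge0 // card_gt1.
have cv : cvgn (psum (bseq R d' q) (modulus s) : R^o ^nat).
  by apply: (bseq_cvg card_gt1); rewrite modulus_ge0.
have -> : (\sum_(0 <= m <oo) (bseq R d' q m * modulus s ^+ m)%:E)%E =
    (limn (psum (bseq R d' q) (modulus s)))%:E.
  rewrite -EFin_lim //; congr (limn _); apply/funext => N /=.
  by rewrite sumEFin big_mkord.
exact: ltry.
Qed.

Lemma cvg_ReIm (a b : nat -> R) (A B : R) : a @ \oo --> A -> b @ \oo --> B ->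
  (fun N => (a N +i* b N : R[i]^o)) @ \oo --> (A +i* B : R[i]^o).
Proof.
move=> /cvgrPdist_le aA /cvgrPdist_le bB; apply/cvgrPdist_le => e e0.
have [r rE] : exists r : R, e = r%:C.
  by exists (complex.Re e); case: e e0 => x y; rewrite ltcE /= => /andP[/eqP-> _].
have r0 : 0 < r / 2 by rewrite divr_gt0 //; move: e0; rewrite rE ltcR.
near=> N; apply: le_trans (norm_le_ReIm _) _; rewrite rE lecR /= [leRHS]splitr.
apply: lerD; near: N; [exact: aA|exact: bB].
Unshelve. all: by end_near. Qed.

(** [Zeta] integrates real and imaginary parts separately. Both are dominated by the modulus, so the
    real convergence for |v| < 1 applies to each. *)
Lemma Zeta_series s : complex.Re s < d%:R ->
  psum (fun m => (bseq R d' q m)%:C) (cexp (rate%:C * s) / q%:R) @ \oo -->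
    (@Zeta R k d s : R[i]^o).
Proof.
rewrite -modulus_lt1 => s1; pose v := cexp (rate%:C * s).
have cv : cvgn (series (fun m => expR (rate * complex.Re s) ^+ m * level_mass m)).
  have : cvgn (psum (bseq R d' q) (modulus s) : R^o ^nat).
    by apply: (bseq_cvg card_gt1); rewrite modulus_ge0.
  have -> // : psum (bseq R d' q) (modulus s) =
    series (fun m => expR (rate * complex.Re s) ^+ m * level_mass m).
  apply/funext => N; rewrite /series /= big_mkord.
  by apply: eq_bigr => m _; rewrite modulus_term.
have dom (g : R[i] -> R) : (forall z, `|g z|%:C <= `|z|) ->
    cvgn (series (fun m => `|g (v ^+ m)| * level_mass m)).
  move=> gz; apply: series_le_cvg cv => m.
  - by rewrite mulr_ge0 ?level_mass_ge0.
  - by rewrite mulr_ge0 ?level_mass_ge0 // exprn_ge0 ?expR_ge0.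
  rewrite ler_wpM2r ?level_mass_ge0 // -lecR; apply: le_trans (gz _) _.
  by rewrite normrX norm_cexp_rate -rmorphXn.
have psE N : psum (fun m => (bseq R d' q m)%:C) (v / q%:R) N =
    (series (fun m => complex.Re (v ^+ m) * level_mass m) N) +i*
    (series (fun m => complex.Im (v ^+ m) * level_mass m) N).
  rewrite /psum /series /= !big_mkord.
  elim: N => [|N IH]; first by rewrite !big_ord0.
  rewrite !big_ord_recr /= IH; set A := \sum_(i < N) _; set B := \sum_(i < N) _.
  have -> : (bseq R d' q N)%:C * (v / q%:R) ^+ N = v ^+ N * (level_mass N)%:C.
    by rewrite /level_mass rmorphM fmorphV rmorphXn rmorph_nat exprMn exprVn; ring.
  by case: (v ^+ N) => x y; simpc.
have -> : psum (fun m => (bseq R d' q m)%:C) (cexp (rate%:C * s) / q%:R) =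
    (fun N => series (fun m => complex.Re (v ^+ m) * level_mass m) N +i*
    series (fun m => complex.Im (v ^+ m) * level_mass m) N).
  by apply/funext => N; exact: psE.
apply: cvg_ReIm; apply: integral_level.
- by move=> m y ym; rewrite (cpow_level _ ym).
- by have := dom _ (@Re_le_norm R).
- by move=> m y ym; rewrite (cpow_level _ ym).
by have := dom _ (@Im_le_norm R).
Qed.

End Levels.

(** Near [p] the difference quotient is within 1 of the derivative D, hence at most 1 + |D|. This is
    the source of the bounded remainder at s = d. *)
Lemma derivable_quotient_bounded (R : realType) (h : R[i]^o -> R[i]^o) (p : R[i]^o) :
  derivable h p 1 -> exists M e : R, 0 < e /\
    forall z : R[i], z != 0 -> `|z| < e%:C -> `|(h (z + p) - h p) / z| <= M%:C.
Proof.
move=> /cvg_ex[D] /cvgrPdist_le /(_ 1 ltr01)[e /= e0 He].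
have [r rE] : exists r : R, e = r%:C.
  by exists (complex.Re e); case: (e) e0 => x y; rewrite ltcE /= => /andP[/eqP-> _].
have [M ME] : exists M : R, `|D| = M%:C by case: (D) => a b; eexists; rewrite normc_def.
exists (1 + M), r; split; first by rewrite -ltcR -rE.
move=> z z0 zr; have := He z; rewrite /= sub0r normrN rE => /(_ zr z0).
rewrite /= [z *: 1]mulr1 => Hz; rewrite mulrC.
rewrite -[_ * _](subrK D) rmorphD /= -ME; apply: le_trans (ler_normD _ _) _.
by rewrite lerD2r distrC.
Qed.

(** * Continuation as a rational function of u *)

Section Continuation.
Variables (R : realType) (k : finFieldType) (d' : nat).
Hypothesis d0 : (0 < d')%N.
Local Notation d := d'.+1.
Local Notation q := #|k|.
Local Notation l := ((rate R k d')%:C : R[i]).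

Let q_n0 : q%:R != 0 :> R[i].
Proof. by rewrite pnatr_eq0 -lt0n ltnW // (card_gt1 R). Qed.

(** Composition with [c] = X / q passes from v to u and moves the pole from v = 1 to u = q. Since
    u/q - 1 = (u - q)/q, a factor 1/q goes into the new [Q], and this accounts for the factor q in
    the last equation. *)
Lemma Zeta_rational : exists P Q : {poly R[i]},
  [/\ forall s, complex.Re s < d%:R ->
        (Q * ('X - q%:R%:P)).[cexp (l * s)] != 0 /\
        @Zeta R k d s = P.[cexp (l * s)] / (Q * ('X - q%:R%:P)).[cexp (l * s)],
      Q.[q%:R] != 0
    & P.[q%:R] = - (residue_sum R d' q)%:C * q%:R * Q.[q%:R]].
Proof.
have L0 := residue_sum_gt0 R (card_gt1 R k) d0.
have [P [Q [cop Q1 P1 QP]]] :=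
  simple_pole_reduce (negbT (gt_eqF L0)) (frac_at_bseq R d' (card_gt1 R k)).
pose f := real_complex R; pose c : {poly R[i]} := q%:R^-1 *: 'X.
have cE x : c.[x] = x / q%:R by rewrite hornerZ hornerX mulrC.
have QfE : map_poly f (Q * ('X - 1)) \Po c =
    (q%:R^-1 *: (map_poly f Q \Po c)) * ('X - q%:R%:P).
  rewrite rmorphM rmorphB /= map_polyX rmorph1 comp_polyM comp_polyB comp_polyX.
  rewrite -[1]polyC1 comp_polyC -scalerAl scalerAr; congr (_ * _).
  by rewrite scalerBr -[q%:R%:P]mulr1 mul_polyC scalerA mulVf // scale1r polyC1.
exists (map_poly f P \Po c), (q%:R^-1 *: (map_poly f Q \Po c)); rewrite -QfE.
have fq : f 1 = q%:R / q%:R by rewrite divff // rmorph1.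
split=> [s sd||]; first 1 last.
- rewrite hornerZ horner_comp cE -fq horner_map mulf_neq0 ?invr_eq0 //.
  by rewrite fmorph_eq0.
- rewrite hornerZ !horner_comp cE -fq !horner_map P1 rmorphM rmorphN /=.
  by field.
rewrite !horner_comp !cE; set v := _ / _.
have rec N : conv (fun i => (map_poly f (Q * ('X - 1)))`_i) (fun m => (bseq R d' q m)%:C) N
    = (map_poly f P)`_N.
  rewrite coef_map /=; have /= <- := congr1 (fun F => pscoef F N) QP.
  rewrite rmorph_sum; apply: eq_bigr => i _.
  by rewrite coef_map -rmorphM.
have ZE := psum_recurrence rec (Zeta_series sd).
(* By [ZE] a zero of the denominator in the half-plane of convergence would be a zero of the
   numerator, against coprimality. *)
have Q0 : (map_poly f (Q * ('X - 1))).[v] != 0.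
  apply/eqP => Qv; move: cop; rewrite coprimep_sym -(coprimep_map f) => /coprimep_root.
  by move=> /(_ v (introT eqP Qv)); rewrite -ZE Qv mul0r eqxx.
by split=> //; rewrite -ZE mulrAC divff // mul1r.
Qed.

End Continuation.

Section Kappa.
Variables (R : realType) (k : finFieldType) (d' : nat).
Local Notation d := d'.+1.
Local Notation q := #|k|.

Lemma kappa_residue :
  (d%:R / ln q%:R * residue_sum R d' q)%:E = kappa R d q.
Proof.
rewrite /kappa EFinM /residue_sum -sumEFin; congr (_ * _)%E.
apply: eq_bigr => j j0; rewrite EFinM; congr (_ * _)%E.
by rewrite -esum_zweight_hsum // (card_gt1 R).
Qed.

End Kappa.

Theorem theorem1p3 (R : realType) (d q : nat) (k : finFieldType)
    (d_ge2 : (2 <= d)%N) (card_k : #|k| = q) :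
  let Z : R[i] -> R[i] := @Zeta R k d in
  let u : R[i] -> R[i] := fun s => cpow (q%:R : R) (s / d%:R) in
  (forall s : R[i], @abs_convergent R k d s <-> complex.Re s < d%:R) /\
  (exists P Q : {poly R[i]},
     let Zext : R[i] -> R[i] := fun s => P.[u s] / Q.[u s] in
     [/\ forall s : R[i], complex.Re s < d%:R -> Q.[u s] != 0 /\ Z s = Zext s,
         meromorphic Zext
       & simple_pole_at Zext d%:R]) /\
  (exists kap : R,
     [/\ 0 < kap,
         kap%:E = kappa R d q
       & exists M : R, \forall s \near (d%:R : R)^'-,
           `|Z s%:C - (kap / (d%:R - s))%:C| <= M%:C]).
Proof.
case: d d_ge2 => [//|d']; rewrite ltnS -card_k => d0 Z u.
pose l : R[i] := (rate R k d')%:C.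
have uE s : u s = cexp (l * s) := cpow_rate k d' s.
have -> : u = (fun s => cexp (l * s)) by apply/funext.
have r0 := rate_gt0 R k d'.
have l0 : l != 0 by rewrite /l fmorph_eq0 gt_eqF.
have L0 := residue_sum_gt0 R (card_gt1 R k) d0.
have ld : cexp (l * d'.+1%:R) = #|k|%:R.
  rewrite -[d'.+1%:R](rmorph_nat (real_complex R)) -rmorphM cexpR /rate divfK ?pnatr_eq0 //.
  by rewrite lnK ?rmorph_nat // posrE q_gt0.
have [P [Q [ZE Qq Pq]]] := Zeta_rational R k d0.
have Q1 : Q.[cexp (l * d'.+1%:R)] != 0 by rewrite ld.
have [h [hol hd hE]] := pole_form P 1 l0 Q1.
pose kap := d'.+1%:R / ln #|k|%:R * residue_sum R d' #|k|.
have kapE : kap = residue_sum R d' #|k| / rate R k d' by rewrite /kap /rate invf_div mulrC.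
have kap0 : 0 < kap by rewrite kapE divr_gt0.
have q0 : #|k|%:R != 0 :> R[i] by rewrite pnatr_eq0 -lt0n ltnW // (card_gt1 R).
(* The derivative of u at d is q times the rate, so [h] takes the value -L / rate there; the sign
   reflects the denominator s - d in place of d - s. *)
have hkap : h d'.+1%:R = - kap%:C.
  rewrite hd expr1 ld Pq kapE fmorph_div /= -/l; field.
  by rewrite q0 l0 Qq.
rewrite ld expr1 in hE.
split; first by move=> s; exact: abs_convergent_level.
split.
  exists P, (Q * ('X - #|k|%:R%:P)); split; first exact: ZE.
    apply: meromorphic_exp_quotient => //; apply: contraTneq isT => Q0.
    (* The denominator is not the zero polynomial, as it does not vanish at s = 0, inside the
       half-plane of convergence. *)
    have [] := ZE 0; first by rewrite ltr0n.
    by rewrite Q0 horner0 eqxx.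
  exists h; split=> //; first by rewrite hkap oppr_eq0 fmorph_eq0 gt_eqF.
  by near=> s; rewrite hE expr1.
exists kap; split=> //; first exact: kappa_residue.
have /derivable_quotient_bounded[M [e [e0 HM]]] : derivable (h : R[i]^o -> R[i]^o) (d'.+1%:R : R[i]^o) 1.
  exact: nbhs_singleton hol.
exists M; near=> s.
have sd : s < d'.+1%:R by near: s; exact: nbhs_left_lt.
have se : d'.+1%:R - e < s by near: s; apply: nbhs_left_gt; rewrite gtrBl.
have dC : d'.+1%:R = (d'.+1%:R)%:C :> R[i] by rewrite rmorph_nat.
have sd0 : s - d'.+1%:R != 0 by rewrite subr_eq0 lt_eqF.
(* After removal of the polar part, what is left is exactly the difference quotient of [h] at d. *)
have -> : Z s%:C - (kap / (d'.+1%:R - s))%:C =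
    (h ((s - d'.+1%:R)%:C + d'.+1%:R) - h d'.+1%:R) / (s - d'.+1%:R)%:C.
  rewrite /Z; have [_ ->] := ZE s%:C sd; rewrite hE expr1 hkap dC -rmorphD subrK -!rmorphB /=.
  rewrite -[d'.+1%:R - s]opprB invrN mulrN rmorphN opprK fmorph_div /=.
  by rewrite mulrBl mulNr opprK.
apply: HM; first by rewrite fmorph_eq0.
rewrite normc_def /= expr0n addr0 sqrtr_sqr ltcR ltr0_norm ?subr_lt0 //.
by rewrite opprB ltrBlDr addrC -ltrBlDr.
Unshelve. all: by end_near. Qed.
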